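(* Let $\mu\in V$ with $\mu+\rho\in\mathcal C$, let $\Lambda\in\overline{\mathcal C}$, and let $\mathbf T_\Lambda:\mathcal M\to\mathcal M$ be the linear operator given by $\mathbf T_\Lambda\underline N_\mu=\underline N_{\mu+\Lambda}$. Let $\mu_0+\rho=\mu+\rho,\ \mu_1+\rho,\ \dots,\ \mu_N+\rho=\mu+\Lambda+\rho$ be the successive vertices of a piecewise linear path such that, for each $0\le i<N$, the vector $\mu_{i+1}-\mu_i$ lies in $\overline{\mathcal C}$ and is admissible for $\mu_i$ (as defined in the context). Then $$\mathbf T_\Lambda\underline N_\mu=(\mathbf P\mathbf F_{\mu_N-\mu_{N-1}})(\mathbf P\mathbf F_{\mu_{N-1}-\mu_{N-2}})\cdots(\mathbf P\mathbf F_{\mu_1-\mu_0})\,\underline N_\mu ,$$ independently of the choice of such a piecewise linear path.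
   Context: **Alcove geometry.** $\Delta$ is the root system of a simple Lie algebra $\mathfrak g$ with positive roots $\Delta_+$, finite Weyl group $W$, weight lattice $X$, $V=X\otimes_{\mathbb Z}\mathbb R$, and bilinear form $\cdot$ normalized by $\alpha\cdot\alpha=2$ for short roots; $\theta$ is the highest root, $\rho$ is half the sum of the positive roots, and $l$ is a positive integer larger than the dual Coxeter number of $\mathfrak g$. For $\alpha\in\Delta_+$, $r\in\mathbb Z$ put $E_{\alpha,r}=\{x\in V: x\cdot\alpha=r\}$, with positive side $\{x\cdot\alpha>r\}$ and negative side $\{x\cdot\alpha<r\}$. $\mathcal W$ is the group generated by $W$ and the affine reflection in $E_{\theta,l}$; $w(x)$ denotes its defining action on $V$, and $w.x=w(x+\rho)-\rho$. $\mathcal E=\{E_{\alpha,ml}:\alpha\in\Delta_+,m\in\mathbb Z\}$; alcoves are the connected components of $V\setminus\bigcup_{E\in\mathcal E}E$. $\mathcal C=\{x: x\cdot\alpha>0 \text{ for all simple }\alpha\}$ is the (open) dominant Weyl chamber with closure $\overline{\mathcal C}$, $\mathcal A_+$ the set of alcoves contained in $\mathcal C$, and $A_+=\mathcal C\cap\{x\cdot\theta<l\}$. A facet is a nonempty set $F\subset V$ of all points satisfying, for each $\alpha\in\Delta_+$, either one condition $x\cdot\alpha=m_\alpha l$ or one condition $m_\alpha l<x\cdot\alpha<(m_\alpha+1)l$ ($m_\alpha\in\mathbb Z$). $A_+(F)$ is the alcove containing $F$ in its closure which lies on the positive side of every hyperplane of $\mathcal E$ containing $F$. $F(x)$ denotes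 the facet containing the point $x$. For facets $F\subset\overline{G}$, $\mathbf a_F(G)$ (resp. $\mathbf b_F(G)$) is the number of hyperplanes in $\mathcal E$ containing $F$ which have $G$ on their negative (resp. positive) side. **Hecke module.** $\mathcal S$ is the set of reflections in the walls of $A_+$; $(\mathcal W,\mathcal S)$ is a Coxeter group with length function $\ell$. $\mathcal H$ is its Hecke algebra over $\mathbb Z[v,v^{-1}]$, with basis $H_x$, $x\in\mathcal W$, satisfying $H_xH_y=H_{xy}$ if $\ell(xy)=\ell(x)+\ell(y)$ and $H_s^2=1+(v^{-1}-v)H_s$ for $s\in\mathcal S$; it has the ring involution $\bar v=v^{-1}$, $\overline{H_x}=(H_{x^{-1}})^{-1}$. $\mathcal N=\mathbb Z[v,v^{-1}]\otimes_{\mathcal H_f}\mathcal H$ is the right $\mathcal H$-module induced from the sign representation $H_s\mapsto -v$ of the Hecke algebra $\mathcal H_f$ of $W$. It has basis $N_x=1\otimes H_x$, $x\in\mathcal W^f$ (minimal length representatives of the cosets $Wx$), and the involution $\overline{a\otimes b}=\bar a\otimes\bar b$; fixed elements are called self-dual. $\mathcal N$ has a unique basis of self-dual elements $\underline N_x\in N_x+\sum_{y<x}v\mathbb Z[v]N_y$; write $\underline N_x=N_x+\sum_{y<x}n_{y,x}N_y$, and $n_{x,x}=1$, $n_{y,x}=0$ if $y\not\le x$ (Bruhat order). The bijection $x\mapsto xA_+$ from $\mathcal W^f$ to $\mathcal A_+$ is used to index these objects by alcoves: $N_A,\underline N_A,n_{B,A}$; $\prec$ is the order on $\mathcal A_+$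 corresponding to the Bruhat order on $\mathcal W^f$ (so for $s\in\mathcal S$ with $A,As\in\mathcal A_+$, where $(wA_+)s=wsA_+$, $As\succ A$ iff $As$ is on the positive side of the hyperplane separating $A$ and $As$). **Points.** For $\mu\in V$ with $\mu+\rho\in\mathcal C$ let $A_+(\mu)=A_+(F(\mu+\rho))$. For two such points, $n_{\lambda\mu}=n_{A_+(\lambda),A_+(\mu)}$ if $\lambda\in\mathcal W.\mu$ and $n_{\lambda\mu}=0$ otherwise. $\mathcal M$ is the free $\mathbb Z[v,v^{-1}]$-module with basis $\{N_\lambda:\lambda+\rho\in\mathcal C\}$, and $\underline N_\mu=\sum_\lambda n_{\lambda\mu}N_\lambda\in\mathcal M$; the elements $\underline N_\mu$ also form a basis of $\mathcal M$. An element of $\mathcal M$ is self-dual if it is a linear combination of elements $\underline N_\mu$ with coefficients in $\mathbb Z[v,v^{-1}]_0=\{f:\bar f=f\}$. For $\lambda\in\mathcal W.\mu$, $\lambda<\mu$ means $A_+(\lambda)\prec A_+(\mu)$. **Admissible vectors and $\mathbf F_\Lambda$.** (Here $\mu$ is any point with $\mu+\rho\in\mathcal C$ and $\Lambda\in V$ any vector.) $\Lambda$ is admissible for $\mu$ if, with $F_0=F(\mu+\rho)$ and $F_1=F(\mu+\rho+\Lambda)$, there is a facet $F$ contained in the closures of both $F_0$ and $F_1$ such that the segment from $\mu+\rho$ to $\mu+\rho+\Lambda$ meets $F$ and is contained in $F_0\cup F\cup F_1$ (the degenerate cases $F=F_0$ and $F=F_1$ are allowed). For $\lambda=w.\mu$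 ($w\in\mathcal W$) with $\lambda+\rho\in\mathcal C$ put $F'=w(F)$ and let $O_\lambda$ be the orbit of the point $w(\mu+\rho+\Lambda)$ under the group generated by the reflections in the hyperplanes of $\mathcal E$ containing $F'$ (these do not depend on the choice of $w$). Define $$\mathbf F^{(\lambda)}=\begin{cases}0&\text{if }F'\not\subset\mathcal C,\\ \sum_{\gamma:\,\gamma+\rho\in O_\lambda}v^{\mathbf a_{F'}(F(\gamma+\rho))-\mathbf b_{F'}(F(\lambda+\rho))}N_\gamma&\text{if }F'\subset\mathcal C,\end{cases}\qquad \mathbf F_\Lambda\underline N_\mu=\sum_{\lambda\in\mathcal W.\mu,\ \lambda+\rho\in\mathcal C}n_{\lambda\mu}\,\mathbf F^{(\lambda)} .$$ **Positivity operator $\mathbf P$.** Let $R=\sum_{\lambda\le\nu}a_\lambda N_\lambda$ be self-dual with $a_\lambda\in\mathbb Z[v,v^{-1}]$, $a_\nu=1$. Let $i_0$ be the smallest exponent of $v$ occurring in any $a_\lambda$ with $\lambda<\nu$. If $i_0>0$, put $\mathbf PR=R$. If $i_0<0$, replace $R$ by $R-\sum_{\lambda<\nu}(v^{i_0}+v^{-i_0})\,c_\lambda\,\underline N_\lambda$, where $c_\lambda$ is the coefficient of $v^{i_0}$ in $a_\lambda$; if $i_0=0$, replace $R$ by $R-\sum_{\lambda<\nu}c_\lambda\underline N_\lambda$, where $c_\lambda$ is the constant coefficient of $a_\lambda$. Iterate until all $a_\lambda$, $\lambda<\nu$, lie in $v\mathbb Z[v]$; the result is $\mathbf PR$. In the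 composition in the claim, the operator $\mathbf P\mathbf F_{\mu_{i+1}-\mu_i}$ is applied to $\underline N_{\mu_i}$. *)

(* Defs.v *)
From HB Require Import structures.
From mathcomp Require Import all_boot all_order all_algebra.
From mathcomp Require Import all_classical all_reals all_analysis.
From mathcomp Require Import finmap ring.

Set Implicit Arguments.
Unset Strict Implicit.
Unset Printing Implicit Defensive.

Import Order.TTheory GRing.Theory Num.Theory.
Import numFieldNormedType.Exports.

Local Open Scope classical_set_scope.
Local Open Scope ring_scope.

(* Throughout, an object that the mathematics singles out by a property is     *)
(* obtained with [xget d P], which is some element of P, or d if P is empty.   *)

(* Z[v, v^-1] is realised inside the fraction field of Z[v]. *)
Definition vfrac : {fraction {poly int}} := FracField.tofrac 'X.

Definition laurent_pred : pred {fraction {poly int}} :=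
  fun f => `[< exists (p : {poly int}) (k : nat),
                 f = FracField.tofrac p / vfrac ^+ k >].

Lemma vfrac_neq0 : vfrac != 0.
Proof. by rewrite /vfrac tofrac_eq0 polyX_eq0. Qed.

Lemma subf_div (F : fieldType) (a b c d : F) : c != 0 -> d != 0 ->
  a / c - b / d = (a * d - b * c) / (c * d).
Proof. by move=> c0 d0; rewrite -mulNr addf_div // mulNr. Qed.

Lemma laurent_subring : subring_closed laurent_pred.
Proof.
have vk k : vfrac ^+ k != 0 by rewrite expf_neq0 ?vfrac_neq0.
split.
- by apply/asboolP; exists 1, 0; rewrite rmorph1 expr0 divr1.
- move=> x y /asboolP[p [k ->]] /asboolP[q [m ->]]; apply/asboolP.
  exists (p * 'X ^+ m - q * 'X ^+ k), (k + m).
  rewrite rmorphB !rmorphM !rmorphXn /= -/vfrac exprD.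
  exact: (@subf_div {fraction {poly int}}) (vk k) (vk m).
- move=> x y /asboolP[p [k ->]] /asboolP[q [m ->]]; apply/asboolP.
  by exists (p * q), (k + m); rewrite rmorphM exprD mulf_div.
Qed.

Record laurent := Laurent
  { laurent_val :> {fraction {poly int}}; _ : laurent_pred laurent_val }.
HB.instance Definition _ := [isSub for laurent_val].
HB.instance Definition _ := [Choice of laurent by <:].
HB.instance Definition _ :=
  GRing.SubChoice_isSubComNzRing.Build _ laurent_pred laurent laurent_subring.

Lemma vpow_subproof (i : int) : laurent_pred (vfrac ^ i).
Proof.
apply/asboolP; case: i => k.
- by exists ('X ^+ k), 0; rewrite expr0 divr1 rmorphXn.
- by exists 1, k.+1; rewrite rmorph1 div1r NegzE exprnN.
Qed.

Definition vpow (i : int) : laurent := Laurent (vpow_subproof i).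

(* The coefficient of v^i: if f = p / v^k, it is that of v^(i + k) in p. *)
Definition lcoef (f : laurent) (i : int) : int :=
  let pk := xget (0 : {poly int}, 0%N)
    [set pk | laurent_val f = FracField.tofrac pk.1 / vfrac ^+ pk.2] in
  if i + pk.2%:Z is Posz j then pk.1`_j else 0.

Definition lbar (f : laurent) : laurent :=
  \sum_(i \in [set: int]) vpow (- i) *~ lcoef f i.

Definition in_vZv (f : laurent) : Prop := forall i, (i <= 0)%R -> lcoef f i = 0.

(* The free K-module with basis D, as functions on T with finite support       *)
(* contained in D.                                                             *)
Definition freemod_pred (K : comNzRingType) (T : choiceType) (D : set T) :
    pred (T -> K^o) :=
  fun f => `[< finite_set [set x | f x != 0] /\ [set x | f x != 0] `<=` D >].

Lemma freemod_submod (K : comNzRingType) (T : choiceType) (D : set T) :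
  subsemimod_closed (@freemod_pred K T D).
Proof.
split; first split.
- apply/asboolP; split.
    by rewrite (_ : [set _ | _] = set0) // -subset0 => x /=; rewrite eqxx.
  by move=> x /=; rewrite eqxx.
- move=> f g /asboolP[ff fD] /asboolP[gf gD]; apply/asboolP.
  have sub : [set x | (f + g) x != 0] `<=` [set x | f x != 0] `|` [set x | g x != 0].
    move=> x /=; case: (eqVneq (f x) 0) => [fx0|]; last by left.
    by rewrite /GRing.add /= fx0 add0r; right.
  split; first by apply: sub_finite_set sub _; rewrite finite_setU.
  by move=> x /sub[/fD|/gD].
- move=> a f /asboolP[ff fD]; apply/asboolP.
  have sub : [set x | (a *: f) x != 0] `<=` [set x | f x != 0].
    move=> x /=; apply: contra => /eqP fx0.
    by rewrite {1}/GRing.scale /= fx0 scaler0.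
  by split; [exact: sub_finite_set sub ff | exact: subset_trans sub fD].
Qed.

Record freemod (K : comNzRingType) (T : choiceType) (D : set T) := FreeMod
  { fmcoef :> T -> K^o; _ : freemod_pred D fmcoef }.

Section FreeModule.
Variables (K : comNzRingType) (T : choiceType) (D : set T).

HB.instance Definition _ := [isSub for @fmcoef K T D].
HB.instance Definition _ := [Choice of freemod K D by <:].
HB.instance Definition _ := GRing.SubChoice_isSubLmodule.Build K (T -> K^o)
  (@freemod_pred K T D) (freemod K D) (@freemod_submod K T D).

(* The basis element indexed by x; it is 0 if x is not in D. *)
Definition fmbasis (x : T) : freemod K D :=
  insubd (0 : freemod K D) (fun y => (y == x)%:R : K^o).

End FreeModule.

Section Hecke.
Variables (G : groupType) (S : set G).

Definition is_word (k : nat) (x : G) : Prop :=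
  exists s : seq G, [/\ size s = k, forall g, g \in s -> S g
                      & x = (\prod_(g <- s) g)%g].

Definition clength (x : G) : nat :=
  xget 0%N [set k | is_word k x /\ forall j, is_word j x -> (k <= j)%N].

Definition creflection (t : G) : Prop :=
  exists g s : G, S s /\ t = (g * s * g^-1)%g.

Inductive bruhat_le (x : G) : G -> Prop :=
| bruhat_refl : bruhat_le x x
| bruhat_step y t : bruhat_le x y -> creflection t ->
    (clength y < clength (y * t)%g)%N -> bruhat_le x (y * t)%g.

Definition bruhat_lt (x y : G) : Prop := bruhat_le x y /\ x <> y.

(* The representatives of minimal length of the cosets Wx. *)
Definition min_rep (W : set G) (x : G) : Prop :=
  forall w, W w -> (clength x <= clength (w * x)%g)%N.

Record hecke_algebra := HeckeAlgebra {
  hk_alg :> algType laurent;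
  hk_H : G -> hk_alg;
  hk_basis : forall h : hk_alg, exists! c : G -> laurent,
    finite_set [set x | c x != 0] /\ h = \sum_(x \in [set: G]) c x *: hk_H x;
  hk_mul : forall x y, clength (x * y)%g = (clength x + clength y)%N ->
    hk_H x * hk_H y = hk_H (x * y)%g;
  hk_quad : forall s, S s ->
    hk_H s ^+ 2 = 1 + (vpow (-1) - vpow 1) *: hk_H s;
  hk_bar : hk_alg -> hk_alg;
  hk_barD : forall h h', hk_bar (h + h') = hk_bar h + hk_bar h';
  hk_barM : forall h h', hk_bar (h * h') = hk_bar h * hk_bar h';
  hk_barZ : forall a h, hk_bar (a *: h) = lbar a *: hk_bar h;
  hk_barH : forall x, hk_bar (hk_H x) * hk_H x^-1%g = 1 /\
                      hk_H x^-1%g * hk_bar (hk_H x) = 1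
}.

(* The tensor product of Z[v, v^-1] with the Hecke algebra over the Hecke      *)
(* algebra of W, which acts on Z[v, v^-1] by the sign representation           *)
(* H_s |-> -v (s in S and W).  It is the quotient of the Hecke algebra by the  *)
(* relations 1 (x) H_s h = (-v) (x) h, and a (x) h is [a *: ind_tens h].       *)
Record induced_sign (W : set G) (Hk : hecke_algebra) := InducedSign {
  ind_mod :> lmodType laurent;
  ind_act : ind_mod -> Hk -> ind_mod;
  ind_tens : {linear Hk -> ind_mod};
  ind_tens_act : forall h h', ind_act (ind_tens h) h' = ind_tens (h * h');
  ind_tens_surj : forall m, exists h, m = ind_tens h;
  ind_tens_ker : forall h, ind_tens h = 0 <->
    exists r : seq (G * Hk),
      (forall p, p \in r -> S p.1 /\ W p.1) /\
      h = \sum_(p <- r) (hk_H Hk p.1 * p.2 + vpow 1 *: p.2);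
  ind_bar : ind_mod -> ind_mod;
  ind_barD : forall m m', ind_bar (m + m') = ind_bar m + ind_bar m';
  ind_bar_tens : forall a h,
    ind_bar (a *: ind_tens h) = lbar a *: ind_tens (hk_bar h)
}.

(* [n y x] is the coefficient n_{y,x} of the self-dual basis of the induced    *)
(* module; it is determined by this property for x of minimal length.          *)
Definition is_kl_family (W : set G) (Hk : hecke_algebra)
    (N : induced_sign W Hk) (n : G -> G -> laurent) : Prop :=
  forall x, min_rep W x ->
    [/\ n x x = 1,
        forall y, n y x != 0 -> min_rep W y /\ bruhat_le y x,
        forall y, bruhat_lt y x -> in_vZv (n y x),
        finite_set [set y | n y x != 0]
      & let Nx := \sum_(y \in [set: G]) n y x *: ind_tens N (hk_H Hk y) in
        ind_bar Nx = Nx].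

End Hecke.

(* An irreducible reduced crystallographic root system of rank n, with a base, *)
(* in a Euclidean space R^n whose scalar product is 2 on short roots.          *)
Record root_system (R : realType) (n : nat) := RootSystem {
  dot : 'rV[R]_n -> 'rV[R]_n -> R;
  dotC : forall x y, dot x y = dot y x;
  dotDl : forall x y z, dot (x + y) z = dot x z + dot y z;
  dotZl : forall c x y, dot (c *: x) y = c * dot x y;
  dot_gt0 : forall x, x != 0 -> 0 < dot x x;
  is_root : set 'rV[R]_n;
  root_finite : finite_set is_root;
  root_neq0 : ~ is_root 0;
  root_refl : forall a b, is_root a -> is_root b ->
    is_root (b - (2 * dot b a / dot a a) *: a);
  root_int : forall a b, is_root a -> is_root b ->
    2 * dot b a / dot a a \is a Num.int;
  root_reduced : forall a c, is_root a -> is_root (c *: a) -> c = 1 \/ c = -1;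
  root_irreducible : forall A : set 'rV[R]_n, A `<=` is_root -> A !=set0 ->
    (forall a b, A a -> (is_root `\` A) b -> dot a b = 0) -> A = is_root;
  root_short : (forall a, is_root a -> 2 <= dot a a) /\
               (exists a, is_root a /\ dot a a = 2);
  simple : 'I_n -> 'rV[R]_n;
  simple_root : forall i, is_root (simple i);
  simple_free : forall c : 'I_n -> R,
    \sum_(i < n) c i *: simple i = 0 -> forall i, c i = 0;
  simple_base : forall a, is_root a -> exists c : 'I_n -> nat,
    a = \sum_(i < n) simple i *+ c i \/ a = - \sum_(i < n) simple i *+ c i;
  theta : 'rV[R]_n;
  theta_root : is_root theta;
  theta_highest : forall a, is_root a -> exists c : 'I_n -> nat,
    theta - a = \sum_(i < n) simple i *+ c i
}.

Definition card_set (T : choiceType) (A : set T) : nat := #|` fset_set A|%fset.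

Inductive generated (T : Type) (A : set (T -> T)) : set (T -> T) :=
| generated_id : generated A id
| generated_comp g w : A g -> generated A w -> generated A (g \o w).

Lemma generatedM (T : Type) (A : set (T -> T)) (g w : T -> T) :
  generated A g -> generated A w -> generated A (g \o w).
Proof.
elim=> {g} [|g u Ag _ IH] // Gw.
exact: (generated_comp Ag (IH Gw)).
Qed.

Lemma generatedV (T : Type) (A : set (T -> T)) :
    (forall g, A g -> g \o g = id) -> forall w, generated A w ->
  exists w', [/\ generated A w', w' \o w = id & w \o w' = id].
Proof.
move=> invA w; elim=> {w} [|g w Ag _ [w' [Gw' w'w ww']]].
  by exists id; split=> //; exact: generated_id.
have gg x : g (g x) = x by have := congr1 (fun f => f x) (invA g Ag).
have e1 x : w' (w x) = x by have := congr1 (fun f => f x) w'w.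
have e2 x : w (w' x) = x by have := congr1 (fun f => f x) ww'.
exists (w' \o g); split.
- apply: generatedM => //; rewrite -[g]/(g \o id).
  exact: (generated_comp Ag (generated_id A)).
- by apply: funext => x /=; rewrite gg e1.
- by apply: funext => x /=; rewrite e2 gg.
Qed.

Section Geometry.
Variables (R : realType) (n : nat) (rs : root_system R n).
Local Notation V := 'rV[R]_n.

Definition pos_root : set V := [set a | is_root rs a /\
  exists c : 'I_n -> nat, a = \sum_(i < n) simple rs i *+ c i].

Definition rho : V := 2^-1 *: \sum_(a \in pos_root) a.

(* rho paired with the coroot of the highest root, plus 1 *)
Definition dual_coxeter : R :=
  1 + 2 * dot rs rho (theta rs) / dot rs (theta rs) (theta rs).

Definition chamber : set V := [set x | forall i, 0 < dot rs x (simple rs i)].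

Definition dominant : set V := [set mu | chamber (mu + rho)].

Definition aff_refl (a : V) (r : R) : V -> V :=
  fun x => x - (2 * (dot rs x a - r) / dot rs a a) *: a.

Lemma aff_reflK a r : is_root rs a -> aff_refl a r \o aff_refl a r = id.
Proof.
move=> ra; apply: funext => x; rewrite /aff_refl /=.
have a0 : dot rs a a != 0.
  by rewrite gt_eqF ?dot_gt0 //; apply/eqP => E; apply: (root_neq0 (r:=rs)); rewrite -E.
set t := 2 * _ / _.
have -> : dot rs (x - t *: a) a = dot rs x a - t * dot rs a a.
  by rewrite dotDl -scaleNr dotZl mulNr.
have -> : 2 * (dot rs x a - t * dot rs a a - r) / dot rs a a = - t.
  by rewrite /t; field.
by rewrite scaleNr opprK addrNK.
Qed.

Definition weyl_refls : set (V -> V) :=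
  [set g | exists2 a, is_root rs a & g = aff_refl a 0].

(* Reflections are involutions, so [generated] yields a group in each use. *)
Definition weyl : set (V -> V) := generated weyl_refls.

Variable l : nat.

Definition aff_weyl_gens : set (V -> V) :=
  weyl_refls `|` [set aff_refl (theta rs) l%:R].

Definition aff_weyl : set (V -> V) := generated aff_weyl_gens.

Lemma aff_weyl_gensK g : aff_weyl_gens g -> g \o g = id.
Proof.
case=> [[a ra ->]|->]; first exact: aff_reflK.
by apply: aff_reflK; exact: theta_root.
Qed.

(* The hyperplane E_{a,ml} is encoded by the pair (a, m) with a a positive     *)
(* root.  As the root system is reduced, distinct pairs give distinct          *)
(* hyperplanes, so that counting pairs is counting hyperplanes.                *)
Definition is_hyp (p : V * int) : Prop := pos_root p.1.

Definition hyp (p : V * int) : set V :=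
  [set x | dot rs x p.1 = p.2%:~R * l%:R].
Definition pos_side (p : V * int) : set V :=
  [set x | p.2%:~R * l%:R < dot rs x p.1].
Definition neg_side (p : V * int) : set V :=
  [set x | dot rs x p.1 < p.2%:~R * l%:R].

Definition hyp_refl (p : V * int) : V -> V := aff_refl p.1 (p.2%:~R * l%:R).

Definition hyp_complement : set V :=
  [set x | forall p, is_hyp p -> ~ hyp p x].

Definition alcove (A : set V) : Prop :=
  exists2 x, hyp_complement x & A = connected_component hyp_complement x.

Definition fund_alcove : set V :=
  chamber `&` [set x | dot rs x (theta rs) < l%:R].

Definition facet (F : set V) : Prop :=
  F !=set0 /\ exists (m : V -> int) (on : V -> bool),
    F = [set x | forall a, pos_root a ->
           if on a then dot rs x a = (m a)%:~R * l%:R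
           else (m a)%:~R * l%:R < dot rs x a < (m a + 1)%:~R * l%:R].

Definition facet_of (x : V) : set V := xget set0 [set F | facet F /\ F x].

Definition upper_alcove (F : set V) : set V :=
  xget set0 [set A | [/\ alcove A, F `<=` closure A
    & forall p, is_hyp p -> F `<=` hyp p -> A `<=` pos_side p]].

(* The numbers a_F(G) and b_F(G), for F contained in the closure of G. *)
Definition num_neg (F G : set V) : nat :=
  card_set [set p | [/\ is_hyp p, F `<=` hyp p & G `<=` neg_side p]].
Definition num_pos (F G : set V) : nat :=
  card_set [set p | [/\ is_hyp p, F `<=` hyp p & G `<=` pos_side p]].

(* p is a wall of the alcove A if it is the support of a face of A, i.e. the   *)
(* only hyperplane containing some facet in the closure of A.                  *)
Definition wall (A : set V) (p : V * int) : Prop :=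
  is_hyp p /\ exists F, [/\ facet F, F `<=` closure A
    & forall q, is_hyp q -> (F `<=` hyp q <-> q = p)].

Record affW := AffW { affW_val :> V -> V; _ : `[< aff_weyl affW_val >] }.
HB.instance Definition _ := [isSub for affW_val].
HB.instance Definition _ := [Choice of affW by <:].

Lemma affWP (w : affW) : aff_weyl w.
Proof. by case: w => w /= /asboolP. Qed.

Definition affW1 : affW := AffW (asboolT (generated_id aff_weyl_gens)).
Definition affWM (g w : affW) : affW :=
  AffW (asboolT (generatedM (affWP g) (affWP w))).
Definition affWV (w : affW) : affW :=
  let e := cid (generatedV aff_weyl_gensK (affWP w)) in
  AffW (asboolT (let: And3 Gw' _ _ := projT2 e in Gw')).

Lemma affWMA : associative affWM.
Proof. by move=> x y z; apply: val_inj. Qed.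
Lemma affW1M : left_id affW1 affWM.
Proof. by move=> x; apply: val_inj. Qed.
Lemma affWM1 : right_id affW1 affWM.
Proof. by move=> x; apply: val_inj. Qed.
Lemma affWVM : left_inverse affW1 affWV affWM.
Proof. by move=> w; apply: val_inj; rewrite /= /affWV; case: cid => w' []. Qed.
Lemma affWMV : right_inverse affW1 affWV affWM.
Proof. by move=> w; apply: val_inj; rewrite /= /affWV; case: cid => w' []. Qed.

HB.instance Definition _ :=
  isGroup.Build affW affWMA affW1M affWM1 affWVM affWMV.

Definition affS : set affW :=
  [set s | exists2 p, wall fund_alcove p & affW_val s = hyp_refl p].

Definition finW : set affW := [set w | weyl (affW_val w)].

(* x in W^f with x A_+ = A *)
Definition alcove_elt (A : set V) : affW :=
  xget 1%g [set x | min_rep affS finW x /\ affW_val x @` fund_alcove = A].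

(* The linkage relation lam \in W.mu for the dot action. *)
Definition linked (lam mu : V) : Prop :=
  exists2 w, aff_weyl w & lam = w (mu + rho) - rho.

Definition point_alcove (mu : V) : set V := upper_alcove (facet_of (mu + rho)).

Definition point_lt (lam mu : V) : Prop :=
  [/\ dominant lam, dominant mu, linked lam mu
    & bruhat_lt affS (alcove_elt (point_alcove lam))
                     (alcove_elt (point_alcove mu))].

Definition pointmod := freemod laurent dominant.

Definition Npt (lam : V) : pointmod := fmbasis laurent dominant lam.

(* Below, [kl] is the family n_{y,x} indexed by the affine Weyl group. *)
Variable kl : affW -> affW -> laurent.

Definition nkl (B A : set V) : laurent := kl (alcove_elt B) (alcove_elt A).

Definition npt (lam mu : V) : laurent :=
  if `[< linked lam mu >] then nkl (point_alcove lam) (point_alcove mu) else 0.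

Definition uN (mu : V) : pointmod :=
  \sum_(lam \in dominant) npt lam mu *: Npt lam.

(* Unique, since the uN mu form a basis. *)
Definition uN_coord (m : pointmod) : V -> laurent :=
  xget (fun=> 0) [set c | [/\ finite_set [set mu | c mu != 0],
    [set mu | c mu != 0] `<=` dominant
    & m = \sum_(mu \in dominant) c mu *: uN mu]].

(* The linear operator on M sending uN mu to f mu. *)
Definition uN_linear (f : V -> pointmod) (m : pointmod) : pointmod :=
  \sum_(mu \in dominant) uN_coord m mu *: f mu.

Definition self_dual (m : pointmod) : Prop :=
  exists c : V -> laurent, [/\ finite_set [set mu | c mu != 0],
    [set mu | c mu != 0] `<=` dominant, forall mu, lbar (c mu) = c mu
    & m = \sum_(mu \in dominant) c mu *: uN mu].

Definition Top (Lam : V) : pointmod -> pointmod :=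
  uN_linear (fun mu => uN (mu + Lam)).

Definition segment (x Lam : V) : set V :=
  [set x + t *: Lam | t in `[0, 1]%classic].

Definition admissible_via (mu Lam : V) (F : set V) : Prop :=
  let F0 := facet_of (mu + rho) in
  let F1 := facet_of (mu + rho + Lam) in
  [/\ facet F, F `<=` closure F0, F `<=` closure F1,
      (segment (mu + rho) Lam `&` F) !=set0
    & segment (mu + rho) Lam `<=` F0 `|` F `|` F1].

Definition admissible (mu Lam : V) : Prop := exists F, admissible_via mu Lam F.

(* The facet F is unique when Lam is admissible for mu, and the result does not *)
(* depend on the choice of w.                                                  *)
Definition Fterm (Lam mu lam : V) : pointmod :=
  let F := xget set0 [set F | admissible_via mu Lam F] in
  let w : V -> V := xget (id : V -> V) [set w | aff_weyl w /\ lam = w (mu + rho) - rho] in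
  let F' := w @` F in
  let stab := generated [set g | exists p,
                [/\ is_hyp p, F' `<=` hyp p & g = hyp_refl p]] in
  let O := [set y | exists2 g, stab g & y = g (w (mu + rho + Lam))] in
  if `[< F' `<=` chamber >] then
    \sum_(gam \in [set gam | O (gam + rho)])
      vpow ((num_neg F' (facet_of (gam + rho)))%:Z
            - (num_pos F' (facet_of (lam + rho)))%:Z) *: Npt gam
  else 0.

(* The linear extension of the formula for F_Lam (uN mu); only its values at   *)
(* the uN mu with Lam admissible for mu are meaningful.                        *)
Definition Fop (Lam : V) : pointmod -> pointmod :=
  uN_linear (fun mu =>
    \sum_(lam \in [set lam | dominant lam /\ linked lam mu])
      npt lam mu *: Fterm Lam mu lam).

(* The domain of P: self-dual, with leading term N_nu. *)
Definition Pdom (nu : V) (m : pointmod) : Prop :=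
  [/\ self_dual m, m nu = 1
    & forall lam, m lam != 0 -> lam = nu \/ point_lt lam nu].

(* The smallest exponent occurring strictly below nu, and 1 if there is none. *)
Definition low_exp (nu : V) (m : pointmod) : int :=
  xget 1 [set i | (exists2 lam, point_lt lam nu & lcoef (m lam) i != 0) /\
    forall j lam, point_lt lam nu -> lcoef (m lam) j != 0 -> i <= j].

Definition Pstep (nu : V) (m : pointmod) : pointmod :=
  let i0 := low_exp nu m in
  let below := [set lam | point_lt lam nu] in
  if i0 < 0 then
    m - \sum_(lam \in below)
          ((vpow i0 + vpow (- i0)) *~ lcoef (m lam) i0) *: uN lam
  else if i0 == 0 then
    m - \sum_(lam \in below) ((1 : laurent) *~ lcoef (m lam) 0) *: uN lam
  else m.

Definition Piter (nu : V) (m : pointmod) : pointmod :=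
  let k := xget 0%N [set k | forall lam, point_lt lam nu ->
                              in_vZv (iter k (Pstep nu) m lam)] in
  iter k (Pstep nu) m.

(* P is given the value 0 outside its domain. *)
Definition Pop (m : pointmod) : pointmod :=
  if pselect (exists nu, Pdom nu m) is left e then Piter (projT1 (cid e)) m
  else 0.

(* (P F_(mu_N - mu_(N-1))) ... (P F_(mu_1 - mu_0)) m for the path mu_0 mu_1 .. *)
Fixpoint path_op (mu_ : nat -> V) (N : nat) (m : pointmod) : pointmod :=
  if N is N'.+1 then Pop (Fop (mu_ N'.+1 - mu_ N') (path_op mu_ N' m)) else m.

End Geometry.

Arguments affS {R n} rs l.
Arguments finW {R n} rs l.

(* Main.v *)
Require Import Defs.
From HB Require Import structures.
From mathcomp Require Import all_boot all_order all_algebra.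
From mathcomp Require Import all_classical all_reals all_analysis.
From mathcomp Require Import finmap ring lra zify.
Import Order.TTheory GRing.Theory Num.Theory.
Import numFieldNormedType.Exports.
Set Implicit Arguments.
Unset Strict Implicit.
Unset Printing Implicit Defensive.
Local Open Scope classical_set_scope.
Local Open Scope ring_scope.

(** Both sides of the identity are the self-dual basis element at mu + Lam.  For the
    left-hand side this is the definition of T.  For the right-hand side it suffices to
    treat one step of the path, i.e. to show that P F (uN mu) = uN (mu + Lam) if Lam is
    dominant and admissible for mu.  As a self-dual element with leading term N_nu is
    turned by P into uN nu ([Pop_uN]: a self-dual element of M whose coefficients all
    lie in v Z[v] is 0), the claim is that R = F (uN mu) is self-dual
    with leading term N_nu, where nu = mu + Lam ([Fop_dom]).

    The proof takes place in the antispherical module.  The affine Weyl group acts on V,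
    and every point y has a unique representative f in the closed fundamental alcove and
    an element [ue y] carrying the fundamental alcove to the alcove above y, with
    y = ue y f.  The points of the orbit of f correspond to the cosets of the stabiliser
    of f, and [phi f] sends N_lam to a weighted sum of the N_g over the coset of lam.  The
    weights are such that uN mu goes to the Kazhdan-Lusztig element KL of the alcove above
    mu + rho ([phi_uN]).  This rests on the descent relations: KL_x (H_s - v^-1) = 0 when
    x s < x ([KL_descent_eq0]).  In particular self-duality in M can be tested on the image
    under phi ([phi_self_dual]).

    Let p0 be a point of the segment in the intermediate facet F, and let f0, f, f1 be the
    representatives of mu + rho, p0 and nu + rho.  The stabiliser of f contains those of
    f0 and f1, as F lies in the closures of the facets of both end points.  Let E be the
    sum of v^-l(u) H_u over the stabiliser of f.  Multiplying KL_x, for x the alcove above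
    mu + rho, by the bar conjugate of E adds up over the alcoves around the points of the
    facets w F, and this is what F does on points: the product is
    v^d P(f0) phi_{f1}(R), with P(f0) the Poincare polynomial of the stabiliser of f0 and
    d the number of hyperplanes that contain p0 and not mu + rho ([grouped]).  The powers of v
    match since the length of [ue y] is the number of hyperplanes separating the alcove above
    y from the fundamental alcove ([dist_len], [len_spec]).  As E is self-dual up to the
    scalar P(f) ([poinc_symm]) and KL_x is self-dual, phi_{f1}(R) is self-dual up to a
    scalar, and the scalar is 1 because the leading coefficient is 1 ([Rsum_self_dual]).

    The leading term is located by the lifting property of the Bruhat order.  Since Lam is
    dominant, no hyperplane through F has nu + rho on its negative side or mu + rho on
    its positive side.  Hence [ue (nu + rho)] = [ue p0], which is maximal in its coset of the
    stabiliser of f, so everything reached from below mu stays below it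
    ([bruhat_coset_max], [Rsum_supp], [Rsum_top]). *)

(** * Laurent polynomials *)

(** Two representations p / v^k and q / v^m of f satisfy p X^m = q X^k, so the shifted
    coefficients agree. *)
Lemma lcoef_repr (f : laurent) (p : {poly int}) (k : nat) (i : int) :
  laurent_val f = FracField.tofrac p / vfrac ^+ k ->
  lcoef f i = if i + k%:Z is Posz j then p`_j else 0.
Proof.
move=> fE; rewrite /lcoef.
case: xgetP => [[q m] _ /= fE'|/(_ (p, k))]; last by case.
have vk j : vfrac ^+ j != 0 by rewrite expf_neq0 ?vfrac_neq0.
have : p * 'X^m = q * 'X^k.
  apply/eqP; rewrite -tofrac_eq; apply/eqP; rewrite !rmorphM !rmorphXn /= -/vfrac.
  have := fE; rewrite fE' => e.
  have := congr1 (fun z => z * vfrac ^+ m * vfrac ^+ k) e.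
  by rewrite divfK ?vk // mulrAC divfK ?vk // => ->.
move=> /polyP pq.
case Em: (i + m%:Z) => [j|j]; case Ek: (i + k%:Z) => [j'|j'] //.
- have := pq (j' + m)%N; rewrite !coefMXn.
  have -> : (j' + m < m)%N = false by lia.
  have -> : (j' + m < k)%N = false by lia.
  by rewrite addnK => ->; congr (_ `_ _); lia.
- have := pq (j + k)%N; rewrite !coefMXn addnK.
  have -> : (j + k < m)%N by lia.
  by have -> : (j + k < k)%N = false by lia.
- have := pq (j' + m)%N; rewrite !coefMXn addnK.
  have -> : (j' + m < k)%N by lia.
  by have -> : (j' + m < m)%N = false by lia.
Qed.

Lemma laurent_repr (f : laurent) : exists p k,
  laurent_val f = FracField.tofrac p / vfrac ^+ k.
Proof. by case: f => f /= /asboolP. Qed.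

Lemma vpow_val i : laurent_val (vpow i) = vfrac ^ i. Proof. by []. Qed.

Lemma laurent_valM (f g : laurent) :
  laurent_val (f * g) = laurent_val f * laurent_val g.
Proof. by []. Qed.

Lemma vpowD i j : vpow (i + j) = vpow i * vpow j.
Proof. by apply: val_inj; rewrite /= expfzDr ?vfrac_neq0. Qed.

Lemma vpow0 : vpow 0 = 1.
Proof. exact: val_inj. Qed.

Lemma vpowNK i : vpow (- i) * vpow i = 1.
Proof. by rewrite -vpowD addNr vpow0. Qed.

Lemma vpowKN i : vpow i * vpow (- i) = 1.
Proof. by rewrite -vpowD subrr vpow0. Qed.

Lemma laurent_mulf_eq0 (f g : laurent) : f * g = 0 -> f = 0 \/ g = 0.
Proof.
move=> /(congr1 laurent_val) /=; rewrite [X in X = _ -> _]/= => e.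
have /eqP : laurent_val f * laurent_val g = 0 by exact: e.
by rewrite mulf_eq0 => /orP[]/eqP h; [left|right]; apply: val_inj.
Qed.

Lemma laurent_mulfI (a b c : laurent) : a != 0 -> a * b = a * c -> b = c.
Proof.
move=> a0 /eqP; rewrite -subr_eq0 -mulrBr => /eqP /laurent_mulf_eq0[|/eqP].
  by move/eqP: a0.
by rewrite subr_eq0 => /eqP.
Qed.

Lemma lcoefD f g i : lcoef (f + g) i = lcoef f i + lcoef g i.
Proof.
have [p [k fE]] := laurent_repr f; have [q [m gE]] := laurent_repr g.
have vk j : vfrac ^+ j != 0 by rewrite expf_neq0 ?vfrac_neq0.
have fE' : laurent_val f = FracField.tofrac (p * 'X^m) / vfrac ^+ (k + m).
  by rewrite fE rmorphM rmorphXn exprD /= -mulf_div divff ?vk // mulr1.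
have gE' : laurent_val g = FracField.tofrac (q * 'X^k) / vfrac ^+ (k + m).
  by rewrite gE rmorphM rmorphXn exprD /= [_ ^+ k * _]mulrC -mulf_div divff ?vk // mulr1.
have fgE : laurent_val (f + g) =
    FracField.tofrac (p * 'X^m + q * 'X^k) / vfrac ^+ (k + m).
  by rewrite rmorphD mulrDl -fE' -gE'.
rewrite (lcoef_repr _ fE') (lcoef_repr _ gE') (lcoef_repr _ fgE).
by case: (_ + _) => j; rewrite ?coefD ?addr0.
Qed.

Lemma lcoef0 i : lcoef 0 i = 0.
Proof. by apply: (addrI (lcoef 0 i)); rewrite -lcoefD !addr0. Qed.

Lemma lcoefN f i : lcoef (- f) i = - lcoef f i.
Proof. by apply/eqP; rewrite -addr_eq0 -lcoefD addNr lcoef0. Qed.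

Lemma lcoefB f g i : lcoef (f - g) i = lcoef f i - lcoef g i.
Proof. by rewrite lcoefD lcoefN. Qed.

Lemma lcoefMn f n i : lcoef (f *+ n) i = lcoef f i *+ n.
Proof. by elim: n => [|n IH]; rewrite ?mulr0n ?lcoef0 // !mulrS lcoefD IH. Qed.

Lemma lcoefMz f z i : lcoef (f *~ z) i = lcoef f i * z.
Proof.
case: z => n; first by rewrite -pmulrn lcoefMn -mulr_natr natz.
by rewrite NegzE mulrNz -pmulrn lcoefN lcoefMn -mulr_natr natz mulrN.
Qed.

Lemma lcoef_sum I (r : seq I) (P : pred I) (F : I -> laurent) i :
  lcoef (\sum_(j <- r | P j) F j) i = \sum_(j <- r | P j) lcoef (F j) i.
Proof.
by apply: (big_morph (fun f => lcoef f i)) => [f g|]; rewrite ?lcoefD ?lcoef0.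
Qed.

Lemma lcoef_vpowM j f i : lcoef (vpow j * f) i = lcoef f (i - j).
Proof.
have [p [k fE]] := laurent_repr f.
have vk m : vfrac ^+ m != 0 by rewrite expf_neq0 ?vfrac_neq0.
case: j => j.
- have E : laurent_val (vpow j * f) = FracField.tofrac ('X^j * p) / vfrac ^+ k.
    by rewrite rmorphM rmorphXn /= -mulrA -fE.
  rewrite (lcoef_repr _ fE) (lcoef_repr _ E).
  case Ei: (i + k%:Z) => [a|a]; case Ej: (i - j%:Z + k%:Z) => [b|b] //.
  + rewrite coefXnM; case: ltnP => h; first lia.
    by congr (_ `_ _); lia.
  + by rewrite coefXnM; case: ltnP => h //; lia.
  + lia.
- have E : laurent_val (vpow (Negz j) * f) = FracField.tofrac p / vfrac ^+ (k + j.+1).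
    rewrite laurent_valM fE vpow_val NegzE -exprnN exprD invfM mulrCA.
    by congr (_ * _); rewrite mulrC.
  rewrite (lcoef_repr _ fE) (lcoef_repr _ E).
  by congr (if _ is Posz _ then _ else _); lia.
Qed.

Lemma lcoef1 i : lcoef 1 i = (i == 0)%:R.
Proof.
have E : laurent_val 1 = FracField.tofrac (1 : {poly int}) / vfrac ^+ 0.
  by rewrite rmorph1 expr0 divr1.
by rewrite (lcoef_repr _ E) addr0; case: i => [[|j]|j] //=; rewrite coef1.
Qed.

Lemma lcoef_vpow j i : lcoef (vpow j) i = (i == j)%:R.
Proof. by rewrite -[vpow j]mulr1 lcoef_vpowM lcoef1 subr_eq0. Qed.

Lemma lcoef_ext f g : lcoef f =1 lcoef g -> f = g.
Proof.
move=> fg; apply/eqP; rewrite -subr_eq0; apply/eqP.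
have {fg} : forall i, lcoef (f - g) i = 0 by move=> i; rewrite lcoefB fg subrr.
move: (f - g) => h h0; have [p [k hE]] := laurent_repr h.
apply: val_inj => /=; rewrite hE (_ : p = 0) ?rmorph0 ?mul0r //.
apply/polyP => j; rewrite coef0 -[RHS](h0 (j%:Z - k%:Z)) (lcoef_repr _ hE).
by rewrite subrK.
Qed.

Lemma lcoef_bounded f : exists B : nat, forall i, lcoef f i != 0 -> `|i| <= B%:Z.
Proof.
have [p [k fE]] := laurent_repr f; exists (size p + k)%N => i.
rewrite (lcoef_repr _ fE); case Ei: (i + k%:Z) => [j|j]; rewrite ?eqxx // => pj.
have : (j < size p)%N by rewrite ltnNge; apply: contra pj => /leq_sizeP ->.
lia.
Qed.

Lemma lcoef_finite f : finite_set [set i | lcoef f i != 0].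
Proof.
have [B fB] := lcoef_bounded f.
apply: (@sub_finite_set _ _ [set` [seq (j%:Z - B%:Z) | j <- iota 0 (B + B).+1]]).
  move=> i; rewrite /mkset => /fB iB; apply/mapP; exists (absz (i + B%:Z)); last by lia.
  by rewrite mem_iota; lia.
exact: finite_seq.
Qed.

Definition lsupp (f : laurent) : seq int := fset_set [set i | lcoef f i != 0].

Lemma mem_lsupp f i : (i \in lsupp f) = (lcoef f i != 0).
Proof.
rewrite in_fset_set; last exact: lcoef_finite.
by apply/idP/idP => [/set_mem //|fi]; apply: mem_set.
Qed.

Lemma lsupp_uniq f : uniq (lsupp f).
Proof. exact: fset_uniq. Qed.

Lemma fsum_seq (I : choiceType) (M : nmodType) (A : set I) (r : seq I) (F : I -> M) :
  uniq r -> (forall i, i \in r -> A i) ->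
  (forall i, A i -> F i != 0 -> i \in r) ->
  \sum_(i \in A) F i = \sum_(i <- r) F i.
Proof.
move=> ur rA Fr; rewrite (fsbigE r) //; last first.
  by move=> i Ai; apply: contraNeq => /(Fr _ Ai).
rewrite big_seq_cond [RHS]big_seq; apply: eq_bigl => i.
by case ri: (i \in r) => //=; rewrite mem_set //; exact: rA.
Qed.

(** A Laurent polynomial is the finite sum of its monomials; this is how the
    multiplicative rules below are reduced to monomials. *)
Lemma laurent_expand f : f = \sum_(i <- lsupp f) vpow i *~ lcoef f i.
Proof.
apply: lcoef_ext => j; rewrite lcoef_sum.
under eq_bigr do rewrite lcoefMz lcoef_vpow.
have [jf|] := boolP (j \in lsupp f); last first.
  rewrite mem_lsupp negbK => /eqP fj.
  rewrite fj big1 // => i _; case: eqVneq => [<-|]; first by rewrite fj mulr0.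
  by rewrite mul0r.
rewrite (bigD1_seq j) ?lsupp_uniq //= eqxx mul1r big1 ?addr0 // => i.
by rewrite eq_sym => /negbTE ->; rewrite mul0r.
Qed.

Lemma lcoef_lbar f i : lcoef (lbar f) i = lcoef f (- i).
Proof.
rewrite /lbar (fsum_seq (lsupp_uniq f)) //; last first.
  by move=> j _; rewrite mem_lsupp; apply: contra => /eqP ->; rewrite mulr0z.
rewrite lcoef_sum; under eq_bigr do rewrite lcoefMz lcoef_vpow.
have [jf|] := boolP (- i \in lsupp f); last first.
  rewrite mem_lsupp negbK => /eqP fi.
  rewrite fi big1 // => j _; case: eqVneq => [ij|]; last by rewrite mul0r.
  by rewrite -[j]opprK -ij fi mulr0.
rewrite (bigD1_seq (- i)) ?lsupp_uniq //=.
rewrite opprK eqxx mul1r big1 ?addr0 // => j.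
by rewrite -eqr_opp opprK eq_sym => /negbTE ->; rewrite mul0r.
Qed.

Lemma lbarK f : lbar (lbar f) = f.
Proof. by apply: lcoef_ext => i; rewrite !lcoef_lbar opprK. Qed.

Lemma lbarD f g : lbar (f + g) = lbar f + lbar g.
Proof. by apply: lcoef_ext => i; rewrite lcoefD !lcoef_lbar lcoefD. Qed.

Lemma lbar0 : lbar 0 = 0.
Proof. by apply: lcoef_ext => i; rewrite lcoef_lbar !lcoef0. Qed.

Lemma lbarN f : lbar (- f) = - lbar f.
Proof. by apply: lcoef_ext => i; rewrite lcoefN !lcoef_lbar lcoefN. Qed.

Lemma lbarMz f z : lbar (f *~ z) = lbar f *~ z.
Proof. by apply: lcoef_ext => i; rewrite lcoefMz !lcoef_lbar lcoefMz. Qed.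

Lemma lbar_vpow i : lbar (vpow i) = vpow (- i).
Proof. by apply: lcoef_ext => j; rewrite lcoef_lbar !lcoef_vpow eqr_oppLR. Qed.

Lemma lbar1 : lbar 1 = 1.
Proof. by rewrite -vpow0 lbar_vpow oppr0. Qed.

Lemma lbar_sum I (r : seq I) (P : pred I) (F : I -> laurent) :
  lbar (\sum_(j <- r | P j) F j) = \sum_(j <- r | P j) lbar (F j).
Proof. by apply: big_morph; [exact: lbarD | exact: lbar0]. Qed.

Lemma lbarM f g : lbar (f * g) = lbar f * lbar g.
Proof.
rewrite [f]laurent_expand.
rewrite mulr_suml !lbar_sum mulr_suml; apply: eq_bigr => i _.
rewrite mulrzAl !lbarMz lbar_vpow mulrzAl; congr (_ *~ _).
by apply: lcoef_ext => j; rewrite lcoef_lbar !lcoef_vpowM lcoef_lbar; congr lcoef; lia.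
Qed.

Lemma in_vZvD f g : in_vZv f -> in_vZv g -> in_vZv (f + g).
Proof. by move=> hf hg i i0; rewrite lcoefD hf // hg. Qed.

Lemma in_vZvN f : in_vZv f -> in_vZv (- f).
Proof. by move=> hf i i0; rewrite lcoefN hf ?oppr0. Qed.

Lemma in_vZv0 : in_vZv 0.
Proof. by move=> i _; rewrite lcoef0. Qed.

Lemma in_vZv_vM f : in_vZv f -> in_vZv (vpow 1 * f).
Proof. by move=> hf i i0; rewrite lcoef_vpowM hf //; lia. Qed.

Lemma in_vZv_v : in_vZv (vpow 1).
Proof. by move=> i i0; rewrite lcoef_vpow; case: eqP => // ?; lia. Qed.

(** The only element of v Z[v] fixed by the involution is 0: this one remark
    is behind all the uniqueness statements about self-dual bases. *)
Lemma in_vZv_bar_eq0 f : in_vZv f -> lbar f = f -> f = 0.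
Proof.
move=> hf fb; apply: lcoef_ext => i; rewrite lcoef0.
case: (lerP i 0) => [/hf //|i0]; rewrite -fb lcoef_lbar hf //; lia.
Qed.

(** * Finitely supported functions *)

Section FreeModules.
Variables (K : comNzRingType) (T : choiceType) (D : set T).
Implicit Types (m : freemod K D).

Lemma fm_ext m m' : (forall x, m x = m' x) -> m = m'.
Proof. by move=> mm'; apply: val_inj; apply: funext => x; exact: mm'. Qed.

Lemma fmEB m m' x : (m - m') x = m x - m' x. Proof. by []. Qed.

Lemma fmEZ (a : K) m x : (a *: m) x = a * m x. Proof. by []. Qed.

Lemma fmE_sum I (r : seq I) (F : I -> freemod K D) x :
  (\sum_(i <- r) F i) x = \sum_(i <- r) F i x.
Proof. by elim/big_rec2: _ => [//|i y z _ <-]. Qed.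

Lemma fm_finite m : finite_set [set x | m x != 0].
Proof. by case: m => f /= /asboolP[]. Qed.

Lemma fm_dom m x : m x != 0 -> D x.
Proof. by case: m => f /= /asboolP[_]; apply. Qed.

Lemma fmbasisE y x : D y -> (fmbasis K D y) x = (x == y)%:R.
Proof.
move=> Dy; rewrite /fmbasis /insubd insubT //.
apply/asboolP; split => [|z /=]; last first.
  by case: (eqVneq z y) => [->|]; rewrite ?eqxx.
apply: (@sub_finite_set _ _ [set y]); last exact: finite_set1.
by move=> z /=; case: (eqVneq z y) => // _; rewrite eqxx.
Qed.

End FreeModules.

Definition suppseq (T : choiceType) (K : nmodType) (f : T -> K) : seq T :=
  fset_set [set x | f x != 0].

Lemma suppseq_uniq (T : choiceType) (K : nmodType) (f : T -> K) :
  uniq (suppseq f).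
Proof. exact: fset_uniq. Qed.

Lemma mem_suppseq (T : choiceType) (K : nmodType) (f : T -> K) x :
  finite_set [set x | f x != 0] -> (x \in suppseq f) = (f x != 0).
Proof.
move=> ff; rewrite in_fset_set //.
by apply/idP/idP => [/set_mem //|fx]; apply: mem_set.
Qed.

Lemma fsum_comb (T : choiceType) (K : pzRingType) (M : lmodType K) (A : set T)
    (c : T -> K) (F : T -> M) (r : seq T) :
  uniq r -> (forall x, x \in r -> A x) -> (forall x, A x -> c x != 0 -> x \in r) ->
  \sum_(x \in A) c x *: F x = \sum_(x <- r) c x *: F x.
Proof.
move=> ur rA cr; apply: fsum_seq => // x Ax h; apply: cr => //.
by apply: contra h => /eqP ->; rewrite scale0r.
Qed.

(** * Roots *)

Section RootSystems.
Variables (R : realType) (n : nat) (rs : root_system R n).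
Local Notation V := 'rV[R]_n.
Local Notation dot := (dot rs).
Implicit Types (x y z a b : V).

Lemma dotDr x y z : dot x (y + z) = dot x y + dot x z.
Proof. by rewrite dotC dotDl dotC [dot z x]dotC. Qed.

Lemma dotZr c x y : dot x (c *: y) = c * dot x y.
Proof. by rewrite dotC dotZl dotC. Qed.

Lemma dotNl x y : dot (- x) y = - dot x y.
Proof. by rewrite -scaleN1r dotZl mulN1r. Qed.

Lemma dotNr x y : dot x (- y) = - dot x y.
Proof. by rewrite dotC dotNl dotC. Qed.

Lemma dotBl x y z : dot (x - y) z = dot x z - dot y z.
Proof. by rewrite dotDl dotNl. Qed.

Lemma dotBr x y z : dot x (y - z) = dot x y - dot x z.
Proof. by rewrite dotDr dotNr. Qed.

Lemma dot0l x : dot 0 x = 0.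
Proof. by rewrite -(subrr x) dotBl subrr. Qed.

Lemma dot0r x : dot x 0 = 0.
Proof. by rewrite dotC dot0l. Qed.

Lemma dot_sumr I (r : seq I) (P : pred I) (F : I -> V) x :
  dot x (\sum_(i <- r | P i) F i) = \sum_(i <- r | P i) dot x (F i).
Proof. by apply: (big_morph (dot x)) => [y z|]; rewrite ?dotDr ?dot0r. Qed.

Lemma dotMnr x y k : dot x (y *+ k) = dot x y *+ k.
Proof. by elim: k => [|k IH]; rewrite ?mulr0n ?dot0r // !mulrS dotDr IH. Qed.

Lemma dot_eq0 x : dot x x <= 0 -> x = 0.
Proof. by move=> xx; apply/eqP; apply: contraTT xx => /(dot_gt0 rs); rewrite ltNge. Qed.

Lemma root_nz a : is_root rs a -> a != 0.
Proof. by move=> ra; apply/eqP => a0; apply: (root_neq0 (r := rs)); rewrite -a0. Qed.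

Lemma root_gt0 a : is_root rs a -> 0 < dot a a.
Proof. by move=> /root_nz; exact: dot_gt0. Qed.

Lemma is_rootN a : is_root rs a -> is_root rs (- a).
Proof.
move=> ra; have := root_refl ra ra; rewrite -mulrA divff ?gt_eqF ?root_gt0 //.
by rewrite mulr1 scaler_nat mulr2n opprD addrA subrr sub0r.
Qed.

Lemma is_rootNE a : is_root rs (- a) <-> is_root rs a.
Proof. by split => /is_rootN //; rewrite opprK. Qed.

Definition refl a x : V := x - (2 * dot x a / dot a a) *: a.

Lemma aff_reflE a r x :
  aff_refl rs a r x = refl a x + (2 * r / dot a a) *: a.
Proof.
rewrite /aff_refl /refl -addrA; congr (_ + _).
by rewrite mulrBr mulrBl scalerBl opprB addrC.
Qed.

Lemma aff_refl0 a : aff_refl rs a 0 = refl a.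
Proof. by apply: funext => x; rewrite aff_reflE mulr0 mul0r scale0r addr0. Qed.

Lemma refl_linear a c x y : refl a (c *: x + y) = c *: refl a x + refl a y.
Proof.
rewrite /refl dotDl dotZl scalerBr scalerA addrACA; congr (_ + _).
by rewrite -opprD -scalerDl; congr (- (_ *: _)); ring.
Qed.

Lemma reflD a x y : refl a (x + y) = refl a x + refl a y.
Proof. by rewrite -[x]scale1r refl_linear !scale1r. Qed.

Lemma reflZ a c x : refl a (c *: x) = c *: refl a x.
Proof.
have r0 : refl a 0 = 0 by rewrite /refl dot0l mulr0 mul0r scale0r subr0.
by rewrite -[c *: x]addr0 refl_linear r0 addr0.
Qed.

Lemma dot_refl a x y : dot (refl a x) y = dot x (refl a y).
Proof. by rewrite dotBl dotBr dotZl dotZr [dot y a]dotC; ring. Qed.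

Lemma reflK a x : is_root rs a -> refl a (refl a x) = x.
Proof.
by move=> ra; have := congr1 (fun f => f x) (aff_reflK 0 ra); rewrite /= aff_refl0.
Qed.

Lemma dot_refl2 a x y : is_root rs a -> dot (refl a x) (refl a y) = dot x y.
Proof. by move=> ra; rewrite dot_refl reflK. Qed.

Lemma refl_root a b : is_root rs a -> is_root rs b -> is_root rs (refl a b).
Proof. by move=> ra rb; exact: root_refl. Qed.

Lemma refl_self a : is_root rs a -> refl a a = - a.
Proof.
move=> ra; rewrite /refl -mulrA divff ?gt_eqF ?root_gt0 //.
by rewrite mulr1 scaler_nat mulr2n opprD addrA subrr sub0r.
Qed.

Lemma root_pairing a b : is_root rs a -> is_root rs b ->
  exists m : int, 2 * dot b a / dot a a = m%:~R.
Proof. by move=> ra rb; have /intrP := root_int ra rb. Qed.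

(** ** Positive roots *)

Local Notation ncomb c := (\sum_(i < n) simple rs i *+ (c : 'I_n -> nat) i).

Lemma dot_ncomb x (c : 'I_n -> nat) :
  dot x (ncomb c) = \sum_(i < n) dot x (simple rs i) *+ c i.
Proof. by rewrite dot_sumr; apply: eq_bigr => i _; rewrite dotMnr. Qed.

Lemma dot_ncomb_ge0 x (c : 'I_n -> nat) :
  (forall i, 0 <= dot x (simple rs i)) -> 0 <= dot x (ncomb c).
Proof. by move=> h; rewrite dot_ncomb sumr_ge0 // => i _; rewrite mulrn_wge0. Qed.

Lemma simple_free_nat (c d : 'I_n -> int) :
  \sum_(i < n) simple rs i *~ c i = \sum_(i < n) simple rs i *~ d i ->
  forall i, c i = d i.
Proof.
move=> /eqP; rewrite -subr_eq0 -sumrB => /eqP e i; apply/eqP.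
have := @simple_free _ _ rs (fun i => (c i - d i)%:~R) _ i.
rewrite -subr_eq0 -(intr_eq0 R) => -> //; rewrite -[RHS]e; apply: eq_bigr => j _.
by rewrite scaler_int mulrzBr.
Qed.

Lemma root_pos_neg a : is_root rs a -> pos_root rs a \/ pos_root rs (- a).
Proof.
move=> ra; have [c [e|e]] := simple_base ra; first by left; split => //; exists c.
by right; split; [exact: is_rootN | exists c; rewrite e opprK].
Qed.

Lemma pos_rootW a : pos_root rs a -> is_root rs a. Proof. by case. Qed.

Lemma simple_pos i : pos_root rs (simple rs i).
Proof.
split; first exact: simple_root.
exists (fun j => (j == i) : nat); rewrite (bigD1 i) //= eqxx mulr1n big1 ?addr0 //.
by move=> j /negbTE ->.
Qed.

Lemma dot_pos_ge0 x a : (forall i, 0 <= dot x (simple rs i)) ->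
  pos_root rs a -> 0 <= dot x a.
Proof. by move=> h [_ [c ->]]; exact: dot_ncomb_ge0. Qed.

(** A positive root is a combination of the simple roots with some positive
    coefficient, as 0 is not a root. *)
Lemma dot_pos_gt0 x a : chamber rs x -> pos_root rs a -> 0 < dot x a.
Proof.
move=> Cx [ra [c e]]; rewrite lt_def dot_pos_ge0 ?andbT; last 2 first.
- by move=> i; apply: ltW; exact: Cx.
- by split => //; exists c.
apply: contra_not_neq (root_neq0 (r := rs)).
rewrite e dot_ncomb => /eqP; rewrite psumr_eq0; last first.
  by move=> i _; rewrite mulrn_wge0 // ltW // Cx.
move=> /allP h; rewrite (_ : 0 = a) // e big1 // => i _.
have /= := h i (mem_index_enum i); rewrite mulrn_eq0 => /orP[/eqP ->|].
  by rewrite mulr0n.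
by rewrite gt_eqF // Cx.
Qed.

(** The simple roots form a basis, so their values at a point can be
    prescribed. *)
Lemma simple_dual (c : 'I_n -> R) : exists x, forall i, dot x (simple rs i) = c i.
Proof.
pose G : 'M[R]_n := \matrix_(j, i) dot (delta_mx 0 j) (simple rs i).
have GE (x : V) i : (x *m G) 0 i = dot x (simple rs i).
  rewrite mxE [in RHS](row_sum_delta x) dotC dot_sumr; apply: eq_bigr => j _.
  by rewrite !mxE dotZr dotC.
pose A : 'M[R]_n := \matrix_i simple rs i.
have AE (u : V) : u *m A = \sum_(i < n) u 0 i *: simple rs i.
  by rewrite mulmx_sum_row; apply: eq_bigr => i _; rewrite rowK.
have uA : A \in unitmx.
  rewrite -row_free_unit -kermx_eq0; apply/eqP/row_matrixP => i.
  have /sub_kermxP : (row i (kermx A) <= kermx A)%MS by exact: row_sub.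
  rewrite row0 AE => /(@simple_free _ _ rs) h; apply/rowP => j.
  by rewrite h mxE.
have uG : G \in unitmx.
  rewrite -row_free_unit -kermx_eq0; apply/eqP/row_matrixP => i.
  have /sub_kermxP : (row i (kermx G) <= kermx G)%MS by exact: row_sub.
  rewrite row0; move: (row i _) => x xG; apply: dot_eq0.
  have -> : dot x x = dot x (x *m invmx A *m A) by rewrite mulmxKV.
  rewrite AE dot_sumr big1 // => j _; by rewrite dotZr -GE xG [X in _ * X]mxE mulr0.
exists ((\row_i c i) *m invmx G) => i; rewrite -GE mulmxKV //.
by rewrite mxE.
Qed.

Lemma chamber_nonempty : exists x, chamber rs x.
Proof. by have [x xE] := simple_dual (fun=> 1); exists x => i; rewrite xE. Qed.

Lemma pos_rootN a : pos_root rs a -> ~ pos_root rs (- a).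
Proof.
have [x Cx] := chamber_nonempty; move=> /(dot_pos_gt0 Cx) h /(dot_pos_gt0 Cx).
by rewrite dotNr oppr_gt0 ltNge (ltW h).
Qed.

(** A simple reflection only changes the coefficient of its own simple root, so
    it can make negative only the multiples of that root. *)
Lemma refl_simple_pos i a : pos_root rs a -> a != simple rs i ->
  pos_root rs (refl (simple rs i) a).
Proof.
move=> [ra [c e]] ai; have si := simple_root rs i.
have [//|[_ [d ed]]] := root_pos_neg (refl_root si ra).
have [m mE] := root_pairing si ra.
case/eqP: ai; have /simple_free_nat h : \sum_(j < n) simple rs j *~ (c j + d j)%:Z =
    \sum_(j < n) simple rs j *~ (if j == i then m else 0).
  rewrite [RHS](bigD1 i) //= eqxx [X in _ = _ + X]big1 ?addr0; last first.
    by move=> j /negbTE ->.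
  have -> : simple rs i *~ m = a - refl (simple rs i) a.
    by rewrite /refl opprB addrC subrK mE scaler_int.
  rewrite [X in X - _]e ed -big_split /=; apply: eq_bigr => j _.
  by rewrite PoszD mulrzDr.
have aE : a = simple rs i *+ c i.
  rewrite e (bigD1 i) //= big1 ?addr0 // => j ji; have := h j.
  by rewrite (negbTE ji) => ?; have -> : c j = 0%N by lia.
have : is_root rs ((c i)%:R *: simple rs i) by rewrite scaler_nat -aE.
move=> /(root_reduced si)[/eqP|/eqP].
  by rewrite -[1]/(1%:R) eqr_nat => /eqP ci; rewrite aE ci mulr1n.
by move=> /eqP ci; have := ler0n R (c i); rewrite ci oppr_ge0 ler10.
Qed.

(** ** The highest root *)

Local Notation theta := (theta rs).

Lemma theta_pos : pos_root rs theta.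
Proof.
have [//|h] := root_pos_neg (theta_root rs); have [x Cx] := chamber_nonempty.
have [c] := theta_highest (is_rootN (theta_root rs)).
move=> /(congr1 (dot x)); have : 0 <= dot x (ncomb c).
  by apply: dot_ncomb_ge0 => i; apply: ltW; exact: Cx.
move=> + e; rewrite -e dotBr dotNr; have := dot_pos_gt0 Cx h; rewrite dotNr; lra.
Qed.

Lemma dot_le_theta x a : (forall i, 0 <= dot x (simple rs i)) -> is_root rs a ->
  dot x a <= dot x theta.
Proof.
move=> h ra; have [c e] := theta_highest ra.
by rewrite -subr_ge0 -dotBr e dot_ncomb_ge0.
Qed.

(** Otherwise the reflection of theta in a simple root would be a root above theta. *)
Lemma theta_dominant i : 0 <= dot theta (simple rs i).
Proof.
have si := simple_root rs i; have [m mE] := root_pairing si (theta_root rs).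
have [c] := theta_highest (refl_root si (theta_root rs)).
rewrite /refl opprB addrC subrK mE scaler_int => e.
have /simple_free_nat : \sum_(j < n) simple rs j *~ (if j == i then m else 0) =
    \sum_(j < n) simple rs j *~ (c j)%:Z.
  by rewrite (bigD1 i) //= eqxx big1 ?addr0 // => j /negbTE ->.
move=> /(_ i); rewrite eqxx => mc; have := mE; rewrite mc => {}mE.
have : 0 <= 2 * dot theta (simple rs i) / dot (simple rs i) (simple rs i).
  by rewrite mE ler0z.
by rewrite pmulr_lge0 ?invr_gt0 ?root_gt0 // pmulr_rge0.
Qed.

Lemma seq_argmax (T : eqType) (f : T -> R) (s : seq T) : s != [::] ->
  exists2 b, b \in s & forall b' : T, b' \in s -> f b' <= f b.
Proof.
elim: s => // a [|a' s] IH _; first by exists a => [|b]; rewrite ?inE // => /eqP ->.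
have [//|b bs bmax] := IH; have [ab|ba] := lerP (f a) (f b).
  by exists b => [|b']; rewrite inE ?bs ?orbT // => /orP[/eqP ->|/bmax].
exists a => [|b']; rewrite inE ?eqxx // => /orP[/eqP -> //|/bmax].
by move=> /le_trans; apply; exact: ltW.
Qed.

Definition root_seq : seq V := fset_set (is_root rs).

Lemma mem_root_seq a : (a \in root_seq) <-> is_root rs a.
Proof.
rewrite in_fset_set; last exact: root_finite.
by split => [/set_mem //|ra]; exact: mem_set.
Qed.

Lemma root_seq_uniq : uniq root_seq. Proof. exact: fset_uniq. Qed.

(** Among the roots of a given length, one that is highest in the direction of
    the chamber is dominant, and a dominant root is no longer than theta. *)
Lemma theta_long a : is_root rs a -> dot a a <= dot theta theta.
Proof.
move=> ra; have [x Cx] := chamber_nonempty.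
pose s := [seq b <- root_seq | dot b b == dot a a].
have as_ : a \in s by rewrite mem_filter eqxx; apply/mem_root_seq.
have [|b] := seq_argmax (dot x) (s := s); first by case: s as_.
rewrite mem_filter => /andP[/eqP bb /mem_root_seq rb] bmax.
have bdom i : 0 <= dot b (simple rs i).
  have si := simple_root rs i; have := bmax (refl (simple rs i) b).
  rewrite mem_filter dot_refl2 // bb eqxx => /(_ _)/wrap[].
    by apply/mem_root_seq; exact: refl_root.
  rewrite dotBr dotZr gerBl pmulr_lge0 ?Cx //.
  by rewrite pmulr_lge0 ?invr_gt0 ?root_gt0 // pmulr_rge0.
rewrite -bb; apply: le_trans (dot_le_theta bdom rb) _.
rewrite dotC; exact: dot_le_theta theta_dominant _.
Qed.

(** As theta is long and dominant, its coroot pairs with any other positive root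
    to 0 or 1. *)
Lemma theta_pairing a : pos_root rs a -> a != theta ->
  2 * dot a theta / dot theta theta = 0 \/ 2 * dot a theta / dot theta theta = 1.
Proof.
move=> pa at_; have ra := pos_rootW pa.
have [m mE] := root_pairing (theta_root rs) ra.
have tt := root_gt0 (theta_root rs).
have : 0 <= dot theta a by apply: dot_pos_ge0 pa; exact: theta_dominant.
rewrite dotC => h0.
have h2 : dot a theta < dot theta theta.
  rewrite dotC lt_def dot_le_theta ?andbT //; last exact: theta_dominant.
  apply: contra_neq at_ => e; apply/eqP; rewrite -subr_eq0; apply/eqP/dot_eq0.
  have := theta_long ra; rewrite dotBl !dotBr [dot a theta]dotC e; lra.
have m0 : (0 <= m)%R.
  by rewrite -(ler0z R) -mE divr_ge0 ?mulr_ge0 // ltW.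
have m2 : (m < 2)%R.
  by rewrite -(ltr_int R) -mE ltr_pdivrMr // ltr_pM2l.
rewrite mE; have [->|->] : m = 0 \/ m = 1 by lia.
  by left.
by right.
Qed.

(** The roots not orthogonal to the whole orbit W theta form a set that is orthogonal to
    its complement: if c is orthogonal to w theta but not to the root a of the set, then c
    is not orthogonal to s_a w theta. *)
Lemma theta_orbit_pairing b : is_root rs b ->
  exists2 w, weyl rs w & dot (w theta) b != 0.
Proof.
pose A : set V := [set b | is_root rs b /\ exists2 w, weyl rs w & dot (w theta) b != 0].
move=> rb; suff E : A = is_root rs by have : A b by [rewrite E|]; case.
 apply: (root_irreducible (r := rs)).
- by move=> c [].
- exists theta; split; first exact: theta_root.
  by exists id; [exact: generated_id | rewrite gt_eqF // root_gt0 //; exact: theta_root].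
- move=> a c [ra [w Ww wa]] [rc nAc]; apply/eqP; apply: contra_notT nAc => ac.
  split => //; case: (eqVneq (dot (w theta) c) 0) => wc; last by exists w.
  exists (refl a \o w).
    rewrite -aff_refl0; apply: generated_comp Ww; by exists a.
  rewrite /= /refl dotBl dotZl wc sub0r oppr_eq0 mulf_neq0 // !mulf_neq0 //.
  by rewrite invr_eq0 gt_eqF // root_gt0.
Qed.

End RootSystems.

(** * The affine Weyl group *)

Section AffineWeyl.
Variables (R : realType) (n : nat) (rs : root_system R n) (l : nat).
Local Notation V := 'rV[R]_n.
Local Notation dot := (dot rs).
Local Notation theta := (theta rs).
Local Notation affW := (affW rs l).
Local Notation lvl m := ((m : int)%:~R * l%:R : R).
Implicit Types (x y z a b : V) (w g : affW) (m q : int).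

Lemma affWM_val g w x : (g * w)%g x = g (w x). Proof. by []. Qed.

Lemma affW1_val x : (1%g : affW) x = x. Proof. by []. Qed.

Lemma affWVK w x : (w^-1)%g (w x) = x.
Proof. by rewrite -affWM_val mulVg. Qed.

Lemma affWKV w x : w ((w^-1)%g x) = x.
Proof. by rewrite -affWM_val mulgV. Qed.

Lemma affW_ext g w : (forall x, g x = w x) -> g = w.
Proof. by move=> gw; apply: val_inj; apply: funext. Qed.

(** The linear part of an affine map. *)
Definition linp (w : V -> V) x := w x - w 0.

Lemma linpE (w : V -> V) x : w x = linp w x + w 0.
Proof. by rewrite subrK. Qed.

Lemma linp_aff_refl a r x : linp (aff_refl rs a r) x = refl rs a x.
Proof.
rewrite /linp !aff_reflE {2}/refl dot0l mulr0 mul0r scale0r subr0 add0r.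
by rewrite addrK.
Qed.

Lemma aff_gens_refl (g : V -> V) : aff_weyl_gens rs l g ->
  exists b m, is_root rs b /\ g = aff_refl rs b (lvl m).
Proof.
case=> [[b rb ->]|->]; first by exists b, 0; rewrite mul0r.
by exists theta, 1; rewrite mul1r; split => //; exact: theta_root.
Qed.

(** All elements of the group are affine isometries whose linear parts permute the roots
    and whose translation parts pair with the roots to multiples of l. *)
Lemma aff_weyl_linp (w : V -> V) : aff_weyl rs l w ->
  [/\ forall c x y, linp w (c *: x + y) = c *: linp w x + linp w y,
      forall x y, dot (linp w x) (linp w y) = dot x y,
      forall a, is_root rs a -> is_root rs (linp w a)
    & forall a, is_root rs a -> exists m, dot (w 0) a = lvl m].
Proof.
elim=> {w} [|g w /aff_gens_refl[b [m [rb ->]]] _ [wl wd wr wt]].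
  split; rewrite /linp /= ?subr0 //.
  - by move=> *; rewrite !subr0.
  - by move=> *; rewrite !subr0.
  - by move=> a; rewrite subr0.
  - by move=> a _; exists 0; rewrite dot0l mul0r.
have E x : linp (aff_refl rs b (lvl m) \o w) x = refl rs b (linp w x).
  rewrite /linp /= !aff_reflE opprD addrACA subrr addr0.
  by rewrite -[- refl _ _ _]scaleN1r -reflZ -reflD scaleN1r.
split.
- by move=> c x y; rewrite !E wl refl_linear.
- by move=> x y; rewrite !E dot_refl2.
- by move=> a ra; rewrite E; apply: refl_root => //; exact: wr.
- move=> a ra; rewrite /= aff_reflE dotDl dotZl dot_refl.
  have [q ->] := wt _ (refl_root rb ra).
  have [p] := root_pairing rb ra; rewrite dotC => pE; exists (q + p * m).
  by rewrite rmorphD rmorphM /= -pE; ring.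
Qed.

Lemma linp_aff w c x y : linp w (c *: x + y) = c *: linp w x + linp w y.
Proof. by have [-> ] := aff_weyl_linp (affWP w). Qed.

Lemma linpD w x y : linp w (x + y) = linp w x + linp w y.
Proof. by rewrite -[x]scale1r linp_aff !scale1r. Qed.

Lemma linpZ w c x : linp w (c *: x) = c *: linp w x.
Proof. by rewrite -[c *: x]addr0 linp_aff /linp subrr addr0. Qed.

Lemma linpN w x : linp w (- x) = - linp w x.
Proof. by rewrite -[- x]scaleN1r linpZ scaleN1r. Qed.

Lemma linp_dot w x y : dot (linp w x) (linp w y) = dot x y.
Proof. by have [_ -> ] := aff_weyl_linp (affWP w). Qed.

Lemma linp_root w a : is_root rs a -> is_root rs (linp w a).
Proof. by have [_ _ h _] := aff_weyl_linp (affWP w); exact: h. Qed.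

Lemma linpM g w x : linp (g * w)%g x = linp g (linp w x).
Proof.
have -> : linp (g * w)%g x = g (w x) - g (w 0) by [].
by rewrite (linpE g) (linpE g (w 0)) opprD addrACA subrr addr0 -linpN -linpD.
Qed.

Lemma linp1 x : linp (1%g : affW) x = x.
Proof. by rewrite /linp !affW1_val subr0. Qed.

Lemma linpVK w x : linp w (linp (w^-1)%g x) = x.
Proof. by rewrite -linpM mulgV linp1. Qed.

Lemma linpKV w x : linp (w^-1)%g (linp w x) = x.
Proof. by rewrite -linpM mulVg linp1. Qed.

Lemma affW_affine w x c y : w (x + c *: y) = w x + c *: linp w y.
Proof. by rewrite linpE addrC addrC linpD linpZ addrAC -linpE. Qed.

(** [adj w a] is the linear functional a transported along w. *)
Definition adj w a := linp (w^-1)%g a.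

Lemma adj_root w a : is_root rs a -> is_root rs (adj w a).
Proof. exact: linp_root. Qed.

Lemma adj_inj w : injective (adj w).
Proof. by move=> a b /(congr1 (linp w)); rewrite !linpVK. Qed.

Lemma dot_adj w x a : dot (w x) a = dot x (adj w a) + dot (w 0) a.
Proof. by rewrite linpE dotDl -{1}(linpVK w a) linp_dot. Qed.

Lemma dot_affW w a : is_root rs a ->
  exists m, forall x, dot (w x) a = dot x (adj w a) + lvl m.
Proof.
move=> ra; have [_ _ _ /(_ a ra)[m mE]] := aff_weyl_linp (affWP w).
by exists m => x; rewrite dot_adj mE.
Qed.

(** ** All hyperplane reflections belong to the group *)

(** The translations in the group; the reflection in x.a = m l is the linear
    reflection in a followed by the translation by m l times the coroot of a. *)
Definition is_trans v := aff_weyl rs l (fun x => x + v).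

Lemma is_transD v u : is_trans v -> is_trans u -> is_trans (v + u).
Proof.
move=> Tv Tu; have := generatedM Tu Tv; congr (aff_weyl _ _ _).
by apply: funext => x /=; rewrite addrA.
Qed.

Lemma is_trans0 : is_trans 0.
Proof.
have := generated_id (aff_weyl_gens rs l); congr (aff_weyl _ _ _).
by apply: funext => x /=; rewrite addr0.
Qed.

Lemma weyl_aff (w : V -> V) : weyl rs w -> aff_weyl rs l w.
Proof.
elim=> {w} [|g w rg _ IH]; first exact: generated_id.
by apply: generated_comp IH; left.
Qed.

Lemma weyl_0 (w : V -> V) : weyl rs w -> w 0 = 0.
Proof.
elim=> {w} [//|g w [a ra ->] _ /= ->].
by rewrite aff_refl0 /refl dot0l mulr0 mul0r scale0r subr0.
Qed.

Lemma is_trans_conj v (w : V -> V) : weyl rs w -> is_trans v -> is_trans (w v).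
Proof.
move=> Ww Tv; have Aw := weyl_aff Ww; pose u := AffW (asboolT Aw).
have Au' : aff_weyl rs l (u^-1)%g by exact: affWP.
have := generatedM Aw (generatedM Tv Au'); congr (aff_weyl _ _ _).
apply: funext => x /=; rewrite -[w]/(affW_val u).
have := affW_affine u ((u^-1)%g x) 1 v; rewrite !scale1r => ->.
have u0 : u 0 = 0 := weyl_0 Ww.
by rewrite affWKV /linp u0 subr0.
Qed.

Lemma is_transN v : is_trans v -> is_trans (- v).
Proof.
move=> Tv; pose u := AffW (asboolT Tv); have := affWP (u^-1)%g.
congr (aff_weyl _ _ _); apply: funext => x.
by apply: (can_inj (affWVK u)); rewrite affWKV /= subrK.
Qed.

Lemma is_transMz v m : is_trans v -> is_trans (v *~ m).
Proof.
move=> Tv; have Tn k : is_trans (v *+ k).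
  by elim: k => [|k IH]; rewrite ?mulrS; [exact: is_trans0 | exact: is_transD].
by case: m => k; rewrite ?NegzE ?mulrNz; [|apply: is_transN]; exact: Tn.
Qed.

Definition coroot a := (2 / dot a a) *: a.

Lemma coroot_refl a b : is_root rs a -> is_root rs b ->
  coroot (refl rs b a) = refl rs b (coroot a).
Proof. by move=> ra rb; rewrite /coroot reflZ dot_refl2. Qed.

Lemma is_trans_theta : is_trans (l%:R *: coroot theta).
Proof.
have rt := theta_root rs.
have G0 : aff_weyl_gens rs l (aff_refl rs theta 0) by left; exists theta.
have G1 : aff_weyl_gens rs l (aff_refl rs theta l%:R) by right.
have := generated_comp G1 (generated_comp G0 (generated_id _)).
congr (aff_weyl _ _ _); apply: funext => x /=.
rewrite aff_refl0 aff_reflE reflK // /coroot scalerA; congr (_ + _ *: _).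
by rewrite mulrA [l%:R * _]mulrC.
Qed.

(** The W-orbit of the coroot of theta spans the coroot lattice: every root b
    pairs non-trivially with some root a of that orbit, a is at least as long as
    b, and so either b is proportional to a or the coroot of b is, up to sign,
    the difference of the coroot of a and its reflection in b. *)
Lemma is_trans_coroot b : is_root rs b -> is_trans (l%:R *: coroot b).
Proof.
move=> rb; have [w Ww wb] := theta_orbit_pairing rb.
pose u := AffW (asboolT (weyl_aff Ww)).
have wE x : w x = linp u x by rewrite /linp /= (weyl_0 Ww) subr0.
set a := w theta in wb; have rt := theta_root rs.
have ra : is_root rs a by rewrite /a wE; exact: linp_root.
have aa : dot a a = dot theta theta by rewrite /a !wE linp_dot.
have Ta : is_trans (l%:R *: coroot a).
  have := is_trans_conj Ww is_trans_theta.
  by rewrite wE /coroot !linpZ aa -wE.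
have Tneg : forall a', is_trans (l%:R *: coroot a') -> is_trans (l%:R *: coroot (- a')).
  by move=> a' /is_transN; rewrite /coroot dotNl dotNr opprK !scalerN.
have [c cE] := root_pairing ra rb; have aa0 := root_gt0 ra.
have [c1|c1] := leP `|c| 1.
  have c0 : c != 0.
    rewrite -(intr_eq0 R) -cE mulf_eq0 mulf_eq0 pnatr_eq0 /= invr_eq0 (gt_eqF aa0).
    by rewrite orbF dotC.
  have Tr : is_trans (l%:R *: coroot (refl rs b a)).
    have Wb : weyl rs (refl rs b).
      rewrite -aff_refl0 -[aff_refl _ _ _]/(aff_refl rs b 0 \o id).
      by apply: generated_comp (generated_id _); exists b.
    by have := is_trans_conj Wb Ta; rewrite reflZ -coroot_refl.
  have E : coroot a - coroot (refl rs b a) = c%:~R *: coroot b.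
    rewrite coroot_refl // /refl opprB addrC subrK /coroot dotZl -cE scalerA.
    by congr (_ *: _); rewrite [dot a b]dotC; ring.
  have := is_transD Ta (is_transN Tr); rewrite -scalerBr E.
  have [->|->] : c = 1 \/ c = -1 by lia.
    by rewrite scale1r.
  by rewrite scaleN1r scalerN => /is_transN; rewrite opprK.
have [s ss sab] : exists2 s : R, s * s = 1 & dot a a <= s * dot a b.
  have cl : 2 <= `|2 * dot b a / dot a a| by rewrite cE -intr_norm -[2]/(2%:~R) ler_int.
  have [p0|p0] := lerP 0 (dot a b); [exists 1; rewrite ?mulr1 // |exists (-1); rewrite ?mulrNN ?mulr1 //].
    have h0 : 0 <= 2 * dot a b / dot a a by rewrite divr_ge0 ?mulr_ge0 // ltW.
    by move: cl; rewrite [dot b a]dotC ger0_norm // ler_pdivlMr // mul1r ler_pM2l.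
  move: cl; rewrite [dot b a]dotC ler0_norm; last first.
    by rewrite pmulr_lle0 ?invr_gt0 // pmulr_rle0 // ltW.
  by rewrite -mulNr -mulrN ler_pdivlMr // mulN1r ler_pM2l.
have bE : b = s *: a.
  apply/eqP; rewrite -subr_eq0; apply/eqP/(@dot_eq0 _ _ rs).
  have := theta_long rb; rewrite -aa dotBl !dotBr !dotZl !dotZr [dot b a]dotC.
  rewrite mulrA ss mul1r; lra.
have [s1|s1] : s = 1 \/ s = -1.
  have /eqP : (s - 1) * (s + 1) = 0 by rewrite mulrBl mulrDr ss; ring.
  rewrite mulf_eq0 subr_eq0 addr_eq0 => /orP[]/eqP ->; [by left|by right].
- by rewrite bE s1 scale1r.
- by rewrite bE s1 scaleN1r; exact: Tneg.
Qed.

Lemma aff_refl_in a m : is_root rs a -> aff_weyl rs l (aff_refl rs a (lvl m)).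
Proof.
move=> ra; have G0 : aff_weyl_gens rs l (aff_refl rs a 0) by left; exists a.
have := generatedM (is_transMz m (is_trans_coroot ra))
  (generated_comp G0 (generated_id _)).
congr (aff_weyl _ _ _); apply: funext => x /=.
rewrite aff_refl0 aff_reflE /coroot; congr (_ + _).
by rewrite -scaler_int !scalerA; congr (_ *: _); ring.
Qed.

(** The reflection in the hyperplane x.a = m l; it is the junk value 1 when a is
    not a root. *)
Definition arefl a m : affW := insubd (1%g : affW) (aff_refl rs a (lvl m)).

Lemma areflE a m x : is_root rs a -> arefl a m x = aff_refl rs a (lvl m) x.
Proof.
move=> ra; rewrite -[affW_val _]/(\val _) /arefl val_insubd.
by case: asboolP => // /(_ (aff_refl_in m ra)).
Qed.

Lemma aff_reflN a r : aff_refl rs (- a) (- r) = aff_refl rs a r.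
Proof.
apply: funext => x; rewrite /aff_refl !dotNr dotNl !opprK.
congr (x - _); rewrite scalerN -scaleNr; congr (_ *: _); ring.
Qed.

Lemma areflN a m : is_root rs a -> arefl (- a) (- m) = arefl a m.
Proof.
move=> ra; apply: affW_ext => x; rewrite !areflE //; last exact: is_rootN.
by rewrite rmorphN mulNr aff_reflN.
Qed.

Lemma arefl2 a m : is_root rs a -> (arefl a m * arefl a m = 1)%g.
Proof.
move=> ra; apply: affW_ext => x; rewrite affWM_val !areflE //.
by have := congr1 (fun f => f x) (aff_reflK (lvl m) ra).
Qed.

Lemma areflK a m x : is_root rs a -> arefl a m (arefl a m x) = x.
Proof. by move=> ra; rewrite -affWM_val arefl2. Qed.

Lemma areflV a m : is_root rs a -> ((arefl a m)^-1 = arefl a m)%g.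
Proof. by move=> ra; apply/esym/(mulIg (arefl a m)); rewrite mulVg arefl2. Qed.

Lemma dot_arefl_self a m x : is_root rs a ->
  dot (arefl a m x) a = lvl m + lvl m - dot x a.
Proof.
move=> ra; rewrite areflE // aff_reflE dotDl dot_refl refl_self // dotNr dotZl.
rewrite -mulrA mulVf ?gt_eqF ?root_gt0 //; ring.
Qed.

Lemma arefl_fix a m x : is_root rs a -> dot x a = lvl m -> arefl a m x = x.
Proof. by move=> ra e; rewrite areflE // /aff_refl e subrr mulr0 mul0r scale0r subr0. Qed.

Lemma linp_arefl a m x : is_root rs a -> linp (arefl a m) x = refl rs a x.
Proof.
move=> ra; rewrite -(linp_aff_refl a (lvl m)) /linp.
by rewrite !areflE.
Qed.

Lemma adj_arefl a m b : is_root rs a -> adj (arefl a m) b = refl rs a b.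
Proof. by move=> ra; rewrite /adj areflV // linp_arefl. Qed.

Lemma arefl_conj w a q m : is_root rs a ->
    (forall x, dot (w x) a = dot x (adj w a) + lvl q) ->
  (arefl a m * w = w * arefl (adj w a) (m - q))%g.
Proof.
move=> ra wE; have ra' := adj_root w ra.
apply: affW_ext => x; rewrite !affWM_val !areflE // /aff_refl.
rewrite -[in RHS]scaleNr affW_affine linpVK scaleNr wE; congr (_ - _ *: _).
rewrite /adj linp_dot rmorphB /=; ring.
Qed.

(** ** Floor functions and the distance between alcoves *)

Hypothesis l_gt0 : (0 < l)%N.

Let lR : 0 < l%:R :> R. Proof. by rewrite ltr0n. Qed.

(** The position of x relative to the hyperplanes orthogonal to a. *)
Definition kf a x : int := Num.floor (dot x a / l%:R).

Lemma kf_ge m a x : (m <= kf a x) = (lvl m <= dot x a).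
Proof. by rewrite /kf floor_ge_int ler_pdivlMr. Qed.

Lemma kf_lt m a x : (kf a x < m) = (dot x a < lvl m).
Proof. by rewrite ltNge kf_ge -ltNge. Qed.

Lemma lvl_inj m q : lvl m = lvl q -> m = q.
Proof.
move=> /(mulIf _)/wrap[]; first by rewrite gt_eqF.
by move=> /eqP; rewrite eqr_int => /eqP.
Qed.

Lemma lvl_lt m q : (lvl m < lvl q) = (m < q).
Proof. by rewrite ltr_pM2r // ltr_int. Qed.

Lemma lvl_le m q : (lvl m <= lvl q) = (m <= q).
Proof. by rewrite ler_pM2r // ler_int. Qed.

Lemma kfP m a x : lvl m <= dot x a -> dot x a < lvl (m + 1) -> kf a x = m.
Proof. rewrite -kf_ge -kf_lt; lia. Qed.

Definition regular x := forall a m, is_root rs a -> dot x a != lvl m.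

Lemma kfN a x : is_root rs a -> regular x -> kf (- a) x = - kf a x - 1.
Proof.
move=> ra rx; apply: kfP; rewrite dotNr.
  rewrite lerNr -mulNr -rmorphN /= ltW // -kf_lt; lia.
rewrite subrK rmorphN mulNr ltrN2 lt_def rx //= -kf_ge //.
Qed.

Lemma kf_aff w a x : is_root rs a -> forall m,
  (forall y, dot (w y) a = dot y (adj w a) + lvl m) ->
  kf a (w x) = kf (adj w a) x + m.
Proof.
move=> ra m mE; rewrite /kf mE mulrDl -mulrA divff ?gt_eqF // mulr1.
by rewrite floorDrz // intrKfloor.
Qed.

Lemma regular_aff w x : regular x -> regular (w x).
Proof.
move=> rx a m ra; have [q ->] := dot_affW w ra.
apply/eqP => e; have := rx _ (m - q) (adj_root w ra).
by rewrite rmorphB mulrBl -e addrK eqxx.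
Qed.

(** Every hyperplane is counted twice here, once for each of its two normals; this makes
    the invariance under the group evident. *)
Definition adist x y : nat :=
  \sum_(a <- root_seq rs) `|kf a x - kf a y|%N.

Lemma adist_aff w x y : adist (w x) (w y) = adist x y.
Proof.
rewrite /adist; transitivity (\sum_(a <- map (adj w) (root_seq rs)) `|kf a x - kf a y|%N)%N.
  rewrite big_map big_seq [RHS]big_seq; apply: eq_bigr => a /mem_root_seq ra.
  have [m mE] := dot_affW w ra; rewrite !(kf_aff _ ra mE).
  by congr absz; lia.
apply: perm_big; apply: uniq_perm; rewrite ?root_seq_uniq ?map_inj_uniq ?root_seq_uniq //.
  exact: adj_inj.
move=> a; apply/mapP/idP => [[b /mem_root_seq rb ->]|/mem_root_seq ra].
  by apply/mem_root_seq; exact: adj_root.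
exists (linp w a); last by rewrite /adj linpKV.
by apply/mem_root_seq; exact: linp_root.
Qed.

Lemma adist_eq0 x y : adist x y = 0%N <-> forall a, is_root rs a -> kf a x = kf a y.
Proof.
split => [/eqP|h]; last first.
  by rewrite /adist big_seq big1 // => a /mem_root_seq /h ->; rewrite subrr.
rewrite sum_nat_seq_eq0 => /allP h a /mem_root_seq /h /=; lia.
Qed.

Definition same_cell x y := forall a, is_root rs a -> kf a x = kf a y.

Lemma same_cell_aff w x y : same_cell x y -> same_cell (w x) (w y).
Proof. by move=> /adist_eq0 h; apply/adist_eq0; rewrite adist_aff. Qed.

Lemma same_cell_pos x y : regular x -> regular y ->
  (forall a, pos_root rs a -> kf a x = kf a y) -> same_cell x y.
Proof.
move=> rx ry h a ra; have [/h //|pa] := root_pos_neg ra.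
have := h _ pa; rewrite !kfN //; lia.
Qed.

(** ** The fundamental alcove *)

Lemma fund_alcoveP x : fund_alcove rs l x <->
  forall a, pos_root rs a -> 0 < dot x a < l%:R.
Proof.
split=> [[Cx xt] a pa|h].
  rewrite dot_pos_gt0 //=; apply: le_lt_trans xt.
  by apply: dot_le_theta (pos_rootW pa) => i; rewrite ltW // Cx.
split=> [i|]; first by case/andP: (h _ (simple_pos rs i)).
by case/andP: (h _ (theta_pos rs)).
Qed.

Lemma fund_kf x a : fund_alcove rs l x -> pos_root rs a -> kf a x = 0.
Proof.
move=> /fund_alcoveP Ax /Ax /andP[h1 h2].
by apply: kfP; rewrite ?mul0r ?add0r ?mul1r // ltW.
Qed.

Lemma fund_regular x : fund_alcove rs l x -> regular x.
Proof.
move=> Ax; have pos a m : pos_root rs a -> dot x a != lvl m.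
  move=> pa; apply/eqP => e; have /andP[] := (fund_alcoveP x).1 Ax a pa.
  rewrite e pmulr_lgt0 // ltr0z gtr_pMl // -[1]/(1%:~R) ltr_int; lia.
move=> a m ra; have [/pos //|/pos h] := root_pos_neg ra.
by have := h (- m); rewrite dotNr rmorphN mulNr eqr_opp.
Qed.

Lemma kf_fund x : regular x -> (forall a, pos_root rs a -> kf a x = 0) ->
  fund_alcove rs l x.
Proof.
move=> rx h; apply/fund_alcoveP => a pa; have := h a pa.
have := rx a 0 (pos_rootW pa); have := kf_ge 0 a x; have := kf_lt 1 a x.
rewrite mul0r mul1r => h1 h0 ne e; rewrite -h1 lt_def ne -h0 e //.
Qed.

Lemma fund_nonempty : exists x, fund_alcove rs l x.
Proof.
have [x Cx] := chamber_nonempty rs.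
have xt := dot_pos_gt0 Cx (theta_pos rs).
exists ((l%:R / (2 * dot x theta)) *: x).
have c0 : 0 < l%:R / (2 * dot x theta) by rewrite divr_gt0 ?mulr_gt0.
split=> [i|/=]; first by rewrite dotZl mulr_gt0 // Cx.
have E : l%:R / (2 * dot x theta) * dot x theta = l%:R / 2.
  by field; rewrite gt_eqF.
rewrite dotZl E.
by rewrite ltr_pdivrMr // ltr_pMr // ltr1n.
Qed.

(** The base point: w is determined by the position of w bpt, on which all comparisons of
    alcoves are read off. *)
Definition bpt : V := xget 0 (fund_alcove rs l).

Lemma bpt_fund : fund_alcove rs l bpt.
Proof.
by rewrite /bpt; case: xgetP => [//|h]; have [x /h] := fund_nonempty.
Qed.

Lemma bpt_regular : regular bpt. Proof. exact: fund_regular bpt_fund. Qed.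

(** The walls of the fundamental alcove, as affine functionals x.a - m l that are
    positive on it. *)
Definition wallp a m := (exists2 i, a = simple rs i & m = 0) \/
  (a = - theta /\ m = -1).

Lemma wallp_root a m : wallp a m -> is_root rs a.
Proof.
by case=> [[i -> _]|[-> _]]; [exact: simple_root | apply: is_rootN; exact: theta_root].
Qed.

Lemma wallp_gt x a m : fund_alcove rs l x -> wallp a m -> lvl m < dot x a.
Proof.
move=> [Cx xt] [[i -> ->]|[-> ->]]; first by rewrite mul0r Cx.
by rewrite mulN1r dotNr ltrN2.
Qed.

Lemma wallpP x : (forall a m, wallp a m -> lvl m < dot x a) -> fund_alcove rs l x.
Proof.
move=> h; split=> [i|/=].
  by have := h (simple rs i) 0; rewrite mul0r; apply; left; exists i.
have : lvl (-1) < dot x (- theta) by apply: h; right.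
by rewrite mulN1r dotNr ltrN2.
Qed.

(** For the wall of a simple root because the simple reflection permutes the other
    positive roots; for the wall of theta because theta pairs with the other positive
    roots to 0 or 1, so that x.c becomes x.(c - theta) + l, and - l < x.(c - theta) < 0. *)
Lemma wall_cross x a m b : wallp a m -> fund_alcove rs l x -> is_root rs b ->
  b != a -> b != - a -> kf b (arefl a m x) = kf b x.
Proof.
move=> wam Ax rb ba bNa; have ra := wallp_root wam.
have rx := fund_regular Ax; have rsx := regular_aff (arefl a m) rx.
suff pos c : pos_root rs c -> c != a -> c != - a -> kf c (arefl a m x) = kf c x.
  have [/pos //|/pos h] := root_pos_neg rb; first exact.
  have : kf (- b) (arefl a m x) = kf (- b) x by apply: h; rewrite ?eqr_opp // eqr_oppLR.
  rewrite !kfN //; lia.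
move=> {b rb ba bNa} pc ca cNa; rewrite (fund_kf Ax pc).
have Adot := (fund_alcoveP x).1 Ax.
have E r : aff_refl rs a r x = arefl a m x ->
    dot (arefl a m x) c = dot x (refl rs a c) + r * (2 * dot c a / dot a a).
  by move=> <-; rewrite aff_reflE dotDl dotZl dot_refl [dot a c]dotC; ring.
have {E} := E _ (esym (areflE m x ra)).
case: wam ra ca cNa {rsx} => [[i -> ->]|[-> ->]] ra ca cNa.
  rewrite mul0r mul0r addr0 => E; have /andP[h1 h2] := Adot _ (refl_simple_pos pc ca).
  by apply: kfP; rewrite E ?mul0r ?add0r ?mul1r // ltW.
rewrite opprK in cNa; have tt := root_gt0 (theta_root rs).
have -> : refl rs (- theta) c = refl rs theta c.
  by rewrite -!aff_refl0 -[in LHS]oppr0 aff_reflN.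
have -> : lvl (-1) * (2 * dot c (- theta) / dot (- theta) (- theta)) =
    l%:R * (2 * dot c theta / dot theta theta).
  by rewrite dotNl !dotNr opprK mulrN1z; ring.
rewrite /refl.
have [e|e] := theta_pairing pc cNa; rewrite e => E.
  rewrite mulr0 addr0 scale0r subr0 in E.
  by apply: kfP; rewrite E ?mul0r ?add0r ?mul1r; have /andP[h1 h2] := Adot c pc => //; exact: ltW.
rewrite mulr1 scale1r dotBr in E.
have /andP[h1 h2] := Adot c pc; have /andP[h3 h4] := Adot _ (theta_pos rs).
have ct : dot x c < dot x theta.
  have : 0 <= dot x theta - dot x c.
    rewrite subr_ge0; apply: dot_le_theta (pos_rootW pc) => i.
    by rewrite ltW //; case: Ax.
  rewrite le_eqVlt subr_gt0 => /orP[|//]; rewrite eq_sym -dotBr => /eqP e0.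
  have rtc : is_root rs (theta - c).
    rewrite -is_rootNE opprB -[X in c - X]scale1r -e -/(refl rs theta c).
    by apply: refl_root; [exact: theta_root | exact: pos_rootW].
  by have := rx _ 0 rtc; rewrite mul0r e0 eqxx.
by apply: kfP; rewrite E ?mul0r ?add0r ?mul1r; lra.
Qed.

Lemma wall_kf x a m : wallp a m -> fund_alcove rs l x -> kf a x = m.
Proof.
move=> wam Ax; have Adot := (fund_alcoveP x).1 Ax.
have h := wallp_gt Ax wam; apply: kfP; first exact: ltW.
case: wam {h} => [[i -> ->]|[-> ->]].
  by rewrite add0r mul1r; case/andP: (Adot _ (simple_pos rs i)).
by rewrite addNr mul0r dotNr oppr_lt0; case/andP: (Adot _ (theta_pos rs)).
Qed.

End AffineWeyl.

(** * Facets, alcoves and walls *)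

Section Facets.
Variables (R : realType) (n : nat) (rs : root_system R n) (l : nat).
Hypothesis l_gt0 : (0 < l)%N.
Local Notation V := 'rV[R]_n.
Local Notation dot := (dot rs).
Local Notation affW := (affW rs l).
Local Notation lvl m := ((m : int)%:~R * l%:R : R).
Local Notation kf := (kf rs l).
Local Notation regular := (regular rs l).
Implicit Types (x y z a b : V) (w g : affW) (m q : int).

Lemma dot_continuous a : continuous (fun x => dot x a).
Proof.
pose f (s : seq 'I_n) x := \sum_(j <- s) x 0 j * dot (delta_mx 0 j) a.
have -> : (fun x => dot x a) = f (index_enum _).
  apply: funext => x; rewrite {1}(row_sum_delta x) dotC dot_sumr.
  by apply: eq_bigr => j _; rewrite dotZr dotC.
elim: (index_enum _) => [|j s IH] x.
  have -> : f [::] = fun=> 0 by apply: funext => y; rewrite /f big_nil.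
  exact: cst_continuous.
have -> : f (j :: s) = fun y => y 0 j * dot (delta_mx 0 j) a + f s y.
  by apply: funext => y; rewrite /f big_cons.
apply: (@cvgD _ _ _ _ (nbhs_filter x)); last exact: IH.
have cj : (fun y : V => y 0 j) @ x --> x 0 j by exact: coord_continuous.
exact: (@cvgMr_tmp _ _ _ (nbhs_filter x) _ _ _ cj).
Qed.

Lemma closure_dot_ge (A : set V) (c : R) a y : closure A y ->
  (forall z, A z -> c <= dot z a) -> c <= dot y a.
Proof.
move=> Ay h; have cl : closed [set x | c <= dot x a].
  apply: (@preimage_closed _ _ (fun x => dot x a) [set r | c <= r]).
    by move=> x _; exact: dot_continuous.
  exact: closed_ge.
by apply: cl; apply: closureS Ay => z /h.
Qed.

Lemma closure_segment (A : set V) y v :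
  (forall t : R, 0 < t -> t < 1 -> A (y + t *: v)) -> closure A y.
Proof.
move=> h B; have cv : (fun t : R => y + t *: v) @ (0 : R) --> y + (0 : R) *: v.
  apply: cvgD; first exact: cvg_cst.
  by apply: cvgZr_tmp; exact: cvg_id.
rewrite scale0r addr0 in cv; move=> /cv /nbhs_ballP[e /= e0 eB].
pose t := Num.min (e / 2) (1 / 2).
have t0 : 0 < t by rewrite lt_min !divr_gt0.
have t1 : t <= 1 / 2 by rewrite ge_min lexx orbT.
have te : t <= e / 2 by rewrite ge_min lexx.
exists (y + t *: v); split; first by apply: h => //; lra.
apply: eB; rewrite /ball /= sub0r normrN gtr0_norm //; lra.
Qed.

(** Points in the same facet, and points in the closure of a facet, described by
    all half-spaces at once: as both a root and its opposite are allowed, weak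
    inequalities suffice.  Both relations are visibly invariant under the affine
    Weyl group. *)
Definition same_facet x y :=
  forall a m, is_root rs a -> (lvl m <= dot y a) = (lvl m <= dot x a).
Definition spec p y :=
  forall a m, is_root rs a -> lvl m <= dot y a -> lvl m <= dot p a.

Lemma same_facet_le x y a m : is_root rs a -> same_facet x y ->
  (dot y a <= lvl m) = (dot x a <= lvl m).
Proof.
move=> ra /(_ (- a) (- m) (is_rootN ra)).
by rewrite !dotNr rmorphN mulNr !lerN2.
Qed.

Lemma spec_le p y a m : is_root rs a -> spec p y ->
  dot y a <= lvl m -> dot p a <= lvl m.
Proof.
move=> ra /(_ (- a) (- m) (is_rootN ra)).
by rewrite !dotNr rmorphN mulNr !lerN2.
Qed.

Lemma spec_trans y x z : spec x y -> spec y z -> spec x z.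
Proof. by move=> xy yz a m ra /(yz _ _ ra)/(xy _ _ ra). Qed.

Lemma spec_aff w x y : spec x y -> spec (w x) (w y).
Proof.
move=> xy a m ra; have [q E] := dot_affW w ra.
rewrite !E -!lerBlDr -mulrBl -rmorphB; apply: xy; exact: adj_root.
Qed.

Lemma facetE F x : facet rs l F -> F x -> F = [set y | same_facet x y].
Proof.
move=> [_ [m [on FE]]] Fx; move: Fx; rewrite FE /= => Fx.
apply/seteqP; split=> y /= Fy; last first.
  move=> a pa; have ra := pos_rootW pa; move: (Fx a pa).
  have E q : (lvl q == dot y a) = (lvl q == dot x a).
    by rewrite !eq_le Fy // (same_facet_le _ ra Fy).
  case: (on a) => [/eqP|]; first by rewrite eq_sym -E eq_sym => /eqP.
  by rewrite !lt_neqAle E Fy // [dot y a == _]eq_sym E (same_facet_le _ ra Fy) [dot x a == _]eq_sym.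
suff pos a q : pos_root rs a -> (lvl q <= dot y a) = (lvl q <= dot x a) /\
    (dot y a <= lvl q) = (dot x a <= lvl q).
  move=> a q ra; have [pa|pa] := root_pos_neg ra; first by case: (pos a q pa).
  have [_] := pos _ (- q) pa; by rewrite !dotNr rmorphN mulNr !lerN2.
move=> pa; move: (Fx a pa) (Fy a pa); case: (on a) => [-> -> //|].
move=> /andP[x1 x2] /andP[y1 y2].
have [qm|qm] := lerP q (m a).
  have h : lvl q <= lvl (m a) by rewrite lvl_le.
  by split; lra.
have h : lvl (m a + 1) <= lvl q by rewrite lvl_le //; lia.
by split; lra.
Qed.

(** A facet is recorded by the positions relative to all half-spaces, so facet_of x does
    exist and is the set of points with the same record as x. *)
Lemma facet_ofE x : facet_of rs l x = [set y | same_facet x y].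
Proof.
rewrite /facet_of; case: xgetP => [F _ [fF Fx]|h]; first exact: facetE.
case: (h [set y | forall a, pos_root rs a ->
  if dot x a == lvl (kf a x) then dot y a = lvl (kf a x)
  else lvl (kf a x) < dot y a < lvl (kf a x + 1)]).
have xin : forall a, pos_root rs a ->
    if dot x a == lvl (kf a x) then dot x a = lvl (kf a x)
    else lvl (kf a x) < dot x a < lvl (kf a x + 1).
  move=> a pa; case: eqVneq => // ne; rewrite lt_neqAle eq_sym ne /=.
  by rewrite -kf_ge // lexx /= -kf_lt //; lia.
split=> //; split; first by exists x.
by exists (fun a => kf a x), (fun a => dot x a == lvl (kf a x)).
Qed.

Lemma facet_of_facet x : facet rs l (facet_of rs l x).
Proof.
rewrite /facet_of; case: xgetP => [F _ [] //|h].
have := facet_ofE x; rewrite /facet_of; case: xgetP => [F _ [fF Fx] _|_ E].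
  by case: (h F).
suff : [set y | same_facet x y] x by rewrite -E.
by [].
Qed.

Lemma facet_of_refl x : facet_of rs l x x.
Proof. by rewrite facet_ofE. Qed.

Lemma facet_hyp x p : is_hyp rs p ->
  facet_of rs l x `<=` hyp rs l p <-> hyp rs l p x.
Proof.
move=> hp; have rp := pos_rootW hp; split=> [|px y]; first by apply; exact: facet_of_refl.
rewrite facet_ofE /hyp /= => xy; move: px; rewrite /hyp /= => px.
by apply/eqP; rewrite eq_le (same_facet_le _ rp xy) xy // -eq_le px.
Qed.

Lemma facet_neg_side x p : is_hyp rs p ->
  facet_of rs l x `<=` neg_side rs l p <-> neg_side rs l p x.
Proof.
move=> hp; have rp := pos_rootW hp; split=> [|px y]; first by apply; exact: facet_of_refl.
by rewrite facet_ofE /= => xy; rewrite /neg_side /= ltNge xy // -ltNge.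
Qed.

Lemma facet_pos_side x p : is_hyp rs p ->
  facet_of rs l x `<=` pos_side rs l p <-> pos_side rs l p x.
Proof.
move=> hp; have rp := pos_rootW hp; split=> [|px y]; first by apply; exact: facet_of_refl.
by rewrite facet_ofE /= => xy; rewrite /pos_side /= ltNge (same_facet_le _ rp xy) -ltNge.
Qed.

Lemma facet_closure_spec p y :
  facet_of rs l p `<=` closure (facet_of rs l y) -> spec p y.
Proof.
move=> h a m ra ya; apply: closure_dot_ge (h _ (facet_of_refl p)) _ => z.
by rewrite facet_ofE /= => /(_ a m ra) ->.
Qed.

Lemma same_facet_sym x y : same_facet x y -> same_facet y x.
Proof. by move=> h a m ra; rewrite h. Qed.

Lemma same_facet_spec x y : same_facet x y -> spec y x.
Proof. by move=> h a m ra; rewrite h. Qed.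

Lemma facet_of_aff w x : w @` facet_of rs l x = facet_of rs l (w x).
Proof.
have sub g u y : same_facet u y -> same_facet (g u) (g y).
  move=> uy a m ra; have [q E] := dot_affW g ra.
  by rewrite !E -!lerBlDr -mulrBl -rmorphB uy //; exact: adj_root.
rewrite !facet_ofE; apply/seteqP; split=> [_ [y xy <-]|y xy].
  exact: sub.
by exists ((w^-1)%g y); [rewrite -[x](affWVK w); exact: sub | rewrite affWKV].
Qed.

(** ** Alcoves *)

(** The alcove on the upper side of x: the points not on any hyperplane whose
    positions relative to all positive roots are those of x. *)
Definition upper_cell x : set V :=
  [set y | regular y /\ forall a, pos_root rs a -> kf a y = kf a x].

Lemma hyp_complementE x : hyp_complement rs l x <-> regular x.
Proof.
split=> [h a m ra|h [a m] ra /= e]; last first.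
  by have := h a m (pos_rootW ra); rewrite -e eqxx.
apply/eqP => e; have [pa|pa] := root_pos_neg ra; first exact: (h (a, m) pa).
by apply: (h (- a, - m) pa); rewrite /hyp /= dotNr rmorphN mulNr e.
Qed.

(** A connected set avoiding the hyperplanes has constant floors by the intermediate value
    theorem; conversely the points with given floors form a convex set. *)
Lemma component_upper_cell x : regular x ->
  connected_component (hyp_complement rs l) x = upper_cell x.
Proof.
move=> rx; have xx : upper_cell x x by split.
apply/seteqP; split.
  move=> y yC; split.
    by apply/hyp_complementE; apply: connected_component_sub yC.
  move=> a pa; have ra := pos_rootW pa.
  pose C := connected_component (hyp_complement rs l) x.
  have : connected ((fun z => dot z a) @` C).
    apply: connected_continuous_connected; first exact: component_connected.
    by apply: continuous_subspaceT => z; exact: dot_continuous.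
  move/connected_intervalP => itv.
  have Cx : C x by apply: connected_component_refl; apply/hyp_complementE.
  have noc m : ~ [set dot z a | z in C] (lvl m).
    move=> [z Cz /eqP]; apply/negP.
    have /hyp_complementE : hyp_complement rs l z by exact: connected_component_sub Cz.
    exact.
  have im z : C z -> [set dot z a | z in C] (dot z a) by move=> Cz; exists z.
  case: (ltgtP (kf a y) (kf a x)) => // h.
    case: (noc (kf a x)); apply: (itv _ _ (im _ yC) (im _ Cx)).
    by rewrite -[X in _ && X]kf_ge // lexx andbT ltW // -kf_lt.
  case: (noc (kf a y)); apply: (itv _ _ (im _ Cx) (im _ yC)).
  by rewrite -[X in _ && X]kf_ge // lexx andbT ltW // -kf_lt.
apply: connected_component_max => //; first by move=> y [ry _]; apply/hyp_complementE.
have seg y : upper_cell x y -> connected [set x + t *: (y - x) | t in `[0, 1]%classic].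
  move=> _; apply: connected_continuous_connected; first exact: segment_connected.
  apply: continuous_subspaceT => t; apply: cvgD; first exact: cvg_cst.
  by apply: cvgZr_tmp; exact: cvg_id.
have -> : upper_cell x = \bigcup_(y in upper_cell x)
    [set x + t *: (y - x) | t in `[0, 1]%classic].
  apply/seteqP; split=> [y xy|_ [y [ry yx] [t /= + <-]]].
    exists y => //; exists 1; first by rewrite /= in_itv /= ler01 lexx.
    by rewrite scale1r addrC subrK.
  rewrite in_itv /= => /andP[t0 t1].
  suff pos a : pos_root rs a -> forall m, lvl m != dot (x + t *: (y - x)) a /\
      kf a (x + t *: (y - x)) = kf a x.
    split; last by move=> a pa; case: (pos a pa 0).
    move=> a m ra; rewrite eq_sym; have [pa|pa] := root_pos_neg ra.
      by case: (pos a pa m).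
    by case: (pos _ pa (- m)); rewrite dotNr rmorphN mulNr eqr_opp.
  move=> pa m; have ra := pos_rootW pa; have := yx _ pa; set k := kf a x => ky.
  have bnd z : regular z -> kf a z = k -> lvl k < dot z a < lvl (k + 1).
    move=> rz kz; rewrite lt_neqAle eq_sym rz //= -kf_ge // -kf_lt // kz lexx /=; lia.
  have /andP[x1 x2] := bnd x rx erefl; have /andP[y1 y2] := bnd y ry ky.
  have D : dot (x + t *: (y - x)) a = (1 - t) * dot x a + t * dot y a.
    by rewrite dotDl dotZl dotBl; ring.
  have h1 : lvl k < dot (x + t *: (y - x)) a.
    rewrite D; have [->|t0'] := eqVneq t 0; first lra.
    have : 0 < t by rewrite lt_def t0'.
    move: x1 y1; move: (lvl k) (dot x a) (dot y a) => u p q; nra.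
  have h2 : dot (x + t *: (y - x)) a < lvl (k + 1).
    rewrite D; have [->|t0'] := eqVneq t 0; first lra.
    have : 0 < t by rewrite lt_def t0'.
    move: x2 y2; move: (lvl _) (dot x a) (dot y a) => u p q; nra.
  split; last by apply: kfP => //; exact: ltW.
  apply/eqP => e; rewrite -e !lvl_lt // in h1 h2; lia.
apply: bigcup_connected; last exact: seg.
exists x => y _; exists 0; first by rewrite /= in_itv /= lexx ler01.
by rewrite scale0r addr0.
Qed.

Lemma small_scale (s : seq V) (f g : V -> R) : (forall a, a \in s -> 0 < g a) ->
  exists2 e : R, 0 < e & forall a, a \in s -> e * f a < g a.
Proof.
elim: s => [|a s IH] h; first by exists 1.
have [|e e0 eh] := IH; first by move=> b bs; apply: h; rewrite inE bs orbT.
have ga : 0 < g a by apply: h; rewrite inE eqxx.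
pose d := Num.min e (g a / (`|f a| + 1)).
have F0 : 0 < `|f a| + 1 by rewrite ltr_wpDl.
have d0 : 0 < d by rewrite lt_min e0 divr_gt0.
exists d => // b; rewrite inE => /orP[/eqP ->|bs].
  have : d <= g a / (`|f a| + 1) by rewrite ge_min lexx orbT.
  rewrite ler_pdivlMr // mulrDr mulr1 => dg.
  have : d * f a <= d * `|f a| by rewrite ler_pM2l // ler_norm.
  lra.
have de : d <= e by rewrite ge_min lexx.
have gb := h b; have := eh b bs; have [fb|fb] := lerP 0 (f b).
  by move=> eb; apply: le_lt_trans eb; exact: ler_wpM2r.
move=> _; apply: le_lt_trans (gb _); last by rewrite inE bs orbT.
by rewrite mulr_ge0_le0 // ltW.
Qed.

(** Moving slightly into the chamber leads from x into the alcove above it. *)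
Lemma upper_cell_near x : exists v, forall t : R, 0 < t -> t < 1 ->
  upper_cell x (x + t *: v).
Proof.
have [c Cc] := chamber_nonempty rs.
have [|e e0 eh] := @small_scale (root_seq rs) (fun a => dot c a)
    (fun a => lvl (kf a x + 1) - dot x a).
  by move=> a /mem_root_seq ra; rewrite subr_gt0 -kf_lt //; lia.
exists (e *: c) => t t0 t1.
suff pos a : pos_root rs a -> lvl (kf a x) < dot (x + t *: (e *: c)) a < lvl (kf a x + 1).
  split=> [|a pa].
    apply/hyp_complementE => -[a m] pa /= E; move: (pos a pa).
    rewrite E !lvl_lt //; lia.
  by have /andP[h1 h2] := pos a pa; apply: kfP => //; exact: ltW.
move=> pa; have ra := pos_rootW pa; have ca := dot_pos_gt0 Cc pa.
have h1 : lvl (kf a x) <= dot x a by rewrite -kf_ge.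
have h2 := eh a ((mem_root_seq _ _).2 ra).
rewrite dotDl !dotZl; have h3 : 0 < e * dot c a by exact: mulr_gt0.
have h4 : t * (e * dot c a) <= e * dot c a by rewrite ler_piMl // ltW.
have h5 : 0 < t * (e * dot c a) by exact: mulr_gt0.
by apply/andP; split; lra.
Qed.

Lemma upper_cell_nonempty x : exists y, upper_cell x y.
Proof.
have [v h] := upper_cell_near x; exists (x + 2^-1 *: v); apply: h; lra.
Qed.

Lemma upper_cell_eq x y : upper_cell x y -> upper_cell y = upper_cell x.
Proof.
move=> [ry yx]; apply/seteqP; split=> z [rz zx]; split=> // a pa.
  by rewrite zx // yx.
by rewrite zx // yx.
Qed.

(** If the alcove of z has x in its closure, the floors of x and z can only differ at a
    hyperplane through x with z on the negative side. *)
Lemma upper_alcove_facet x : upper_alcove rs l (facet_of rs l x) = upper_cell x.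
Proof.
rewrite /upper_alcove; case: xgetP => [A _ [[z /hyp_complementE rz ->]]|h].
  rewrite component_upper_cell // => Fcl Fpos.
  apply: upper_cell_eq; split=> // a pa; have ra := pos_rootW pa.
  have clx := Fcl _ (facet_of_refl x).
  have h1 : lvl (kf a z) <= dot x a.
    apply: closure_dot_ge clx _ => y [_ /(_ a pa) <-]; by rewrite -kf_ge.
  have h2 : - lvl (kf a z + 1) <= dot x (- a).
    apply: closure_dot_ge clx _ => y [_ /(_ a pa) <-].
    by rewrite dotNr lerN2 ltW // -kf_lt //; lia.
  rewrite dotNr lerN2 le_eqVlt in h2; case/orP: h2 => [/eqP e|h2]; last first.
    by apply/esym/kfP.
  have hp : is_hyp rs (a, kf a z + 1) by [].
  have /(Fpos _ hp)/(_ z) := (facet_hyp x hp).2 e.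
  have zz : upper_cell z z by split.
  by move=> /(_ zz); rewrite /pos_side /= => /ltW; rewrite -kf_ge //; lia.
have [y yx] := upper_cell_nonempty x; case: (h (upper_cell x)); split.
- exists y; first by apply/hyp_complementE; case: yx.
  by rewrite component_upper_cell ?(upper_cell_eq yx) //; case: yx.
- move=> z; rewrite facet_ofE /= => xz.
  have [v vz] := upper_cell_near z; apply: closure_segment (v) _ => t t0 t1.
  have [rt tz] := vz t t0 t1; split=> // a pa; rewrite tz //.
  apply: kfP => //; first by rewrite xz -?kf_ge //; exact: pos_rootW.
  by rewrite ltNge xz -?ltNge -?kf_lt //; [lia | exact: pos_rootW].
- move=> [a m] pa /(facet_hyp _ pa) xm z [rz zx]; rewrite /pos_side /=.
  have {}xm : dot x a = lvl m by exact: xm.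
  have zm : lvl m <= dot z a by rewrite -kf_ge // zx // kf_ge // xm.
  by rewrite lt_neqAle zm andbT eq_sym; apply: rz; exact: pos_rootW.
Qed.

(** ** The Coxeter generators *)

Local Notation bpt := (bpt rs l).

(** The segment from y to the base point enters the open alcove at once. *)
Lemma fund_closure y : (forall a m, wallp rs a m -> lvl m <= dot y a) ->
  closure (fund_alcove rs l) y.
Proof.
move=> h; apply: closure_segment (bpt - y) _ => t t0 t1; apply: wallpP => // a m wam.
have := wallp_gt (bpt_fund rs l_gt0) wam; have := h a m wam.
rewrite dotDl dotZl dotBl; move: (lvl m) (dot y a) (dot bpt a) => u p q; nra.
Qed.

Lemma wallp_unique a m q : wallp rs a m -> wallp rs a q -> m = q.
Proof.
have A := bpt_fund rs l_gt0.
by move=> /(wall_kf l_gt0)/(_ A) <- /(wall_kf l_gt0)/(_ A) <-.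
Qed.

(** If a facet in the closure of the fundamental alcove lies on a single hyperplane, then this
    is a wall, as the points on no wall are in the open alcove.  Conversely the midpoint of the
    base point and its mirror image in a wall lies on that wall and on no other
    hyperplane. *)
Lemma affS_wallp (s : affW) :
  affS rs l s <-> exists a m, wallp rs a m /\ s = arefl rs l a m.
Proof.
have Ab := bpt_fund rs l_gt0; have rb := bpt_regular (rs := rs) l_gt0.
split=> [[p [hp [F [fF Fcl Fp]]] sE]|[a [m [wam ->]]]].
  have [[x Fx] _] := fF; have FE := facetE fF Fx; have FE' : F = facet_of rs l x by rewrite facet_ofE.
  have wx a m : wallp rs a m -> lvl m <= dot x a.
    move=> wam; apply: closure_dot_ge (Fcl _ Fx) _ => z Az.
    by apply: ltW; exact: wallp_gt.
  have [a [m [wam xa]]] : exists a m, wallp rs a m /\ dot x a = lvl m.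
    apply: contrapT => no; have : fund_alcove rs l x.
      apply: wallpP => // a m wam; rewrite lt_neqAle wx // andbT.
      by apply/eqP => e; apply: no; exists a, m.
    move=> /(fund_regular l_gt0)/(_ p.1 p.2 (pos_rootW hp)) /eqP; apply.
    by apply: (Fp p hp).2.
  exists a, m; split => //; apply: affW_ext => y.
  rewrite areflE ?sE /hyp_refl; last exact: wallp_root wam.
  have hq (q : V * int) : is_hyp rs q -> hyp rs l q x -> q = p.
    by move=> hq xq; apply/(Fp q hq); rewrite FE'; apply/facet_hyp.
  case: wam xa => [[i -> ->]|[-> ->]] xa.
    by rewrite -(hq (simple rs i, 0)) //; exact: simple_pos.
  rewrite -(hq (theta rs, 1)); first by rewrite rmorphN mulNr aff_reflN.
    exact: theta_pos.
  by rewrite /hyp /=; move/eqP: xa; rewrite dotNr rmorphN mulNr eqr_opp => /eqP.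
have ra := wallp_root wam; clear s; pose s := arefl rs l a m.
pose x := 2^-1 *: (bpt + s bpt).
have xE b : dot x b = (dot bpt b + dot (s bpt) b) / 2.
  by rewrite dotZl dotDl mulrC.
have xa : dot x a = lvl m by rewrite xE dot_arefl_self //; lra.
have bnd z b : is_root rs b -> regular z -> lvl (kf b z) < dot z b < lvl (kf b z + 1).
  move=> rbb rz; rewrite lt_neqAle eq_sym rz //= -kf_ge // -kf_lt // lexx /=; lia.
have xb b : is_root rs b -> b != a -> b != - a ->
    lvl (kf b bpt) < dot x b < lvl (kf b bpt + 1).
  move=> rbb ba bNa; rewrite xE.
  have := bnd _ b rbb (regular_aff s rb); rewrite (wall_cross l_gt0 wam) //.
  have := bnd _ b rbb rb; move: (lvl _) (lvl _) => u1 u2 /andP[? ?] /andP[? ?].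
  by apply/andP; split; lra.
suff main p : is_hyp rs p -> hyp rs l p x -> aff_refl rs p.1 (lvl p.2) = s ->
    p.1 = a \/ p.1 = - a -> affS rs l s.
  case: (wam) => [[i aE mE]|[aE mE]].
    apply: (main (simple rs i, 0)); rewrite /is_hyp /hyp /= -?aE -?mE //.
    - by rewrite aE; exact: simple_pos.
    - by apply: funext => y; rewrite /s areflE.
    - by left.
  have aN : theta rs = - a by rewrite aE opprK.
  apply: (main (theta rs, 1)); rewrite /is_hyp /hyp /= ?aN.
  - by rewrite -aN; exact: theta_pos.
  - by rewrite dotNr xa mE rmorphN mulNr opprK.
  - apply: funext => y; rewrite /s areflE // mE rmorphN mulNr.
    by rewrite -[in LHS](opprK (lvl 1)) aff_reflN.
  - by right.
move=> hp px sE pa; exists p; last by rewrite -sE.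
split=> //; exists (facet_of rs l x); split; first exact: facet_of_facet.
  move=> y; rewrite facet_ofE /= => xy; apply: fund_closure => b q wbq.
  have rbb := wallp_root wbq; rewrite xy //; have kb := wall_kf l_gt0 wbq Ab.
  have [ba|ba] := eqVneq b a.
    by rewrite ba in wbq *; rewrite (wallp_unique wbq wam) xa.
  have [bNa|bNa] := eqVneq b (- a); last first.
    by have /andP[] := xb b rbb ba bNa; rewrite kb => /ltW.
  rewrite bNa dotNr xa -mulNr -rmorphN lvl_le // -kb bNa kfN // (wall_kf l_gt0 wam) //.
  lia.
move=> q hq; rewrite facet_hyp //; split=> [xq|->//].
have rq := pos_rootW hq.
have q1 : q.1 = p.1.
  have [qa|qa] := eqVneq q.1 a; last have [qNa|qNa] := eqVneq q.1 (- a).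
  - rewrite qa; case: pa => [-> //|pNa]; case: (@pos_rootN _ _ rs q.1) => //.
    by rewrite qa -pNa.
  - rewrite qNa; case: pa => [pa|-> //]; case: (@pos_rootN _ _ rs p.1) => //.
    by rewrite pa -qNa.
  - have := xb _ rq qa qNa; rewrite xq !lvl_lt //; lia.
rewrite [q]surjective_pairing [p]surjective_pairing q1; congr pair.
by apply: (@lvl_inj R l l_gt0); rewrite -xq -px q1.
Qed.

End Facets.

(** * Length, exchange and the Bruhat order *)

Section Words.
Variables (G : groupType) (S : set G).
Implicit Types (x y w u s : G).

Lemma is_word0 : is_word S 0 1%g.
Proof. by exists [::]; split=> //; rewrite big_nil. Qed.

Lemma is_word_cons k s w : S s -> is_word S k w -> is_word S k.+1 (s * w)%g.
Proof.
move=> Ss [r [rk rS ->]]; exists (s :: r); split; rewrite ?big_cons //= ?rk //.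
by move=> g; rewrite inE => /orP[/eqP -> //|/rS].
Qed.

Lemma is_word_nil w : is_word S 0 w -> w = 1%g.
Proof. by move=> [r [/size0nil -> _ ->]]; rewrite big_nil. Qed.

Lemma is_word_uncons k w : is_word S k.+1 w ->
  exists s u, [/\ S s, is_word S k u & w = (s * u)%g].
Proof.
move=> [[|s r] [] // [rk] rS ->]; exists s, (\prod_(g <- r) g)%g; split.
- by apply: rS; rewrite inE eqxx.
- by exists r; split => // g gr; apply: rS; rewrite inE gr orbT.
- by rewrite big_cons.
Qed.

Lemma is_word_cat k m w u : is_word S k w -> is_word S m u ->
  is_word S (k + m) (w * u)%g.
Proof.
move=> + Wu; elim: k w => [|k IH] w; first by move=> /is_word_nil ->; rewrite mul1g.
move=> /is_word_uncons[s [w' [Ss Ww' ->]]]; rewrite -mulgA addSn.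
by apply: is_word_cons => //; exact: IH.
Qed.

Lemma is_word1 s : S s -> is_word S 1 s.
Proof. by move=> Ss; rewrite -[s]mulg1; apply: is_word_cons => //; exact: is_word0. Qed.

Hypothesis S_inv : forall s, S s -> (s * s = 1)%g.
Hypothesis S_gen : forall w, exists k, is_word S k w.

Lemma S_invE s : S s -> (s^-1 = s)%g.
Proof. by move=> /S_inv ss; apply/esym/(mulIg s); rewrite mulVg. Qed.

Lemma is_wordV k w : is_word S k w -> is_word S k (w^-1)%g.
Proof.
elim: k w => [|k IH] w; first by move=> /is_word_nil ->; rewrite invg1; exact: is_word0.
move=> /is_word_uncons[s [u [Ss Wu ->]]]; rewrite invgM -addn1.
by apply: is_word_cat; [exact: IH | rewrite S_invE //; exact: is_word1].
Qed.

Lemma clength_spec w :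
  is_word S (clength S w) w /\ forall j, is_word S j w -> (clength S w <= j)%N.
Proof.
rewrite /clength; case: xgetP => [k _ [] //|h].
have ex : exists k, `[< is_word S k w >].
  by have [k kw] := S_gen w; exists k; exact: asboolT.
case: (ex_minnP ex) => m /asboolP mw mmin; case: (h m); split=> // j jw.
by apply: mmin; exact: asboolT.
Qed.

Lemma clength_word w : is_word S (clength S w) w.
Proof. by have [] := clength_spec w. Qed.

Lemma clength_le j w : is_word S j w -> (clength S w <= j)%N.
Proof. by have [_] := clength_spec w; apply. Qed.

Lemma clength_eq0 w : clength S w = 0%N -> w = 1%g.
Proof. by move=> e; have := clength_word w; rewrite e => /is_word_nil. Qed.

Lemma clength1 : clength S 1%g = 0%N.
Proof. by apply/eqP; rewrite -leqn0; exact: clength_le is_word0. Qed.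

Lemma clengthV w : clength S (w^-1)%g = clength S w.
Proof.
have h u : (clength S (u^-1)%g <= clength S u)%N.
  by apply: clength_le; apply: is_wordV; exact: clength_word.
by apply/eqP; rewrite eqn_leq h -{1}[w]invgK h.
Qed.

Lemma clength_cons s w : S s -> (clength S (s * w)%g <= (clength S w).+1)%N.
Proof. by move=> Ss; apply: clength_le; apply: is_word_cons => //; exact: clength_word. Qed.

Lemma clength_first w k : clength S w = k.+1 ->
  exists s u, [/\ S s, clength S u = k & w = (s * u)%g].
Proof.
move=> wk; have := clength_word w; rewrite wk => /is_word_uncons[s [u [Ss Wu wE]]].
exists s, u; split => //; apply/eqP; rewrite eqn_leq clength_le //.
by rewrite -ltnS -wk wE clength_cons.
Qed.

Lemma bruhat_trans x y w : bruhat_le S x y -> bruhat_le S y w -> bruhat_le S x w.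
Proof.
move=> xy; elim=> {w} [//|w t _ IH rt lt]; exact: bruhat_step IH rt lt.
Qed.

Lemma bruhat_length x y : bruhat_le S x y ->
  x = y \/ (clength S x < clength S y)%N.
Proof.
elim=> {y} [|y t _ IH _ lt]; first by left.
by right; case: IH => [-> //|/ltn_trans]; apply.
Qed.

End Words.

Section Coxeter.
Variables (R : realType) (n : nat) (rs : root_system R n) (l : nat).
Hypothesis l_gt0 : (0 < l)%N.
Local Notation V := 'rV[R]_n.
Local Notation dot := (dot rs).
Local Notation affW := (affW rs l).
Local Notation lvl m := ((m : int)%:~R * l%:R : R).
Local Notation kf := (kf rs l).
Local Notation regular := (regular rs l).
Local Notation bpt := (bpt rs l).
Local Notation arefl := (arefl rs l).
Local Notation S := (affS rs l).
Local Notation finW := (finW rs l).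
Local Notation len := (clength (affS rs l)).
Local Notation wallp := (wallp rs).
Local Notation spec := (spec rs l).
Implicit Types (y z a b p f : V) (x w g u s t : affW) (m q : int).

Let Ab : fund_alcove rs l bpt. Proof. exact: bpt_fund. Qed.
Let rb : regular bpt. Proof. exact: bpt_regular. Qed.

Lemma wall_affS a m : wallp a m -> S (arefl a m).
Proof. by move=> wam; apply/affS_wallp => //; exists a, m. Qed.

Lemma affS_inv s : S s -> (s * s = 1)%g.
Proof.
by move=> /(affS_wallp l_gt0)[a [m [/wallp_root ra ->]]]; exact: arefl2.
Qed.

(** Simple reflections generate the reflections in all roots: a positive root
    that is not simple is made lower by some simple reflection. *)
Lemma arefl0_word a : is_root rs a -> exists k, is_word S k (arefl a 0).
Proof.
have [x xE] := simple_dual rs (fun=> 1 : R).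
have Cx : chamber rs x by move=> i; rewrite xE.
suff main N b : pos_root rs b -> dot x b <= N%:R -> exists k, is_word S k (arefl b 0).
  move=> ra; have bd b : exists N, dot x b <= N%:R.
    by exists (Num.truncn (dot x b)).+1; apply: ltW; exact: truncnS_gt.
  have [pa|pa] := root_pos_neg ra.
    by have [N /(main _ _ pa)] := bd a.
  rewrite -(areflN l 0 ra) oppr0; by have [N /(main _ _ pa)] := bd (- a).
elim: N b => [|N IH] b pb.
  by rewrite leNgt dot_pos_gt0.
move=> hb; have rbb := pos_rootW pb.
have [[i ->]|nb] := pselect (exists i, b = simple rs i).
  by exists 1%N; apply: is_word1; apply: wall_affS; left; exists i.
have [i bi] : exists i, 0 < dot b (simple rs i).
  apply: contrapT => no; have := root_gt0 rbb; rewrite ltNge => /negP; apply.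
  have [_ [c {2}->]] := pb; rewrite dot_ncomb sumr_le0 // => i _.
  by rewrite mulrn_wle0 // leNgt; apply/negP => h; apply: no; exists i.
have si := simple_root rs i.
have bni : b != simple rs i by apply/eqP => e; apply: nb; exists i.
have pb' := refl_simple_pos pb bni.
have [m mE] := root_pairing si rbb.
have m1 : 1 <= (m%:~R : R).
  have : 0 < (m%:~R : R) by rewrite -mE divr_gt0 ?mulr_gt0 ?root_gt0.
  by rewrite ltr0z -[1]/(1%:~R) ler_int; lia.
have [|k kw] := IH _ pb'.
  rewrite /refl dotBr dotZr xE mulr1 mE.
  move: hb; rewrite -natr1; lra.
have Ss : S (arefl (simple rs i) 0) by apply: wall_affS; left; exists i.
set s := arefl (simple rs i) 0 in Ss.
have adE : adj s b = refl rs (simple rs i) b by rewrite adj_arefl.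
have s0 : s 0 = 0 by rewrite areflE // mul0r aff_refl0 /refl dot0l mulr0 mul0r scale0r subr0.
have E y : dot (s y) b = dot y (adj s b) + lvl 0.
  by rewrite dot_adj s0 dot0l mul0r.
have := arefl_conj 0 rbb E; rewrite subr0 adE => conj.
exists (1 + k + 1)%N.
have -> : arefl b 0 = (s * arefl (refl rs (simple rs i) b) 0 * s)%g.
  by rewrite -conj -mulgA affS_inv // mulg1.
by apply: is_word_cat; [apply: is_word_cat => //|]; exact: is_word1.
Qed.

Lemma affS_gen w : exists k, is_word S k w.
Proof.
suff main (h : V -> V) : aff_weyl rs l h ->
    exists (k : nat) (u : affW), is_word S k u /\ affW_val u = h.
  have [k [u [Wu uw]]] := main _ (affWP w); exists k.
  by rewrite (_ : w = u) //; apply: val_inj; rewrite /= uw.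
elim=> {h} [|h h' hgen _ [k [u [Wu <-]]]].
  by exists 0%N, 1%g; split=> //; exact: is_word0.
have [m [g [Wg <-]]] : exists (m : nat) (g : affW), is_word S m g /\ affW_val g = h.
  case: hgen => [[a ra ->]|->].
    have [m Wm] := arefl0_word ra; exists m, (arefl a 0); split => //.
    by apply: funext => y; rewrite areflE // mul0r.
  have rt := theta_root rs.
  exists 1%N, (arefl (theta rs) 1); split; last first.
    by apply: funext => y; rewrite areflE // mul1r.
  apply: is_word1; rewrite -(areflN l 1 rt); apply: wall_affS; by right.
by exists (m + k)%N, (g * u)%g; split=> //; exact: is_word_cat.
Qed.

Local Notation len_word := (clength_word affS_gen).
Local Notation len_le := (clength_le affS_gen).

(** By wall_cross the reflection in a wall changes no other floor, and it changes the
    floor of its own root by 1. *)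
Lemma cross_wall a m b q : wallp b q -> is_root rs a ->
  lvl m < dot bpt a -> dot (arefl b q bpt) a < lvl m -> a = b /\ m = q.
Proof.
move=> wbq ra h1 h2; have rbb := wallp_root wbq.
have [aNb|aNb] := eqVneq a (- b).
  have h3 := wallp_gt Ab wbq; move: h1 h2; rewrite aNb !dotNr dot_arefl_self // => h1 h2.
  by exfalso; clear aNb; lra.
have [ab|ab] := eqVneq a b; last first.
  have := wall_cross l_gt0 wbq Ab ra ab aNb; move: h1 h2.
  by rewrite -kf_lt // => /ltW; rewrite -kf_ge //; lia.
split=> //; have kb := wall_kf l_gt0 wbq Ab.
have h3 : m <= q by rewrite -kb kf_ge // -ab ltW.
have h4 : dot bpt b < lvl (q + 1) by rewrite -kf_lt // kb; lia.
have : lvl (q - 1) < lvl m.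
  apply: le_lt_trans h2; rewrite ab dot_arefl_self //; move: h4.
  by rewrite rmorphD rmorphB mulrDl mulrBl; lra.
rewrite lvl_lt //; lia.
Qed.

Lemma affW_regular w : regular (w bpt).
Proof. exact: regular_aff. Qed.

Lemma dot_lt_or w a m : is_root rs a ->
  lvl m < dot (w bpt) a \/ dot (w bpt) a < lvl m.
Proof.
move=> ra; have := affW_regular w m ra; rewrite neq_lt => /orP[h|h].
  by right.
by left.
Qed.

(** Strong exchange.  The word describes a gallery from the base alcove; where it crosses
    the hyperplane it is folded back, which deletes one letter. *)
Lemma strong_exchange k w a m : is_word S k w -> is_root rs a ->
    lvl m < dot bpt a -> dot (w bpt) a < lvl m ->
  exists2 k', k = k'.+1 & is_word S k' (arefl a m * w)%g.
Proof.
elim: k w a m => [|k IH] w a m.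
  by move=> /is_word_nil -> ra h1; rewrite affW1_val => h2; lra.
move=> /is_word_uncons[s [u [Ss Wu wE]]] ra h1 h2; exists k => //.
have [b [q [wbq sE]]] := (affS_wallp l_gt0 s).1 Ss.
have [h3|h3] := dot_lt_or s m ra; last first.
  rewrite sE in h3; have [ab mq] := cross_wall wbq ra h1 h3.
  by rewrite wE ab mq -sE mulgA affS_inv // mul1g.
have [p pE] := dot_affW s ra; have ra' := adj_root s ra.
have [] := IH u (adj s a) (m - p) Wu ra'.
- by rewrite rmorphB mulrBl ltrBlDr -pE.
- by rewrite rmorphB mulrBl ltrBrDr -pE -affWM_val -wE.
move=> k' -> Wk'; rewrite wE mulgA (arefl_conj m ra pE) -mulgA.
exact: is_word_cons.
Qed.

Lemma len_refl_lt w a m : is_root rs a -> lvl m < dot bpt a ->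
  dot (w bpt) a < lvl m -> (len (arefl a m * w)%g < len w)%N.
Proof.
move=> ra h1 h2; have [k' e Wk'] := strong_exchange (len_word w) ra h1 h2.
by rewrite e ltnS; exact: len_le.
Qed.

Lemma len_refl_gt w a m : is_root rs a -> lvl m < dot bpt a ->
  lvl m < dot (w bpt) a -> (len w < len (arefl a m * w)%g)%N.
Proof.
move=> ra h1 h2; rewrite -{1}[w]mul1g -(arefl2 l m ra) -mulgA.
by apply: len_refl_lt => //; rewrite affWM_val dot_arefl_self //; lra.
Qed.

Lemma len_wall_up w b q : wallp b q -> lvl q < dot (w bpt) b ->
  len (arefl b q * w)%g = (len w).+1.
Proof.
move=> wbq h; apply/eqP; rewrite eqn_leq (clength_cons affS_gen w (wall_affS wbq)).
exact: len_refl_gt (wallp_root wbq) (wallp_gt Ab wbq) h.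
Qed.

Lemma len_wall_down w b q : wallp b q -> dot (w bpt) b < lvl q ->
  len w = (len (arefl b q * w)%g).+1.
Proof.
move=> wbq h; have rbb := wallp_root wbq.
rewrite -[LHS](_ : len (arefl b q * (arefl b q * w))%g = _); last first.
  by rewrite mulgA arefl2 // mul1g.
by apply: len_wall_up => //; rewrite affWM_val dot_arefl_self //; lra.
Qed.

Lemma len_S_cases s w : S s ->
  len (s * w)%g = (len w).+1 \/ len w = (len (s * w)%g).+1.
Proof.
move=> /(affS_wallp l_gt0)[b [q [wbq ->]]].
have [h|h] := dot_lt_or w q (wallp_root wbq); first by left; exact: len_wall_up.
by right; exact: len_wall_down.
Qed.

Lemma len_V w : len (w^-1)%g = len w.
Proof. exact: (clengthV affS_inv affS_gen). Qed.

Lemma len_Sr_cases s w : S s ->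
  len (w * s)%g = (len w).+1 \/ len w = (len (w * s)%g).+1.
Proof.
move=> Ss; rewrite -[len (w * s)%g]len_V -[len w]len_V invgM (S_invE affS_inv Ss).
exact: len_S_cases.
Qed.

Lemma len_S s : S s -> len s = 1%N.
Proof.
move=> Ss; have := len_S_cases 1%g Ss; rewrite mulg1 clength1 ?affS_gen //.
  by case=> // /eqP.
exact: affS_gen.
Qed.

(** ** Length counts separating hyperplanes *)

Local Notation dist := (adist rs l).

(** Only b and - b contribute to the change of distance. *)
Lemma dist_wall b q y : wallp b q -> regular y -> lvl q < dot y b ->
  dist (arefl b q bpt) y = (dist bpt y + 2)%N.
Proof.
move=> wbq ry hy; have rbb := wallp_root wbq.
have rsb := affW_regular (arefl b q).
have bN : - b != b.
  apply/eqP => e; have := root_gt0 rbb; rewrite -{1}e dotNl; have := root_gt0 rbb; lra.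
have brs : b \in root_seq rs by apply/mem_root_seq.
have bNrs : - b \in root_seq rs by apply/mem_root_seq; exact: is_rootN.
have kb : kf b bpt = q by exact: wall_kf.
have ksb : kf b (arefl b q bpt) = q - 1.
  have h : lvl q < dot bpt b by exact: wallp_gt.
  have h' : dot bpt b < lvl (q + 1) by rewrite -kf_lt // kb; lia.
  rewrite rmorphD mulrDl in h'.
  apply: kfP => //; rewrite dot_arefl_self // ?subrK ?rmorphB ?mulrBl; lra.
have ky : q <= kf b y by rewrite kf_ge // ltW.
rewrite /adist !(bigD1_seq b brs (root_seq_uniq rs)) /=.
rewrite !(big_rem _ bNrs) /= bN.
have E : (\sum_(a <- rem (- b) (root_seq rs) | a != b) `|kf a (arefl b q bpt) - kf a y| =
    \sum_(a <- rem (- b) (root_seq rs) | a != b) `|kf a bpt - kf a y|)%N.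
  rewrite big_seq_cond [RHS]big_seq_cond; apply: eq_bigr => a /andP[].
  rewrite mem_rem_uniq ?root_seq_uniq // inE => /andP[aN /mem_root_seq ra] ab.
  by rewrite (wall_cross l_gt0 wbq).
rewrite E !kfN // kb ksb; move: (\sum_(_ <- _ | _) _)%N ky; move: (kf b y). lia.
Qed.

(** The length is the number of hyperplanes separating the two alcoves: the first letter of
    a reduced word crosses exactly one of them. *)
Lemma dist_len w : dist bpt (w bpt) = (2 * len w)%N.
Proof.
have [k ek] : exists k, len w = k by exists (len w).
elim: k w ek => [|k IH] w ek.
  have -> : w = 1%g by apply: clength_eq0 ek; exact: affS_gen.
  by rewrite (clength1 affS_gen); apply/(adist_eq0 rs l_gt0).
have [s [u [Ss eu wE]]] := clength_first affS_gen ek.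
have [b [q [wbq sE]]] := (affS_wallp l_gt0 s).1 Ss.
have h : lvl q < dot (u bpt) b.
  have [//|h] := dot_lt_or u q (wallp_root wbq).
  by have := len_wall_down wbq h; rewrite -sE -wE ek eu; lia.
rewrite ek wE affWM_val -(adist_aff l_gt0 s) -[s (s _)]affWM_val affS_inv // affW1_val.
rewrite sE dist_wall //; last exact: affW_regular.
rewrite IH // eu; lia.
Qed.

Lemma same_cell_inj w u : same_cell rs l (w bpt) (u bpt) -> w = u.
Proof.
move=> sc; have := (adist_eq0 rs l_gt0 (w bpt) (u bpt)).2 sc; rewrite -(adist_aff l_gt0 (w^-1)%g) affWVK -affWM_val dist_len.
move/eqP; rewrite muln_eq0 /= => /eqP/(clength_eq0 affS_gen).
by move=> e; rewrite -[u]mul1g -(mulgV w) -mulgA e mulg1.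
Qed.

Lemma pos_cell_inj w u :
  (forall a, pos_root rs a -> kf a (w bpt) = kf a (u bpt)) -> w = u.
Proof.
by move=> h; apply: same_cell_inj; apply: same_cell_pos => //; exact: affW_regular.
Qed.

(** Every summand splits, since the floors are monotone along x, y, z for a positive root
    and antitone for a negative one. *)
Lemma dist_add (x y z : V) : regular x -> regular y -> regular z ->
  (forall a, pos_root rs a -> kf a x <= kf a y <= kf a z) ->
  dist x z = (dist x y + dist y z)%N.
Proof.
move=> rx ry rz h; rewrite /adist -big_split /= big_seq [RHS]big_seq.
apply: eq_bigr => a /mem_root_seq ra; have [pa|pa] := root_pos_neg ra.
  have := h a pa; lia.
have := h _ pa; rewrite !kfN //; lia.
Qed.

Lemma len_add w u g : (forall a, pos_root rs a ->
    kf a (w bpt) <= kf a (u bpt) <= kf a (g bpt)) ->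
  len (w^-1 * g)%g = (len (w^-1 * u)%g + len (u^-1 * g)%g)%N.
Proof.
move=> h; have D (x y : affW) : dist (x bpt) (y bpt) = (2 * len (x^-1 * y)%g)%N.
  by rewrite -(adist_aff l_gt0 (x^-1)%g) affWVK -affWM_val dist_len.
have := dist_add (affW_regular w) (affW_regular u) (affW_regular g) h.
rewrite !D; lia.
Qed.

(** ** Minimal coset representatives *)

Lemma finW_0 w : finW w -> w 0 = 0. Proof. exact: weyl_0. Qed.

Lemma arefl_finW a : is_root rs a -> finW (arefl a 0).
Proof.
move=> ra; have -> : finW (arefl a 0) = weyl rs (aff_refl rs a 0).
  by rewrite /finW /=; congr weyl; apply: funext => x; rewrite areflE // mul0r.
rewrite -[aff_refl _ _ _]/(aff_refl rs a 0 \o id).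
by apply: generated_comp (generated_id _); exists a.
Qed.

Lemma finWV w : finW w -> finW (w^-1)%g.
Proof.
rewrite /Defs.finW /=; have inv (h : V -> V) : weyl_refls rs h -> h \o h = id.
  by case=> a ra ->; exact: aff_reflK.
move=> /(@generatedV _ (weyl_refls rs) inv)[w' [Gw' w'w ww']]; have E : affW_val (w^-1)%g = w'.
  apply: funext => x; have := congr1 (fun h => h x) ww' => /= e.
  by rewrite -{1}e; exact: affWVK.
by rewrite -E in Gw'.
Qed.

Lemma finW_kf w a : finW w -> pos_root rs a -> kf a (w bpt) <= 0.
Proof.
move=> Ww pa; rewrite -ltzD1 add0r kf_lt // mul1r dot_adj finW_0 // dot0l addr0.
have ra' := adj_root w (pos_rootW pa); have [pa'|pa'] := root_pos_neg ra'.
  by have /andP[] := (fund_alcoveP rs l bpt).1 Ab _ pa'.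
have /andP[] := (fund_alcoveP rs l bpt).1 Ab _ pa'; rewrite dotNr.
by have l0 : 0 < l%:R :> R; [rewrite ltr0n | move=> h1 h2; lra].
Qed.

Lemma chamber_kf y : chamber rs y -> forall a, pos_root rs a -> 0 <= kf a y.
Proof. by move=> Cx a pa; rewrite kf_ge // mul0r ltW // dot_pos_gt0. Qed.

Lemma kf_chamber y : regular y ->
  (forall i, 0 <= kf (simple rs i) y) -> chamber rs y.
Proof.
move=> rx h i; have := h i; rewrite kf_ge // mul0r => h'.
by rewrite lt_def h' andbT; have := rx _ 0 (simple_root rs i); rewrite mul0r.
Qed.

(** The fundamental alcove lies between w^-1 A_+ and x A_+. *)
Lemma len_finW_min w x : finW w -> chamber rs (x bpt) ->
  len (w * x)%g = (len w + len x)%N.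
Proof.
move=> Ww Cx; have := @len_add (w^-1)%g 1%g x.
rewrite invgK mulg1 invg1 mul1g; apply=> a pa; rewrite affW1_val.
by rewrite (fund_kf l_gt0 Ab pa) finW_kf ?chamber_kf //; exact: finWV.
Qed.

Lemma min_repP x : min_rep S finW x <-> chamber rs (x bpt).
Proof.
split=> [h i|Cx w Ww]; last by rewrite len_finW_min // leq_addl.
have si := simple_root rs i.
have [|hi] := dot_lt_or x 0 si; first by rewrite mul0r.
have wi : wallp (simple rs i) 0 by left; exists i.
have := h _ (arefl_finW si); by rewrite (len_wall_down wi hi) ltnn.
Qed.

Lemma min_rep_unique w x : finW w -> min_rep S finW x ->
  min_rep S finW (w * x)%g -> w = 1%g.
Proof.
move=> Ww /min_repP Cx /min_repP Cwx; apply: (clength_eq0 affS_gen).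
have := len_finW_min (finWV Ww) Cwx; rewrite mulgA mulVg mul1g len_finW_min //.
lia.
Qed.

(** Minimal representatives are the alcoves in the chamber, so the wall between the alcoves
    of x and x s is a wall of the chamber. *)
Lemma min_rep_leave x s : S s -> min_rep S finW x -> ~ min_rep S finW (x * s)%g ->
  exists s', [/\ S s', finW s' & (x * s = s' * x)%g].
Proof.
move=> Ss /min_repP Cx nCxs; have [b [q [wbq sE]]] := (affS_wallp l_gt0 s).1 Ss.
have [i hi] : exists i, dot ((x * s)%g bpt) (simple rs i) < lvl 0.
  apply: contrapT => no; apply: nCxs; apply/min_repP => i.
  have [|h] := dot_lt_or (x * s)%g 0 (simple_root rs i); first by rewrite mul0r.
  by case: no; exists i.
have si := simple_root rs i; have [p pE] := dot_affW x si.
exists (arefl (simple rs i) 0); split; last 1 first.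
- have := Cx i; have := arefl_conj 0 si pE; rewrite pE sub0r => -> hx.
  rewrite affWM_val pE in hi.
  have [] := @cross_wall (adj x (simple rs i)) (- p) b q wbq (adj_root x si).
  + by rewrite rmorphN mulNr; lra.
  + by rewrite -sE rmorphN mulNr; rewrite mul0r in hi; lra.
  by move=> -> ->; rewrite sE.
- by apply: wall_affS; left; exists i.
- exact: arefl_finW.
Qed.

(** ** The alcove above a point *)

(** Reflecting a point outside the fundamental alcove in a wall that separates it brings it
    closer. *)
Lemma cell_trans z : regular z -> exists w, same_cell rs l (w bpt) z.
Proof.
have [k ek] : exists k, (dist bpt z <= k)%N by exists (dist bpt z).
elim: k z ek => [|k IH] z ek rz.
  by exists 1%g; rewrite affW1_val; apply/(adist_eq0 rs l_gt0)/eqP; rewrite -leqn0.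
have [Az|nAz] := pselect (fund_alcove rs l z).
  exists 1%g; rewrite affW1_val; apply: same_cell_pos => // a pa.
  by rewrite !fund_kf.
have [b [q [wbq hb]]] : exists b q, wallp b q /\ dot z b < lvl q.
  apply: contrapT => no; apply: nAz; apply: wallpP => // b q wbq.
  have := rz b q (wallp_root wbq); rewrite neq_lt => /orP[h|//].
  by case: no; exists b, q.
have rbb := wallp_root wbq.
have rsz : regular (arefl b q z) by exact: regular_aff.
have [|w hw] := IH (arefl b q z) _ rsz.
  have := dist_wall wbq rsz; rewrite (adist_aff l_gt0) dot_arefl_self // => h.
  have : lvl q < lvl q + lvl q - dot z b by lra.
  move=> /h; lia.
exists (arefl b q * w)%g; rewrite affWM_val -[z](areflK l q z rbb).
exact: (same_cell_aff l_gt0).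
Qed.

(** The element carrying the fundamental alcove to the alcove above y. *)
Definition ue y : affW :=
  xget 1%g [set w : affW | forall a, pos_root rs a -> kf a (w bpt) = kf a y].

Lemma ue_kf y a : pos_root rs a -> kf a (ue y bpt) = kf a y.
Proof.
rewrite /ue; case: xgetP => [w _|h]; first exact.
have [z [rz zy]] := upper_cell_nonempty rs l_gt0 y.
have [w wz] := cell_trans rz; case: (h w) => b pb /=.
by rewrite wz ?zy //; exact: pos_rootW.
Qed.

Lemma ue_unique y w : (forall a, pos_root rs a -> kf a (w bpt) = kf a y) -> w = ue y.
Proof. by move=> h; apply: pos_cell_inj => a pa; rewrite h // ue_kf. Qed.

Lemma ue_min y : chamber rs y -> min_rep S finW (ue y).
Proof.
move=> Cy; apply/min_repP/kf_chamber; first exact: affW_regular.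
by move=> i; rewrite ue_kf ?chamber_kf //; exact: simple_pos.
Qed.

Lemma image_fund w : w @` fund_alcove rs l = upper_cell rs l (w bpt).
Proof.
apply/seteqP; split=> [_ [z Az <-]|z [rz zw]].
  have rzz := fund_regular l_gt0 Az.
  have sc : same_cell rs l z bpt.
    by apply: same_cell_pos => // a pa; rewrite !fund_kf.
  split; first exact: regular_aff.
  by move=> a pa; apply: (same_cell_aff l_gt0) => //; exact: pos_rootW.
exists ((w^-1)%g z); last by rewrite affWKV.
have sc : same_cell rs l z (w bpt) by apply: same_cell_pos => //; exact: affW_regular.
apply: kf_fund => //; first exact: regular_aff.
move=> a pa; have := same_cell_aff l_gt0 (w^-1)%g sc (pos_rootW pa).
by rewrite affWVK => ->; exact: fund_kf.
Qed.

Lemma alcove_elt_point mu : dominant rs mu ->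
  alcove_elt rs l (point_alcove rs l mu) = ue (mu + rho rs).
Proof.
move=> dmu; rewrite /point_alcove upper_alcove_facet // /alcove_elt.
have h x : x @` fund_alcove rs l = upper_cell rs l (mu + rho rs) -> x = ue (mu + rho rs).
  rewrite image_fund => e; apply: ue_unique => a pa.
  have : upper_cell rs l (x bpt) (x bpt) by split => //; exact: affW_regular.
  by rewrite e => -[_]; apply.
case: xgetP => [x _ [_ /h //]|no].
case: (no (ue (mu + rho rs))); split; first exact: ue_min.
rewrite image_fund; apply: upper_cell_eq; split; first exact: affW_regular.
by move=> a pa; rewrite ue_kf.
Qed.

Lemma spec_ue y : spec y (ue y bpt).
Proof.
move=> a m ra; have [pa|pa] := root_pos_neg ra.
  by rewrite -!kf_ge // ue_kf.
have ruy := affW_regular (ue y).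
have E (u : V) : (lvl m <= dot u a) = (dot u (- a) <= lvl (- m)).
  by rewrite dotNr rmorphN mulNr lerN2.
rewrite !E => h; have h' : kf (- a) (ue y bpt) < - m.
  by rewrite kf_lt // lt_neqAle h andbT; apply: ruy; exact: pos_rootW.
by rewrite ltW // -kf_lt // -ue_kf.
Qed.

(** ** Stabilisers of points *)

(** The first letter of a reduced word of w separates the alcove of w from the fundamental
    alcove, so w f, which lies in the closures of both, lies on its wall and is fixed by it; induct. *)
Lemma fund_domain f f' w : spec f bpt -> spec f' bpt -> w f = f' -> f = f'.
Proof.
have [k ek] : exists k, len w = k by exists (len w).
elim: k w ek => [|k IH] w ek sf sf' wf.
  by move: wf; rewrite (clength_eq0 affS_gen ek) affW1_val.
have [s [u [Ss eu wE]]] := clength_first affS_gen ek.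
have [b [q [wbq sE]]] := (affS_wallp l_gt0 s).1 Ss; have rbb := wallp_root wbq.
have h : dot (w bpt) b < lvl q.
  have [h|//] := dot_lt_or w q rbb.
  have := len_wall_up wbq h; rewrite -sE wE mulgA affS_inv // mul1g -wE ek eu; lia.
have f'b : dot f' b = lvl q.
  apply/eqP; rewrite eq_le; apply/andP; split.
    by apply: (spec_le rbb) (ltW h); rewrite -wf; exact: spec_aff.
  by apply: sf' => //; apply: ltW; exact: wallp_gt.
apply: (IH u) => //; have := arefl_fix rbb f'b; rewrite -sE -{1}wf wE affWM_val.
by rewrite -affWM_val affS_inv.
Qed.

(** As for fund_domain: each letter of a reduced word of a stabilising element fixes f. *)
Lemma stab_ind f (K : affW -> Prop) : spec f bpt -> K 1%g ->
    (forall s u, S s -> s f = f -> u f = f -> len (s * u)%g = (len u).+1 ->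
       K u -> K (s * u)%g) ->
  forall u, u f = f -> K u.
Proof.
move=> sf K1 KS w; have [k ek] : exists k, len w = k by exists (len w).
elim: k w ek => [|k IH] w ek wf; first by rewrite (clength_eq0 affS_gen ek).
have [s [u [Ss eu wE]]] := clength_first affS_gen ek.
have [b [q [wbq sE]]] := (affS_wallp l_gt0 s).1 Ss; have rbb := wallp_root wbq.
have h : dot (w bpt) b < lvl q.
  have [h|//] := dot_lt_or w q rbb.
  have := len_wall_up wbq h; rewrite -sE wE mulgA affS_inv // mul1g -wE ek eu; lia.
have fb : dot f b = lvl q.
  apply/eqP; rewrite eq_le; apply/andP; split.
    by apply: (spec_le rbb) (ltW h); rewrite -{1}wf; exact: spec_aff.
  by apply: sf => //; apply: ltW; exact: wallp_gt.
have sff : s f = f by rewrite sE; exact: arefl_fix.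
have uE : u = (s * w)%g by rewrite wE mulgA affS_inv // mul1g.
have uf : u f = f by rewrite uE affWM_val wf.
rewrite wE; apply: KS => //; first by rewrite -wE ek eu.
exact: IH.
Qed.

Lemma spec_kf p y a : is_root rs a -> spec p y -> kf a y <= kf a p <= kf a y + 1.
Proof.
move=> ra py; apply/andP; split; first by rewrite kf_ge // py // -kf_ge.
have : dot y a <= lvl (kf a y + 1) by rewrite ltW // -kf_lt //; lia.
move=> /(spec_le ra py) h; rewrite -ltzD1 kf_lt // (le_lt_trans h) //.
by rewrite lvl_lt //; lia.
Qed.

(** A stabilising element is determined by the sides of the hyperplanes through f on which
    its alcove lies. *)
Lemma stab_finite f : spec f bpt -> finite_set [set u : affW | u f = f].
Proof.
move=> sf; pose pat (u : affW) : (size (root_seq rs)).-tuple bool :=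
  map_tuple (fun a => kf a (u bpt) == kf a f) (in_tuple (root_seq rs)).
pose g (t : _.-tuple bool) := xget (1%g : affW) [set u : affW | u f = f /\ pat u = t].
apply: (@sub_finite_set _ _ (g @` [set: (size (root_seq rs)).-tuple bool])).
  move=> u uf; exists (pat u) => //; rewrite /g; case: xgetP => [w _ [wf e]|/(_ u)]; last by case.
  apply: same_cell_inj => a ra; have ars := (mem_root_seq _ _).2 ra.
  have /eq_in_map/(_ a ars) : [seq kf a (w bpt) == kf a f | a <- root_seq rs] =
     [seq kf a (u bpt) == kf a f | a <- root_seq rs] by exact: (congr1 val e).
  have sw : spec f (w bpt) by rewrite -wf; exact: spec_aff.
  have su : spec f (u bpt) by rewrite -{1}uf; exact: spec_aff.
  have := spec_kf ra sw; have := spec_kf ra su.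
  by case: eqP => h1; case: eqP => h2 // ; lia.
by apply: finite_image; exact: finite_finset.
Qed.

Lemma ue_stab y f w : spec f bpt -> w f = y -> ue y f = y.
Proof.
move=> sf wf; have s' : spec ((ue y)^-1%g y) bpt.
  by rewrite -[X in spec _ X](affWVK (ue y)); apply: spec_aff; exact: spec_ue.
have e : ((ue y)^-1 * w)%g f = (ue y)^-1%g y by rewrite affWM_val wf.
by rewrite {1}(fund_domain sf s' e) affWKV.
Qed.

(** The alcove above y lies on the positive side of all hyperplanes through y, so an alcove
    w A_+ with y in its closure lies between the fundamental alcove and the alcove above y. *)
Lemma len_ue y f w : chamber rs y -> spec f bpt -> w f = y ->
  chamber rs (w bpt) /\ len (ue y) = (len w + len (w^-1 * ue y)%g)%N.
Proof.
move=> Cy sf wf; have yw : spec y (w bpt) by rewrite -wf; exact: spec_aff.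
have Cw : chamber rs (w bpt).
  move=> i; have si := simple_root rs i.
  have [|h] := dot_lt_or w 0 si; first by rewrite mul0r.
  by have := spec_le si yw (ltW h); have := Cy i; rewrite mul0r; lra.
split=> //; have := @len_add 1%g w (ue y); rewrite invg1 !mul1g; apply=> a pa.
rewrite affW1_val (fund_kf l_gt0 Ab pa) ue_kf // chamber_kf //=.
by have /andP[] := spec_kf (pos_rootW pa) yw.
Qed.

(** ** Lifting *)

Local Notation ble := (bruhat_le (affS rs l)).

Lemma creflection_arefl t : creflection S t ->
  exists a m, is_root rs a /\ t = arefl a m.
Proof.
move=> [g [s [Ss ->]]]; have [b [q [wbq ->]]] := (affS_wallp l_gt0 s).1 Ss.
have rbb := wallp_root wbq.
pose a := adj (g^-1)%g b; have ra : is_root rs a by exact: adj_root.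
have aE : adj g a = b by rewrite /a /adj invgK linpKV.
have [p pE] := dot_affW g ra; exists a, (q + p); split=> //.
by have := arefl_conj (q + p) ra pE; rewrite aE addrK => <-; rewrite mulgK.
Qed.

(** Right multiplication by a simple reflection s preserves a step y < y t of the
    Bruhat order unless t = s: the hyperplane of the step does not separate y A
    from its neighbour y s A. *)
Lemma bruhat_step_S (y : affW) t s : S s -> creflection S t -> t <> s ->
  (len y < len (y * t)%g)%N -> (len (y * s)%g < len (y * t * s)%g)%N.
Proof.
move=> Ss ct ts lt; have [a0 [m0 [ra0 tE]]] := creflection_arefl ct.
have [b [q [wbq sE]]] := (affS_wallp l_gt0 s).1 Ss.
(* the hyperplane of y t y^-1, with the base point on its positive side *)
have [a [m [ra rE ha]]] : exists a m, [/\ is_root rs a, (y * t = arefl a m * y)%g &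
    lvl m < dot bpt a].
  pose a := adj (y^-1)%g a0; have ra : is_root rs a by exact: adj_root.
  have aE : adj y a = a0 by rewrite /a /adj invgK linpKV.
  have [p pE] := dot_affW y ra.
  have e : (y * t = arefl a (m0 + p) * y)%g.
    by rewrite (arefl_conj (m0 + p) ra pE) aE addrK tE.
  have [h|h] := dot_lt_or 1%g (m0 + p) ra; first by exists a, (m0 + p).
  exists (- a), (- (m0 + p)); split; first exact: is_rootN.
    by rewrite areflN.
  by rewrite dotNr rmorphN mulNr ltrN2.
have hy : lvl m < dot (y bpt) a.
  have [//|h] := dot_lt_or y m ra; have := len_refl_lt ra ha h.
  by rewrite -rE ltnNge ltnW.
rewrite rE -mulgA; apply: len_refl_gt => //.
have [//|h] := dot_lt_or (y * s)%g m ra; case: ts.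
have [p pE] := dot_affW y ra; rewrite affWM_val pE in h; rewrite pE in hy.
have [] := @cross_wall (adj y a) (m - p) b q wbq (adj_root y ra).
- by rewrite rmorphB mulrBl ltrBlDr.
- by rewrite -sE rmorphB mulrBl ltrBrDr.
move=> e1 e2; apply: (mulgI y); rewrite rE (arefl_conj m ra pE) e1 e2.
by rewrite sE.
Qed.

Lemma bruhat_S_up (y : affW) s : S s -> len (y * s)%g = (len y).+1 -> ble y (y * s)%g.
Proof.
move=> Ss e; apply: bruhat_step (bruhat_refl _ _) _ _; last by rewrite e.
by exists 1%g, s; split => //; rewrite invg1 mulg1 mul1g.
Qed.

(** The lifting property, by induction along the chain of reflections from x to y. *)
Lemma bruhat_lifting x (y : affW) s : S s -> ble x y -> ble (x * s)%g y \/ ble (x * s)%g (y * s)%g.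
Proof.
move=> Ss; elim=> {y} [|y t xy IH ct lt]; first by right; exact: bruhat_refl.
have [ts|ts] := pselect (t = s).
  case: IH => [h|h]; left; last by rewrite ts.
  exact: bruhat_step h ct lt.
case: IH => [h|h]; first by left; exact: bruhat_step h ct lt.
right; apply: bruhat_trans h _.
have -> : (y * t * s = (y * s) * (s * t * s))%g.
  by rewrite !mulgA -[(y * s * s)%g]mulgA affS_inv // mulg1.
apply: bruhat_step (bruhat_refl _ _) _ _.
  case: ct => g [s' [Ss' ->]]; exists (s * g)%g, s'; split=> //.
  by rewrite invgM (S_invE affS_inv Ss) !mulgA.
rewrite !mulgA -[(y * s * s)%g]mulgA affS_inv // mulg1.
exact: bruhat_step_S.
Qed.

(** By the lifting property, x <= M implies x s <= M if M s < M; iterate along a reduced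
    word of u. *)
Lemma bruhat_coset_max f M : spec f bpt ->
    (forall s, S s -> s f = f -> len M = (len (M * s)%g).+1) ->
  forall u, u f = f -> forall g, ble g M -> ble (g * u)%g M.
Proof.
move=> sf Mmax; apply: stab_ind => //; first by move=> z; rewrite mulg1.
move=> s u Ss sff uf _ IH z zM; rewrite mulgA; apply: IH.
have [//|h] := bruhat_lifting Ss zM; apply: bruhat_trans h _.
have e := Mmax s Ss sff.
have := @bruhat_S_up (M * s)%g s Ss; rewrite -mulgA affS_inv // mulg1; exact.
Qed.

Lemma ue_max y f s : chamber rs y -> spec f bpt -> ue y f = y -> S s -> s f = f ->
  len (ue y) = (len (ue y * s)%g).+1.
Proof.
move=> Cy sf uf Ss sff.
have [_ ->] := len_ue (w := (ue y * s)%g) Cy sf (etrans (congr1 (ue y) sff) uf).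
by rewrite invgM -mulgA mulVg mulg1 (S_invE affS_inv Ss) (len_S Ss) addn1.
Qed.

End Coxeter.

(** * The Hecke algebra and the antispherical module *)

Lemma lcomb_addf (T : choiceType) (K : comNzRingType) (c c' : T -> K) :
  finite_set [set x | c x != 0] -> finite_set [set x | c' x != 0] ->
  finite_set [set x | c x + c' x != 0].
Proof.
move=> fc fc'; apply: (@sub_finite_set _ _ ([set x | c x != 0] `|` [set x | c' x != 0])).
  by move=> x /=; case: (eqVneq (c x) 0) => [->|]; [rewrite add0r; right|left].
by rewrite finite_setU.
Qed.

Section LinearCombinations.
Variables (T : choiceType) (K : comNzRingType) (M : lmodType K) (F : T -> M).
Implicit Types (c : T -> K).

Definition lcomb c : M := \sum_(x \in [set: T]) c x *: F x.

Lemma lcomb_seq c (r : seq T) : uniq r -> (forall x, c x != 0 -> x \in r) ->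
  lcomb c = \sum_(x <- r) c x *: F x.
Proof. by move=> ur cr; apply: fsum_comb => // x _; exact: cr. Qed.

Lemma lcomb_suppE c : finite_set [set x | c x != 0] ->
  lcomb c = \sum_(x <- suppseq c) c x *: F x.
Proof.
move=> fc; apply: lcomb_seq; first exact: suppseq_uniq.
by move=> x; rewrite mem_suppseq.
Qed.

Lemma lcombD c c' : finite_set [set x | c x != 0] -> finite_set [set x | c' x != 0] ->
  lcomb (fun x => c x + c' x) = lcomb c + lcomb c'.
Proof.
move=> fc fc'; pose r := undup (suppseq c ++ suppseq c').
have cr x : c x != 0 -> x \in r by rewrite mem_undup mem_cat (mem_suppseq x fc) => ->.
have cr' x : c' x != 0 -> x \in r.
  by rewrite mem_undup mem_cat (mem_suppseq x fc') orbC => ->.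
rewrite !(@lcomb_seq _ r) ?undup_uniq //.
  by rewrite -big_split /=; apply: eq_bigr => x _; rewrite scalerDl.
move=> x; case: (eqVneq (c x) 0) => [->|/cr //]; rewrite add0r; exact: cr'.
Qed.

Lemma lcombZ a c : finite_set [set x | c x != 0] ->
  lcomb (fun x => a * c x) = a *: lcomb c.
Proof.
move=> fc; rewrite (lcomb_suppE fc) scaler_sumr.
rewrite (@lcomb_seq _ (suppseq c)); last 2 first.
- exact: suppseq_uniq.
- by move=> x; rewrite mem_suppseq //; apply: contra => /eqP ->; rewrite mulr0.
by apply: eq_bigr => x _; rewrite scalerA.
Qed.

Lemma lcomb0 : lcomb (fun=> 0) = 0.
Proof. by rewrite (@lcomb_seq _ [::]) ?big_nil // => x; rewrite eqxx. Qed.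

Lemma lcomb_ext c c' : c =1 c' -> lcomb c = lcomb c'.
Proof. by move=> /funext ->. Qed.

Lemma lcomb1 y : lcomb (fun x => (x == y)%:R) = F y.
Proof.
rewrite (@lcomb_seq _ [:: y]) //; last first.
  by move=> x; rewrite inE; case: (eqVneq x y) => //; rewrite eqxx.
by rewrite big_seq1 eqxx scale1r.
Qed.

Lemma delta_finite y : finite_set [set x : T | (x == y)%:R != 0 :> K].
Proof.
apply: (@sub_finite_set _ _ [set y]); last exact: finite_set1.
by move=> x /=; case: (eqVneq x y) => // _; rewrite eqxx.
Qed.

Lemma scalef_finite (a c : T -> K) : finite_set [set x | c x != 0] ->
  finite_set [set x | a x * c x != 0].
Proof.
by apply: sub_finite_set => x /=; apply: contra => /eqP ->; rewrite mulr0.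
Qed.

Lemma sumf_finite I (s : seq I) (c : I -> T -> K) :
  (forall i, finite_set [set x | c i x != 0]) ->
  finite_set [set x | \sum_(i <- s) c i x != 0].
Proof.
move=> fc; elim: s => [|i s IH].
  by rewrite (_ : [set _ | _] = set0) // -subset0 => x /=; rewrite big_nil eqxx.
apply: sub_finite_set (lcomb_addf (fc i) IH) => x /=.
by rewrite big_cons.
Qed.

Lemma lcomb_sum I (s : seq I) (c : I -> T -> K) :
  (forall i, finite_set [set x | c i x != 0]) ->
  lcomb (fun x => \sum_(i <- s) c i x) = \sum_(i <- s) lcomb (c i).
Proof.
move=> fc; elim: s => [|i s IH].
  by rewrite big_nil -lcomb0; apply: lcomb_ext => x; rewrite big_nil.
rewrite big_cons -IH -lcombD //; last exact: sumf_finite.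
by apply: lcomb_ext => x; rewrite big_cons.
Qed.

End LinearCombinations.

Section Hecke.
Variables (R : realType) (n : nat) (rs : root_system R n) (l : nat).
Hypothesis l_gt0 : (0 < l)%N.
Local Notation affW := (affW rs l).
Local Notation S := (affS rs l).
Local Notation finW := (finW rs l).
Local Notation len := (clength (affS rs l)).
Local Notation min_rep := (min_rep (affS rs l) (Defs.finW rs l)).
Variables (Hk : hecke_algebra (affS rs l)) (N : induced_sign (Defs.finW rs l) Hk).
Local Notation H := (hk_H Hk).
Local Notation bar := (@hk_bar _ _ Hk).
Local Notation T := (ind_tens N).
Local Notation nbar := (ind_bar (i := N)).
Implicit Types (x y w g u s : affW) (h : Hk) (a : laurent) (m : N).

Let affS_inv := @affS_inv R n rs l l_gt0.

Lemma affS_mulK w s : S s -> (w * s * s)%g = w.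
Proof. by move=> Ss; rewrite -mulgA affS_inv // mulg1. Qed.

Lemma affS_Kmul w s : S s -> (s * (s * w))%g = w.
Proof. by move=> Ss; rewrite mulgA affS_inv // mul1g. Qed.

Lemma H1 : H 1%g = 1.
Proof.
have [b1 _] := hk_barH Hk 1%g; rewrite invg1 in b1.
have : H 1%g * H 1%g = H 1%g by rewrite hk_mul ?mulg1 // (clength1 (affS_gen l_gt0)).
by move=> /(congr1 (fun h => bar (H 1%g) * h)); rewrite mulrA b1 mul1r.
Qed.

Lemma bar1 : bar 1 = 1.
Proof.
by have [b1 _] := hk_barH Hk 1%g; rewrite invg1 H1 mulr1 in b1.
Qed.

Lemma barN h : bar (- h) = - bar h.
Proof. by rewrite -scaleN1r hk_barZ lbarN lbar1 scaleN1r. Qed.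

Lemma bar_sum I (r : seq I) (F : I -> Hk) :
  bar (\sum_(i <- r) F i) = \sum_(i <- r) bar (F i).
Proof.
apply: (big_morph bar) => [h h'|]; first exact: hk_barD.
by rewrite -(scale0r (1 : Hk)) hk_barZ lbar0 !scale0r.
Qed.

Lemma H_S_up w s : S s -> len (w * s)%g = (len w).+1 -> H w * H s = H (w * s)%g.
Proof. by move=> Ss e; rewrite hk_mul // e (len_S l_gt0 Ss) addn1. Qed.

Lemma S_H_up w s : S s -> len (s * w)%g = (len w).+1 -> H s * H w = H (s * w)%g.
Proof. by move=> Ss e; rewrite hk_mul // e (len_S l_gt0 Ss) add1n. Qed.

Lemma H_S_down w s : S s -> len w = (len (w * s)%g).+1 ->
  H w * H s = H (w * s)%g + (vpow (-1) - vpow 1) *: H w.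
Proof.
move=> Ss e; have wE : H w = H (w * s)%g * H s by rewrite H_S_up ?affS_mulK.
by rewrite {1}wE -mulrA -expr2 hk_quad // mulrDr mulr1 -scalerAr -wE.
Qed.

Lemma S_H_down w s : S s -> len w = (len (s * w)%g).+1 ->
  H s * H w = H (s * w)%g + (vpow (-1) - vpow 1) *: H w.
Proof.
move=> Ss e; have wE : H w = H s * H (s * w)%g by rewrite S_H_up ?affS_Kmul.
by rewrite {1}wE mulrA -expr2 hk_quad // mulrDl mul1r -scalerAl -wE.
Qed.

Lemma bar_HS s : S s -> bar (H s) = H s + (vpow 1 - vpow (-1)) *: 1.
Proof.
move=> Ss; have [b1 _] := hk_barH Hk s.
rewrite (S_invE affS_inv Ss) in b1.
have e : H s * (H s + (vpow 1 - vpow (-1)) *: 1) = 1.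
  rewrite mulrDr -expr2 hk_quad // -scalerAr mulr1 -addrA -scalerDl.
  by rewrite addrA subrK subrr scale0r addr0.
by rewrite -[LHS]mulr1 -[X in _ * X = _]e mulrA b1 mul1r.
Qed.

(** ** Coordinates in the antispherical module *)

Definition hcoef h : affW -> laurent := projT1 (cid (hk_basis h)).

Lemma hcoefP h : finite_set [set x | hcoef h x != 0] /\ h = lcomb H (hcoef h).
Proof. by rewrite /hcoef; case: cid => c [] /=. Qed.

Lemma hcoef_unique h c : finite_set [set x | c x != 0] -> h = lcomb H c -> hcoef h = c.
Proof.
by move=> fc hE; rewrite /hcoef; case: cid => c' [_ /= u]; apply: u.
Qed.

Lemma hcoefD h h' : hcoef (h + h') = fun x => hcoef h x + hcoef h' x.
Proof.
have [f1 e1] := hcoefP h; have [f2 e2] := hcoefP h'.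
by apply: hcoef_unique; [exact: (lcomb_addf f1 f2) | rewrite (lcombD _ f1 f2) -e1 -e2].
Qed.

Lemma hcoefZ a h : hcoef (a *: h) = fun x => a * hcoef h x.
Proof.
have [f1 e1] := hcoefP h.
by apply: hcoef_unique; [exact: (scalef_finite (fun=> a) f1) | rewrite (lcombZ _ a f1) -e1].
Qed.

Lemma hcoef_H w : hcoef (H w) = fun x => (x == w)%:R.
Proof. by apply: hcoef_unique; [exact: delta_finite | rewrite lcomb1]. Qed.

(** The coefficient of N_x in the image of H_g, for x of minimal length: if g = w x with w
    in the finite Weyl group, then H_g = H_w H_x and w acts by (-v)^l(w). *)
Definition tau x g : laurent :=
  if `[< finW (g * x^-1)%g >] then (- vpow 1) ^+ (len g - len x) else 0.

Definition psi x h : laurent := lcomb (fun g => tau x g : laurent^o) (hcoef h).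

Lemma psiD x h h' : psi x (h + h') = psi x h + psi x h'.
Proof.
have [f1 _] := hcoefP h; have [f2 _] := hcoefP h'.
by rewrite /psi hcoefD (lcombD _ f1 f2).
Qed.

Lemma psiZ x a h : psi x (a *: h) = a * psi x h.
Proof. by have [f1 _] := hcoefP h; rewrite /psi hcoefZ (lcombZ _ a f1). Qed.

Lemma psi_H x g : psi x (H g) = tau x g.
Proof. by rewrite /psi hcoef_H lcomb1. Qed.

Lemma psi_sum x I (r : seq I) (F : I -> Hk) :
  psi x (\sum_(i <- r) F i) = \sum_(i <- r) psi x (F i).
Proof.
apply: (big_morph (psi x)) => [h h'|]; first exact: psiD.
by rewrite -(scale0r (1 : Hk)) psiZ mul0r.
Qed.

Lemma finWM g w : finW g -> finW w -> finW (g * w)%g.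
Proof. exact: generatedM. Qed.

(** H_s H_g is H_(s g) or H_(s g) + (v^-1 - v) H_g, and accordingly tau x (s g) is -v or -v^-1
    times tau x g. *)
Lemma psi_relation x s h : min_rep x -> S s -> finW s ->
  psi x (H s * h + vpow 1 *: h) = 0.
Proof.
move=> mx Ss Ws; rewrite psiD psiZ; have [fh hE] := hcoefP h.
rewrite {1 2}hE (lcomb_suppE _ fh) mulr_sumr !psi_sum mulr_sumr -big_split /=.
rewrite big1 // => g _; rewrite -scalerAr !psiZ mulrCA -mulrDr psi_H.
rewrite (_ : _ + _ = 0) ?mulr0 //.
have cosetS : finW (s * g * x^-1)%g <-> finW (g * x^-1)%g.
  split=> [h'|h']; last by rewrite -mulgA; exact: finWM.
  by have := finWM Ws h'; rewrite -!mulgA affS_Kmul.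
have len_coset g' : finW (g' * x^-1)%g -> (len x <= len g')%N.
  by move=> /mx; rewrite mulgVK.
have tau0 g' : ~ finW (g' * x^-1)%g -> tau x g' = 0.
  by rewrite /tau; case: asboolP.
have tau_up g' : finW (g' * x^-1)%g -> finW (s * g' * x^-1)%g ->
    len (s * g')%g = (len g').+1 -> tau x (s * g')%g = - vpow 1 * tau x g'.
  move=> c1 c2 e; rewrite /tau; case: asboolP => // _; case: asboolP => // _.
  by rewrite e subSn ?exprS //; exact: len_coset.
have [c|nc] := pselect (finW (g * x^-1)%g).
  have c' := cosetS.2 c; have [e|e] := len_S_cases l_gt0 g Ss.
    by rewrite S_H_up // psi_H tau_up // mulNr addNr.
  rewrite S_H_down // psiD psiZ !psi_H.
  have -> : tau x g = - vpow 1 * tau x (s * g)%g.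
    by have := @tau_up (s * g)%g; rewrite !affS_Kmul //; apply.
  have /(congr1 (fun z => z * tau x (s * g)%g)) := vpowNK 1; rewrite mul1r => {1}<-.
  ring.
have nc' : ~ finW (s * g * x^-1)%g by move/cosetS.
have [e|e] := len_S_cases l_gt0 g Ss.
  by rewrite S_H_up // psi_H !tau0 // mulr0 addr0.
by rewrite S_H_down // psiD psiZ !psi_H !tau0 // !mulr0 !addr0.
Qed.

Lemma ind_tens_S s h : S s -> finW s -> T (H s * h) = - vpow 1 *: T h.
Proof.
move=> Ss Ws; apply/eqP; rewrite scaleNr -addr_eq0 -linearZ -linearD; apply/eqP.
apply/ind_tens_ker; exists [:: (s, h)]; split; last by rewrite big_seq1.
by move=> p; rewrite inE => /eqP ->.
Qed.

Lemma psi_ker x h : min_rep x -> T h = 0 -> psi x h = 0.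
Proof.
move=> mx /ind_tens_ker[r [rS ->]]; rewrite psi_sum big_seq big1 // => p /rS[Sp Wp].
exact: psi_relation.
Qed.

Definition ncoef x m : laurent := psi x (projT1 (cid (ind_tens_surj m))).

Lemma ncoef_tens x h : min_rep x -> ncoef x (T h) = psi x h.
Proof.
move=> mx; rewrite /ncoef; case: cid => h' /= e.
have : psi x (h - h') = 0 by apply: psi_ker => //; rewrite linearB /= e subrr.
by rewrite -scaleN1r psiD psiZ mulN1r => /eqP; rewrite subr_eq0 => /eqP.
Qed.

Lemma ncoefD x m m' : min_rep x -> ncoef x (m + m') = ncoef x m + ncoef x m'.
Proof.
have [h ->] := ind_tens_surj m; have [h' ->] := ind_tens_surj m'.
by move=> mx; rewrite -linearD /= !ncoef_tens // psiD.
Qed.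

Lemma ncoefZ x a m : min_rep x -> ncoef x (a *: m) = a * ncoef x m.
Proof.
have [h ->] := ind_tens_surj m.
by move=> mx; rewrite -linearZ /= !ncoef_tens // psiZ.
Qed.

(** The standard basis of the antispherical module. *)
Definition nb x : N := T (H x).

Lemma ncoef_nb x y : min_rep x -> min_rep y -> ncoef x (nb y) = (x == y)%:R.
Proof.
move=> mx my; rewrite ncoef_tens // psi_H /tau; case: asboolP => c; last first.
  by case: eqVneq => // e; case: c; rewrite e mulgV; exact: generated_id.
have e : (y * x^-1)%g = 1%g.
  by apply: (min_rep_unique l_gt0 c mx); rewrite mulgVK.
have -> : y = x by rewrite -[y](mulgVK x) e mul1g.
by rewrite eqxx subnn.
Qed.

(** The filtration of the module by length, for which the involution is unitriangular. *)
Definition below d m := exists c : affW -> laurent,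
  [/\ finite_set [set y | c y != 0],
      forall y, c y != 0 -> min_rep y /\ (len y < d)%N & m = lcomb nb c].

Lemma ncoef_sum x I (r : seq I) (F : I -> N) : min_rep x ->
  ncoef x (\sum_(i <- r) F i) = \sum_(i <- r) ncoef x (F i).
Proof.
move=> mx; apply: (big_morph (ncoef x)) => [m m'|]; first exact: ncoefD.
by rewrite -(scale0r (0 : N)) ncoefZ // mul0r.
Qed.

Lemma ncoef_lcomb x c : finite_set [set y | c y != 0] ->
  (forall y, c y != 0 -> min_rep y) -> min_rep x -> ncoef x (lcomb nb c) = c x.
Proof.
move=> fc cm mx; rewrite lcomb_suppE // ncoef_sum //.
transitivity (\sum_(y <- suppseq c) c y * (x == y)%:R).
  rewrite big_seq [RHS]big_seq; apply: eq_bigr => y.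
  by rewrite mem_suppseq // => /cm my; rewrite ncoefZ // ncoef_nb.
case: (eqVneq (c x) 0) => cx.
  rewrite big1 // => y _; case: eqVneq => [<-|]; first by rewrite cx mul0r.
  by rewrite mulr0.
rewrite (bigD1_seq x) ?suppseq_uniq ?mem_suppseq //= eqxx mulr1 big1 ?addr0 // => y.
by rewrite eq_sym => /negbTE ->; rewrite mulr0.
Qed.

Lemma belowD d m m' : below d m -> below d m' -> below d (m + m').
Proof.
move=> [c [fc cd ->]] [c' [fc' cd' ->]]; exists (fun y => c y + c' y); split.
- exact: (lcomb_addf fc fc').
- by move=> y; case: (eqVneq (c y) 0) => [->|/cd //]; rewrite add0r => /cd'.
- by rewrite (lcombD _ fc fc').
Qed.

Lemma belowZ d a m : below d m -> below d (a *: m).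
Proof.
move=> [c [fc cd ->]]; exists (fun y => a * c y); split; last by rewrite (lcombZ _ a fc).
  exact: (scalef_finite (fun=> a) fc).
by move=> y ac; apply: cd; apply: contra ac => /eqP ->; rewrite mulr0.
Qed.

Lemma below0 d : below d 0.
Proof.
exists (fun=> 0); split; last by rewrite lcomb0.
  by rewrite (_ : [set _ | _] = set0) // -subset0 => y /=; rewrite eqxx.
by move=> y; rewrite eqxx.
Qed.

Lemma belowB d m m' : below d m -> below d m' -> below d (m - m').
Proof. by move=> h h'; rewrite -scaleN1r; apply: belowD => //; exact: belowZ. Qed.

Lemma below_nb d y : min_rep y -> (len y < d)%N -> below d (nb y).
Proof.
move=> my yd; exists (fun x => (x == y)%:R); split; last by rewrite lcomb1.
  exact: delta_finite.
by move=> x; case: (eqVneq x y) => [->|] //; rewrite eqxx.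
Qed.

Lemma below_leq d d' m : (d <= d')%N -> below d m -> below d' m.
Proof.
move=> dd [c [fc cd ->]]; exists c; split=> // y /cd[my yd]; split=> //.
exact: leq_trans dd.
Qed.

Lemma ncoef_below d m x : below d m -> min_rep x -> (d <= len x)%N -> ncoef x m = 0.
Proof.
move=> [c [fc cd ->]] mx dx; rewrite ncoef_lcomb //; last by move=> y /cd[].
by apply/eqP; apply: contraLR dx => /cd[_]; rewrite -ltnNge.
Qed.

Lemma below_eq0 d m : below d m -> (forall x, min_rep x -> ncoef x m = 0) -> m = 0.
Proof.
move=> [c [fc cd ->]] h; rewrite -[RHS](lcomb0 nb); apply: lcomb_ext => y.
apply/eqP; apply: contraT => cy; have [my _] := cd y cy.
by have := h y my; rewrite ncoef_lcomb // => [e|z /cd[] //]; rewrite e eqxx in cy.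
Qed.

(** ** The bar involution of the module *)

Lemma nbar_tens h : nbar (T h) = T (bar h).
Proof. by rewrite -[T h]scale1r ind_bar_tens lbar1 scale1r. Qed.

Lemma nbarZ a m : nbar (a *: m) = lbar a *: nbar m.
Proof. by have [h ->] := ind_tens_surj m; rewrite ind_bar_tens nbar_tens. Qed.

Lemma nbar_sum I (r : seq I) (F : I -> N) :
  nbar (\sum_(i <- r) F i) = \sum_(i <- r) nbar (F i).
Proof.
apply: (big_morph nbar) => [m m'|]; first exact: ind_barD.
by rewrite -(scale0r (0 : N)) nbarZ lbar0 !scale0r.
Qed.

Variables (kl : affW -> affW -> laurent).
Hypothesis hkl : is_kl_family N kl.

Definition KL x : N := lcomb nb (kl^~ x).

Lemma kl_diag x : min_rep x -> kl x x = 1. Proof. by case/hkl. Qed.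

Lemma kl_neq0 x y : min_rep x -> kl y x != 0 ->
  min_rep y /\ bruhat_le (affS rs l) y x.
Proof. by case/hkl => _ h _ _ _; exact: h. Qed.

Lemma kl_small x y : min_rep x -> y <> x -> in_vZv (kl y x).
Proof.
move=> mx yx; case: (eqVneq (kl y x) 0) => [->|nz]; first exact: in_vZv0.
by case: (hkl mx) => _ _ h _ _; apply: h; split=> //; case: (kl_neq0 mx nz).
Qed.

Lemma kl_finite x : min_rep x -> finite_set [set y | kl y x != 0].
Proof. by case/hkl. Qed.

Lemma nbar_KL x : min_rep x -> nbar (KL x) = KL x.
Proof. by case/hkl. Qed.

Lemma kl_len x y : min_rep x -> kl y x != 0 -> y <> x -> (len y < len x)%N.
Proof. by move=> mx /(kl_neq0 mx)[_ /bruhat_length[]]. Qed.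

Lemma KL_split x : min_rep x -> exists m, below (len x) m /\ KL x = nb x + m.
Proof.
move=> mx; exists (lcomb nb (fun y => kl y x * (y != x)%:R)).
have f : finite_set [set y | kl y x * (y != x)%:R != 0].
  apply: sub_finite_set (kl_finite mx) => y /=; apply: contra => /eqP ->.
  by rewrite mul0r.
split.
  exists (fun y => kl y x * (y != x)%:R); split=> // y.
  case: (eqVneq y x) => [_|/eqP yx]; rewrite /= ?mulr0 ?eqxx // mulr1 => nz.
  by split; [case: (kl_neq0 mx nz) | exact: kl_len].
rewrite -[nb x](lcomb1 nb) -(lcombD nb (@delta_finite _ laurent x) f).
apply: lcomb_ext => y; case: (eqVneq y x) => [->|_] /=; last by rewrite mulr1 add0r.
by rewrite mulr0 addr0 kl_diag.
Qed.

(** By induction on the length, comparing the two sides of the self-duality of KL_y: KL_y is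
    N_y plus shorter terms. *)
Lemma nbar_nb y : min_rep y -> below (len y) (nbar (nb y) - nb y).
Proof.
have [k] := ubnP (len y); elim: k y => // k IH y yk my.
have [m [bm E]] := KL_split my.
have /eqP : nbar (nb y) + nbar m = nb y + m by rewrite -ind_barD -E nbar_KL.
rewrite -subr_eq0 opprD addrACA addr_eq0 opprB => /eqP ->.
apply: belowB => //; case: bm => c [fc cd ->]; rewrite lcomb_suppE // nbar_sum.
rewrite big_seq; elim/big_ind: _ => [|m1 m2|x]; [exact: below0|exact: belowD|].
rewrite mem_suppseq // => /cd[mx xy]; rewrite nbarZ; apply: belowZ.
rewrite -[nbar _](subrK (nb x)); apply: belowD; last exact: below_nb.
by apply: (below_leq (ltnW xy)); apply: IH => //; lia.
Qed.

Lemma ncoef_nbar x m : min_rep x -> below (len x).+1 m ->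
  ncoef x (nbar m) = lbar (ncoef x m).
Proof.
move=> mx [c [fc cd ->]]; rewrite ncoef_lcomb //; last by move=> y /cd[].
rewrite lcomb_suppE // nbar_sum ncoef_sum //.
rewrite -[in RHS](ncoef_lcomb fc) //; last by move=> y /cd[].
rewrite lcomb_suppE // ncoef_sum // lbar_sum big_seq [RHS]big_seq; apply: eq_bigr => y.
rewrite mem_suppseq // => /cd[my yx]; rewrite nbarZ !ncoefZ // lbarM; congr (_ * _).
rewrite -[nbar _](subrK (nb y)) ncoefD // (ncoef_below (nbar_nb my)) // add0r.
rewrite ncoef_nb //; case: eqP => _; first by rewrite lbar1.
by rewrite lbar0.
Qed.

(** As the involution is unitriangular for the length, it acts on a coefficient of maximal
    length through the bar involution of the scalars alone. *)
Lemma top_coef_bar (c : affW -> laurent) y : finite_set [set y | c y != 0] ->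
    (forall y, c y != 0 -> min_rep y) -> nbar (lcomb nb c) = lcomb nb c ->
    min_rep y -> (forall z, c z != 0 -> (len z <= len y)%N) ->
  lbar (c y) = c y.
Proof.
move=> fc cm cb my ym; rewrite -{1}(ncoef_lcomb fc cm my) -ncoef_nbar //.
  by rewrite cb ncoef_lcomb.
by exists c; split=> // z cz; split; [exact: cm | exact: ym].
Qed.

Lemma max_len (c : affW -> laurent) : finite_set [set y | c y != 0] -> (exists y, c y != 0) ->
  exists y, c y != 0 /\ forall z, c z != 0 -> (len z <= len y)%N.
Proof.
move=> fc [y0 cy0]; pose P k := `[< exists y, c y != 0 /\ len y = k >].
have exP : exists k, P k by exists (len y0); apply/asboolP; exists y0.
pose B := \max_(y <- suppseq c) len y.
have bnd z : c z != 0 -> (len z <= B)%N.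
  by move=> cz; apply: leq_bigmax_seq => //; rewrite mem_suppseq.
have PB k : P k -> (k <= B)%N by move=> /asboolP[y [cy <-]]; exact: bnd.
case: (ex_maxnP exP PB) => k /asboolP[y [cy yk]] kmax; exists y; split=> // z cz.
by rewrite yk; apply: kmax; apply/asboolP; exists z.
Qed.

(** ** Right multiplication by a simple reflection *)

(** KL_x absorbs the involution, so it passes to the factor h. *)
Lemma act_bar x h : min_rep x -> forall hx, KL x = T hx -> nbar (T (hx * h)) = T (hx * bar h).
Proof.
move=> mx hx E; rewrite nbar_tens hk_barM -!ind_tens_act; congr ind_act.
by rewrite -nbar_tens -E nbar_KL // E.
Qed.

Lemma KL_tens x : min_rep x -> KL x = T (lcomb H (kl^~ x)).
Proof.
move=> mx; have fx := kl_finite mx.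
by rewrite /KL !lcomb_suppE // linear_sum; apply: eq_bigr => y _; rewrite linearZ.
Qed.

End Hecke.

Section Descents.
Variables (R : realType) (n : nat) (rs : root_system R n) (l : nat).
Hypothesis l_gt0 : (0 < l)%N.
Local Notation V := 'rV[R]_n.
Local Notation finW := (finW rs l).
Local Notation ue := (ue rs l).
Local Notation spec := (spec rs l).
Local Notation affW := (affW rs l).
Local Notation S := (affS rs l).
Local Notation len := (clength (affS rs l)).
Local Notation min_rep := (min_rep (affS rs l) (Defs.finW rs l)).
Local Notation bpt := (bpt rs l).
Variables (Hk : hecke_algebra (affS rs l)) (N : induced_sign (Defs.finW rs l) Hk).
Variables (kl : affW -> affW -> laurent).
Hypothesis hkl : is_kl_family N kl.
Local Notation bar := (@hk_bar _ _ Hk).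
Local Notation H := (hk_H Hk).
Local Notation T := (ind_tens N).
Local Notation nbar := (ind_bar (i := N)).
Local Notation nb := (nb N).
Implicit Types (x y w g u s : affW) (h : Hk) (a : laurent) (m : N).

Lemma min_rep_descent x s : S s -> min_rep x -> len x = (len (x * s)%g).+1 ->
  min_rep (x * s)%g.
Proof.
move=> Ss mx e; apply: contrapT => nm.
have [s' [Ss' Ws' xs]] := min_rep_leave l_gt0 Ss mx nm.
have := mx s' Ws'; rewrite -xs e; lia.
Qed.

(** The N_y with y of minimal length span the module: left multiplication by a
    simple reflection of the finite group only contributes a scalar. *)
Lemma below_all m : exists d, below d m.
Proof.
have [h ->] := ind_tens_surj m; have [fh ->] := hcoefP h.
rewrite lcomb_suppE // linear_sum; elim: (suppseq _) => [|g r [d IH]].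
  by exists 0%N; rewrite big_nil; exact: below0.
suff [d' H'] : exists d', below d' (nb g).
  exists (maxn d' d); rewrite big_cons linearZ; apply: belowD.
    by apply: belowZ; apply: below_leq H'; exact: leq_maxl.
  by apply: below_leq IH; exact: leq_maxr.
have [k] := ubnP (len g); elim: k g => // k IHk g gk.
have [mg|nmg] := pselect (min_rep g); first by exists (len g).+1; apply: below_nb.
have [i hi] : exists i, dot rs (g bpt) (simple rs i) < 0%:~R * l%:R.
  apply: contrapT => no; apply: nmg; apply/(min_repP l_gt0) => i.
  have [|h'] := dot_lt_or l_gt0 g 0 (simple_root rs i); first by rewrite mul0r.
  by case: no; exists i.
have wi : wallp rs (simple rs i) 0 by left; exists i.
have Ss := wall_affS l_gt0 wi; set s := arefl rs l (simple rs i) 0 in Ss.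
have e : len g = (len (s * g)%g).+1 by exact: len_wall_down.
have [|d' H'] := IHk (s * g)%g; first by rewrite -ltnS -e.
have E : nb g = T (H s * H (s * g)%g) by rewrite S_H_up ?affS_Kmul.
exists d'; rewrite E ind_tens_S //; last exact: arefl_finW (simple_root rs i).
exact: belowZ.
Qed.

Lemma torsion_free a m : a != 0 -> a *: m = 0 -> m = 0.
Proof.
move=> a0 am; have [d bm] := below_all m; apply: (below_eq0 l_gt0 bm) => x mx.
have : a * ncoef x m = 0 by rewrite -ncoefZ // am -(scale0r (0 : N)) ncoefZ // mul0r.
by move=> /laurent_mulf_eq0[e|//]; rewrite e eqxx in a0.
Qed.

(** Right multiplication of N_y by H_s: the term N_{ys} is present exactly when
    y s is of minimal length, and [act_coef] is the coefficient of N_y. *)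
Definition act_coef y s : laurent :=
  if `[< min_rep (y * s)%g >] then
    if (len y < len (y * s)%g)%N then 0 else vpow (-1) - vpow 1
  else - vpow 1.

Lemma nb_HS y s : S s -> min_rep y ->
  T (H y * H s) = (`[< min_rep (y * s)%g >] : nat)%:R *: nb (y * s)%g + act_coef y s *: nb y.
Proof.
move=> Ss my; rewrite /act_coef; case: asboolP => mys.
  rewrite scale1r; have [e|e] := len_Sr_cases l_gt0 y Ss.
    by rewrite e ltnSn H_S_up // scale0r addr0.
  have -> : (len y < len (y * s)%g)%N = false by rewrite e ltnNge leqnSn.
  by rewrite H_S_down // linearD linearZ.
have [s' [Ss' Ws' ys]] := min_rep_leave l_gt0 Ss my mys.
have e : len (y * s)%g = (len y).+1.
  have [//|e] := len_Sr_cases l_gt0 y Ss.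
  by case: mys; exact: min_rep_descent.
rewrite scale0r add0r H_S_up // ys -(S_H_up l_gt0 Hk Ss') -?ys //.
exact: ind_tens_S.
Qed.

Lemma sum_reindex (r : seq affW) s (F : affW -> N) : S s -> uniq r ->
  (forall y, y \in r -> (y * s)%g \in r) ->
  \sum_(y <- r) F (y * s)%g = \sum_(y <- r) F y.
Proof.
move=> Ss ur rs_; rewrite -(big_map (fun y => y * s)%g xpredT F).
apply: perm_big; apply: uniq_perm => //; first by rewrite map_inj_uniq //; exact: mulIg.
move=> y; apply/mapP/idP => [[z zr ->]|yr]; first exact: rs_.
by exists (y * s)%g; [exact: rs_ | rewrite affS_mulK].
Qed.

(** These are the coefficients of KL_x (H_s - v^-1).  The element is self-dual, because
    H_s - v^-1 is, so its coefficient at a y of maximal length in its support is fixed by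
    the bar involution.  This is absurd: either y s would be a longer element of the support,
    or the coefficient lies in v Z[v], possibly after division by v + v^-1. *)
Lemma KL_descent_eq0 x s : S s -> min_rep x -> len x = (len (x * s)%g).+1 ->
  forall y, (`[< min_rep y >] : nat)%:R * kl (y * s)%g x +
            kl y x * (act_coef y s - vpow (-1)) = 0.
Proof.
move=> Ss mx xs; pose c y := kl y x.
pose z y := (`[< min_rep y >] : nat)%:R * c (y * s)%g + c y * (act_coef y s - vpow (-1)).
rewrite -[forall y, _]/(forall y, z y = 0).
have fc : finite_set [set y | c y != 0] by exact: kl_finite hkl _ mx.
have cm y : c y != 0 -> min_rep y by move=> cy; case: (kl_neq0 hkl mx cy).
have mxs := min_rep_descent Ss mx xs.
pose r := undup (suppseq c ++ [seq (y * s)%g | y <- suppseq c]).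
have cr y : c y != 0 -> y \in r.
  by rewrite mem_undup mem_cat (mem_suppseq y fc) => ->.
have rs_ y : y \in r -> (y * s)%g \in r.
  rewrite !mem_undup !mem_cat => /orP[yr|/mapP[w wr ->]].
    by apply/orP; right; apply: map_f.
  by rewrite affS_mulK // wr.
have zr y : z y != 0 -> y \in r.
  rewrite /z; case: (eqVneq (c y) 0) => [->|/cr //]; rewrite mul0r addr0.
  case: (eqVneq (c (y * s)%g) 0) => [->|/cr/rs_]; first by rewrite mulr0 eqxx.
  by rewrite affS_mulK.
have fz : finite_set [set y | z y != 0].
  by apply: (@sub_finite_set _ _ [set` r]) => //; exact: finite_seq.
have zm y : z y != 0 -> min_rep y.
  move=> zy; apply: contrapT => my; case/eqP: zy; rewrite /z asboolF // mul0r add0r.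
  case: (eqVneq (c y) 0) => [->|/cm //]; exact: mul0r.
have Ehx : KL N kl x = T (lcomb H c) by exact: KL_tens hkl _ mx.
have ZE : T (lcomb H c * (H s - (vpow (-1))%:A)) = lcomb nb z.
  rewrite (lcomb_seq _ _ cr) ?undup_uniq // (lcomb_seq _ _ zr) ?undup_uniq //.
  rewrite mulr_suml linear_sum /=.
  transitivity (\sum_(y <- r) c y *: ((`[< min_rep (y * s)%g >] : nat)%:R *: nb (y * s)%g
      + (act_coef y s - vpow (-1)) *: nb y)).
    apply: eq_bigr => y _; rewrite -scalerAl linearZ /=.
    case: (eqVneq (c y) 0) => [->|/cm my]; first by rewrite !scale0r.
    congr (_ *: _); rewrite mulrBr linearB /= nb_HS // -scalerAr mulr1 linearZ /=.
    by rewrite -addrA scalerBl.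
  pose F y := ((`[< min_rep y >] : nat)%:R * c (y * s)%g) *: nb y.
  rewrite (eq_bigr (fun y => F (y * s)%g + (c y * (act_coef y s - vpow (-1))) *: nb y)); last first.
    by move=> y _; rewrite scalerDr !scalerA /F affS_mulK // [c y * _%:R]mulrC.
  rewrite big_split /= (sum_reindex F Ss) ?undup_uniq // -big_split /=.
  by apply: eq_bigr => y _; rewrite -scalerDl.
(* bar (H_s - v^-1) = H_s - v^-1 *)
have Zbar : nbar (lcomb nb z) = lcomb nb z.
  rewrite -ZE (act_bar hkl _ mx Ehx); congr (T (_ * _)).
  rewrite hk_barD barN (bar_HS l_gt0 Hk Ss) hk_barZ (bar1 l_gt0) lbar_vpow opprK.
  by rewrite -addrA -scalerBl addrAC subrr add0r scaleNr.
move=> y0; apply/eqP; apply: contraT => zy0.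
have [|y [zy ymax]] := max_len fz; first by exists y0.
have my := zm y zy; have zb := top_coef_bar l_gt0 hkl fz zm Zbar my ymax.
case/eqP: zy; move: zb; rewrite /z asboolT // mul1r /act_coef.
case: asboolP => mys; last first.
  have c0 : c (y * s)%g = 0 by apply/eqP; apply: contraT => /cm.
  have yx : y <> x by move=> e; apply: mys; rewrite e.
  (* here z y = - (v + v^-1) c y, and the factor v + v^-1 is bar-invariant *)
  rewrite c0 add0r -opprD mulrN lbarN lbarM lbarD !lbar_vpow opprK.
  rewrite [vpow (-1) + _]addrC => /oppr_inj e.
  have v0 : vpow 1 + vpow (-1) != 0.
    apply/eqP => /(congr1 (fun f => lcoef f 1)).
    by rewrite lcoefD !lcoef_vpow lcoef0.
  have cb : lbar (c y) = c y by apply: (laurent_mulfI v0); rewrite mulrC e mulrC.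
  have -> : c y = 0 by exact: in_vZv_bar_eq0 (kl_small hkl mx yx) cb.
  by rewrite mul0r oppr0.
have [e|e] := len_Sr_cases l_gt0 y Ss.
  (* the coefficient at y s is -v times the one at y, and y s is longer *)
  rewrite e ltnSn sub0r mulrN => _; apply/eqP; apply: contraT => nz.
  have : z (y * s)%g != 0.
    have yss : (y * s * s)%g = y by exact: affS_mulK.
    have -> : z (y * s)%g = c y - c (y * s)%g * vpow 1.
      rewrite /z /act_coef yss (asboolT mys) (asboolT my) e ltnNge leqnSn /=.
      by rewrite mul1r addrAC subrr add0r mulrN.
    apply: contra nz => /eqP h; apply/eqP.
    have -> : c (y * s)%g = vpow (-1) * (c (y * s)%g * vpow 1).
      by rewrite mulrCA vpowNK mulr1.
    have /eqP := h; rewrite subr_eq0 => /eqP <-.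
    by rewrite [vpow (-1) * _]mulrC subrr.
  by move=> /ymax; rewrite e ltnn.
rewrite [len y in X in if X then _ else _]e ltnNge leqnSn /= addrAC subrr add0r mulrN.
move=> zb; apply: in_vZv_bar_eq0 zb; apply: in_vZvD.
  have ysx : (y * s)%g <> x.
    by move=> ysx; have := xs; rewrite -ysx affS_mulK //; lia.
  exact: (kl_small hkl mx ysx).
apply: in_vZvN; rewrite mulrC; have [->|/eqP yx] := eqVneq y x.
  by rewrite /c (kl_diag hkl mx) mulr1; exact: in_vZv_v.
by apply: in_vZv_vM; exact: (kl_small hkl mx yx).
Qed.

Lemma KL_descent_leave x s y : S s -> min_rep x -> len x = (len (x * s)%g).+1 ->
  min_rep y -> ~ min_rep (y * s)%g -> kl y x = 0.
Proof.
move=> Ss mx xs my mys; have := KL_descent_eq0 Ss mx xs y.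
have -> : kl (y * s)%g x = 0.
  by apply/eqP; apply: contraT => /(kl_neq0 hkl mx)[].
rewrite mulr0 add0r /act_coef asboolF // => /laurent_mulf_eq0[//|].
move=> /(congr1 (fun f => lcoef f 1)).
by rewrite lcoefB lcoefN !lcoef_vpow lcoef0.
Qed.

Lemma KL_descent_mul x s y : S s -> min_rep x -> len x = (len (x * s)%g).+1 ->
    min_rep y -> min_rep (y * s)%g ->
  vpow (len y) * kl y x = vpow (len (y * s)%g) * kl (y * s)%g x.
Proof.
move=> Ss mx xs; wlog e : y / len (y * s)%g = (len y).+1.
  move=> hw my mys; have [e|e] := len_Sr_cases l_gt0 y Ss; first exact: hw.
  by rewrite (hw (y * s)%g) ?affS_mulK.
move=> my mys; have := KL_descent_eq0 Ss mx xs y.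
rewrite asboolT // mul1r /act_coef asboolT // e ltnSn sub0r mulrN => /eqP.
rewrite subr_eq0 => /eqP ->.
have -> : (len y).+1%:Z = (len y)%:Z + 1 by lia.
by rewrite vpowD -mulrA [kl _ _ * _]mulrC [vpow 1 * _]mulrA vpowKN mul1r.
Qed.

(** If x is maximal in its coset of the stabiliser of f, then x s < x for every simple
    reflection s of that stabiliser, so the descent relations determine the coefficients
    of KL_x along the cosets. *)
Section Coset.
Variables (f y0 : V).
Hypotheses (sf : spec f bpt) (Cy0 : chamber rs y0) (y0f : ue y0 f = y0).
Let x := ue y0.

Let mx : min_rep x. Proof. exact: ue_min. Qed.

Let xs s : S s -> s f = f -> len x = (len (x * s)%g).+1.
Proof. by move=> Ss sff; exact: (ue_max l_gt0 Cy0 sf y0f Ss sff). Qed.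

Lemma kl_coset g : chamber rs (g f) ->
  vpow (len g) * kl g x = vpow (len (ue (g f))) * kl (ue (g f)) x.
Proof.
move=> Cg; have gu : (g^-1 * ue (g f))%g f = f.
  by rewrite affWM_val (ue_stab l_gt0 sf erefl) affWVK.
have min g' : g' f = g f -> min_rep g'.
  by move=> e; apply/(min_repP l_gt0); case: (len_ue l_gt0 Cg sf e).
suff : forall u, u f = f -> forall g', g' f = g f ->
    vpow (len g') * kl g' x = vpow (len (g' * u)%g) * kl (g' * u)%g x.
  by move=> /(_ _ gu g erefl); rewrite mulgA mulgV mul1g.
apply: (stab_ind l_gt0 sf) => [g' _|s u Ss sff _ _ IH g' g'f]; first by rewrite mulg1.
have g'sf : (g' * s)%g f = g f by rewrite affWM_val sff.
rewrite (KL_descent_mul Ss mx (xs Ss sff) (min _ g'f) (min _ g'sf)).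
by rewrite (IH _ g'sf) mulgA.
Qed.

(** A coset around a point on a wall of the chamber contains alcoves outside the chamber;
    along a path to such an alcove the coefficients are proportional until the chamber is
    left, where they vanish. *)
Lemma kl_coset_wall g : min_rep g -> ~ chamber rs (g f) -> kl g x = 0.
Proof.
move=> mg nC; have /(min_repP l_gt0) Cg := mg.
have sg : spec (g f) (g bpt) by exact: spec_aff.
have [i gi] : exists i, dot rs (g f) (simple rs i) = 0.
  apply: contrapT => no; apply: nC => i; rewrite lt_def; apply/andP; split.
    by apply/eqP => e; apply: no; exists i.
  by have := sg (simple rs i) 0 (simple_root rs i); rewrite mul0r; apply; exact: ltW.
have si := simple_root rs i; pose s' := arefl rs l (simple rs i) 0.
have s'g : s' (g f) = g f by apply: arefl_fix => //; rewrite gi mul0r.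
have uf : (g^-1 * (s' * g))%g f = f by rewrite !affWM_val s'g affWVK.
have : ~ min_rep (g * (g^-1 * (s' * g)))%g.
  rewrite mulgA mulgV mul1g => /(min_repP l_gt0)/(_ i); have := Cg i.
  by rewrite affWM_val dot_arefl_self // mul0r addr0 sub0r oppr_gt0 => /lt_gtF ->.
move: {uf}(_ * _)%g uf.
suff : forall u, u f = f -> forall g', min_rep g' -> ~ min_rep (g' * u)%g -> kl g' x = 0.
  by move=> h u uf /h; apply.
apply: (stab_ind l_gt0 sf) => [g' mg'|s u Ss sff _ _ IH g' mg']; first by rewrite mulg1.
rewrite mulgA => ngu; have [mgs|mgs] := pselect (min_rep (g' * s)%g); last first.
  exact: KL_descent_leave Ss mx (xs Ss sff) mg' mgs.
have := KL_descent_mul Ss mx (xs Ss sff) mg' mgs; rewrite (IH _ mgs ngu) mulr0.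
move=> /(congr1 (fun z => vpow (- (len g')%:Z) * z)).
by rewrite mulrA vpowNK mul1r mulr0.
Qed.

End Coset.

(** ** The symmetriser of a point stabiliser *)

Section Symmetriser.
Variable f : V.
Hypothesis sf : spec f bpt.

Definition stab_seq : seq affW := fset_set [set u : affW | u f = f].

Lemma stab_seq_uniq : uniq stab_seq. Proof. exact: fset_uniq. Qed.

Lemma mem_stab_seq u : (u \in stab_seq) = (u f == f).
Proof.
rewrite in_fset_set; last exact: stab_finite.
by apply/idP/eqP => [/set_mem //|uf]; apply: mem_set.
Qed.

Definition symm : Hk := \sum_(u <- stab_seq) vpow (- (len u)%:Z) *: H u.

(** The Poincare polynomial of the stabiliser. *)
Definition poinc : laurent := \sum_(u <- stab_seq) vpow (len u + len u)%N.

Lemma poinc_neq0 : poinc != 0.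
Proof.
apply/eqP => /(congr1 (fun p => lcoef p 0)); rewrite lcoef0 /poinc lcoef_sum.
rewrite (bigD1_seq 1%g) ?stab_seq_uniq ?mem_stab_seq ?affW1_val //=.
rewrite lcoef_vpow (clength1 (affS_gen l_gt0)) eqxx big1 // => u u1.
rewrite lcoef_vpow; case: eqP => // e; case/eqP: u1.
by apply: (clength_eq0 (affS_gen l_gt0)); lia.
Qed.

Lemma stab_S_l s u : S s -> s f = f -> u \in stab_seq -> (s * u)%g \in stab_seq.
Proof. by move=> Ss sff; rewrite !mem_stab_seq affWM_val => /eqP ->; exact/eqP. Qed.

Lemma stab_S_r s u : S s -> s f = f -> u \in stab_seq -> (u * s)%g \in stab_seq.
Proof. by move=> Ss sff; rewrite !mem_stab_seq affWM_val sff. Qed.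

Let coefE (k k' : nat) : k' = k.+1 \/ k = k'.+1 ->
  vpow (- k'%:Z) + (if (k' < k)%N then vpow (-1) - vpow 1 else 0) * vpow (- k%:Z) =
  vpow (-1) * vpow (- k%:Z).
Proof.
move=> [->|->].
  rewrite ltnNge leqnSn mul0r addr0 -vpowD; congr vpow; lia.
rewrite leqnn mulrBl -!vpowD; have -> : (1 + - k'.+1%:Z) = - k'%:Z by lia.
by rewrite addrCA subrr addr0.
Qed.

Lemma symm_S_l s : S s -> s f = f -> H s * symm = vpow (-1) *: symm.
Proof.
move=> Ss sff; rewrite /symm mulr_sumr scaler_sumr.
transitivity (\sum_(u <- stab_seq) (vpow (- (len u)%:Z) *: H (s * u)%g +
    ((if (len (s * u)%g < len u)%N then vpow (-1) - vpow 1 else 0)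
      * vpow (- (len u)%:Z)) *: H u)).
  apply: eq_bigr => u _; rewrite -scalerAr; have [e|e] := len_S_cases l_gt0 u Ss.
    by rewrite e ltnNge leqnSn mul0r scale0r addr0 S_H_up.
  have -> : (len (s * u)%g < len u)%N by rewrite e.
  by rewrite S_H_down // scalerDr [_ * vpow _]mulrC scalerA.
rewrite big_split /= (perm_big (map (fun u => (s * u)%g) stab_seq)) /=; last first.
  apply: uniq_perm; rewrite ?stab_seq_uniq ?map_inj_uniq ?stab_seq_uniq //; first exact: mulgI.
  move=> u; apply/idP/mapP => [us|[w ws ->]]; last exact: stab_S_l.
  by exists (s * u)%g; [exact: stab_S_l | rewrite affS_Kmul].
rewrite big_map -big_split /=; apply: eq_bigr => u _.
rewrite affS_Kmul // -scalerDl scalerA; congr (_ *: _); apply: coefE.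
exact: len_S_cases.
Qed.

Lemma symm_S_r s : S s -> s f = f -> symm * H s = vpow (-1) *: symm.
Proof.
move=> Ss sff; rewrite /symm mulr_suml scaler_sumr.
transitivity (\sum_(u <- stab_seq) (vpow (- (len u)%:Z) *: H (u * s)%g +
    ((if (len (u * s)%g < len u)%N then vpow (-1) - vpow 1 else 0)
      * vpow (- (len u)%:Z)) *: H u)).
  apply: eq_bigr => u _; rewrite -scalerAl; have [e|e] := len_Sr_cases l_gt0 u Ss.
    by rewrite e ltnNge leqnSn mul0r scale0r addr0 H_S_up.
  have -> : (len (u * s)%g < len u)%N by rewrite e.
  by rewrite H_S_down // scalerDr [_ * vpow _]mulrC scalerA.
rewrite big_split /= (perm_big (map (fun u => (u * s)%g) stab_seq)) /=; last first.
  apply: uniq_perm; rewrite ?stab_seq_uniq ?map_inj_uniq ?stab_seq_uniq //; first exact: mulIg.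
  move=> u; apply/idP/mapP => [us|[w ws ->]]; last exact: stab_S_r.
  by exists (u * s)%g; [exact: stab_S_r | rewrite affS_mulK].
rewrite big_map -big_split /=; apply: eq_bigr => u _.
rewrite affS_mulK // -scalerDl scalerA; congr (_ *: _); apply: coefE.
exact: len_Sr_cases.
Qed.

Lemma symm_l u : u f = f -> H u * symm = vpow (- (len u)%:Z) *: symm.
Proof.
move: u; apply: (stab_ind l_gt0 sf) => [|s u Ss sff _ e IH].
  by rewrite H1 // mul1r (clength1 (affS_gen l_gt0)) oppr0 vpow0 scale1r.
rewrite -(S_H_up l_gt0 Hk Ss e) -mulrA IH -scalerAr symm_S_l // scalerA -vpowD e.
by congr (vpow _ *: _); lia.
Qed.

Lemma symm_r u : u f = f -> symm * H u = vpow (- (len u)%:Z) *: symm.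
Proof.
move: u; apply: (stab_ind l_gt0 sf) => [|s u Ss sff _ e IH].
  by rewrite H1 // mulr1 (clength1 (affS_gen l_gt0)) oppr0 vpow0 scale1r.
rewrite -(S_H_up l_gt0 Hk Ss e) mulrA symm_S_r // -scalerAl IH scalerA -vpowD e.
by congr (vpow _ *: _); lia.
Qed.

Lemma stabV u : u f = f -> (u^-1)%g f = f.
Proof. by move=> uf; rewrite -{1}uf affWVK. Qed.

Lemma barsymm_l u : u f = f -> H u * bar symm = vpow (- (len u)%:Z) *: bar symm.
Proof.
move=> uf; have := congr1 bar (symm_l (stabV uf)).
rewrite hk_barM hk_barZ lbar_vpow opprK len_V // => e.
have [_] := hk_barH Hk (u^-1)%g; rewrite invgK => b2.
have /(congr1 (fun z => H u * z)) := e; rewrite mulrA b2 mul1r -scalerAr => E.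
by rewrite [in RHS]E scalerA vpowNK scale1r.
Qed.

Lemma barsymm_r u : u f = f -> bar symm * H u = vpow (- (len u)%:Z) *: bar symm.
Proof.
move=> uf; have := congr1 bar (symm_r (stabV uf)).
rewrite hk_barM hk_barZ lbar_vpow opprK len_V // => e.
have [b1 _] := hk_barH Hk (u^-1)%g; rewrite invgK in b1.
have /(congr1 (fun z => z * H u)) := e; rewrite -mulrA b1 mulr1 -scalerAl => E.
by rewrite [in RHS]E scalerA vpowNK scale1r.
Qed.

Lemma bar_H_symm u : u f = f -> bar (H u) * symm = vpow (len u) *: symm.
Proof.
move=> uf; have := symm_l (stabV uf); rewrite len_V // => e.
have [b1 _] := hk_barH Hk u.
have /(congr1 (fun z => bar (H u) * z)) := e; rewrite mulrA b1 mul1r -scalerAr => E.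
by rewrite [in RHS]E scalerA vpowKN scale1r.
Qed.

(** The symmetriser is self-dual up to a scalar; computing its product with its
    image under the involution in two ways gives that scalar as a quotient of
    Poincare polynomials. *)
Lemma poinc_symm : poinc *: symm = lbar poinc *: bar symm.
Proof.
transitivity (bar symm * symm).
  rewrite {2}/symm bar_sum mulr_suml /poinc scaler_suml big_seq [RHS]big_seq.
  apply: eq_bigr => u; rewrite mem_stab_seq => /eqP uf.
  by rewrite hk_barZ lbar_vpow opprK -scalerAl bar_H_symm // scalerA -vpowD.
rewrite {2}/symm mulr_sumr /poinc lbar_sum scaler_suml big_seq [RHS]big_seq.
apply: eq_bigr => u; rewrite mem_stab_seq => /eqP uf.
rewrite -scalerAr barsymm_r // scalerA lbar_vpow -vpowD.
by congr (vpow _ *: _); lia.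
Qed.

(** H_g bar E depends on the coset of g only up to the power v^l(g). *)
Lemma H_barsymm_coset g u : u f = f ->
  vpow (len g) *: (H g * bar symm) = vpow (len (g * u)%g) *: (H (g * u)%g * bar symm).
Proof.
move=> uf; move: u uf g; apply: (stab_ind l_gt0 sf) => [g|s u Ss sff _ _ IH g].
  by rewrite mulg1.
rewrite mulgA -IH.
have up w : len (w * s)%g = (len w).+1 ->
    vpow (len w) *: (H w * bar symm) = vpow (len (w * s)%g) *: (H (w * s)%g * bar symm).
  move=> e; rewrite -(H_S_up l_gt0 Hk Ss e) -mulrA (barsymm_l sff) (len_S l_gt0 Ss).
  rewrite -scalerAr scalerA -vpowD e; congr (vpow _ *: _); lia.
have [e|e] := len_Sr_cases l_gt0 g Ss; first exact: up.
by have := up (g * s)%g; rewrite affS_mulK // => /(_ e) ->.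
Qed.

(** The image in the module of the standard basis element of a point p of the
    orbit of f: the sum of the N_g over the alcoves around p. *)
Definition point_coef (p : V) g : laurent :=
  if g f == p then vpow ((len (ue p))%:Z - (len g)%:Z) else 0.

Lemma point_coef_finite p : ue p f = p -> finite_set [set g | point_coef p g != 0].
Proof.
move=> pf; apply: (@sub_finite_set _ _ [set` [seq (ue p * u)%g | u <- stab_seq]]).
  move=> g /=; rewrite /point_coef; case: (eqVneq (g f) p) => [gf _|_]; last by rewrite eqxx.
  apply/mapP; exists ((ue p)^-1 * g)%g; last by rewrite mulgA mulgV mul1g.
  rewrite mem_stab_seq affWM_val gf; apply/eqP.
  by apply: (can_inj (affWVK (ue p))); rewrite affWKV pf.
exact: finite_seq.
Qed.

(** As bar E absorbs the H_u of the stabiliser up to powers of v, the claim reduces to the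
    longest g of the coset, where H_g bar H_u = H_(g u). *)
Lemma nb_barsymm g : chamber rs (g f) ->
  T (H g * bar symm) = vpow ((len (ue (g f)))%:Z - (len g)%:Z) *: lcomb nb (point_coef (g f)).
Proof.
move=> Cp; set p := g f in Cp *; set M := ue p.
have Mf : M f = p by exact: (ue_stab l_gt0 sf erefl).
have gM : (g^-1 * M)%g f = f by rewrite affWM_val Mf affWVK.
have := H_barsymm_coset g gM; rewrite mulgA mulgV mul1g.
move=> /(congr1 (fun z => vpow (- (len g)%:Z) *: z)).
rewrite !scalerA vpowNK scale1r -vpowD => ->; rewrite linearZ /= addrC; congr (_ *: _).
pose r := [seq (M * u)%g | u <- stab_seq].
have ur : uniq r by rewrite map_inj_uniq ?stab_seq_uniq //; exact: mulgI.
rewrite (@lcomb_seq _ _ _ nb _ r) //; last first.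
  move=> h; rewrite /point_coef; case: (eqVneq (h f) p) => [hf _|_]; last by rewrite eqxx.
  apply/mapP; exists (M^-1 * h)%g; last by rewrite mulgA mulgV mul1g.
  by rewrite mem_stab_seq affWM_val hf -{1}Mf affWVK.
rewrite /symm bar_sum mulr_sumr linear_sum big_map big_seq [RHS]big_seq.
apply: eq_bigr => u; rewrite mem_stab_seq => /eqP uf.
have Muf : (M * u)%g f = p by rewrite affWM_val uf.
have [_] := len_ue l_gt0 Cp sf Muf; rewrite invgM -mulgA mulVg mulg1 => e.
rewrite /point_coef Muf eqxx hk_barZ lbar_vpow opprK -scalerAr linearZ /=.
rewrite /M e len_V // PoszD addrAC subrr add0r; congr (_ *: T _).
have <- : H (M * u)%g * H (u^-1)%g = H M.
  by rewrite hk_mul ?mulgK // len_V.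
have [_ b2] := hk_barH Hk u.
by rewrite -mulrA b2 mulr1.
Qed.

(** The reflection s in a wall of the chamber through g f acts on the left by the scalar -v,
    while s g lies in the coset of g and so gives the same element up to v^-1. *)
Lemma nb_barsymm_wall g : min_rep g -> ~ chamber rs (g f) -> T (H g * bar symm) = 0.
Proof.
move=> mg nC; have /(min_repP l_gt0) Cg := mg.
have sg : spec (g f) (g bpt) by exact: spec_aff.
have [i gi] : exists i, dot rs (g f) (simple rs i) = 0.
  apply: contrapT => no; apply: nC => i; rewrite lt_def; apply/andP; split.
    by apply/eqP => e; apply: no; exists i.
  by have := sg (simple rs i) 0 (simple_root rs i); rewrite mul0r; apply; exact: ltW.
have si := simple_root rs i; pose s := arefl rs l (simple rs i) 0.
have Ss : S s by apply: wall_affS => //; left; exists i.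
have Ws : finW s by exact: arefl_finW.
have sgf : s (g f) = g f by apply: arefl_fix => //; rewrite gi mul0r.
have uf : (g^-1 * (s * g))%g f = f by rewrite !affWM_val sgf affWVK.
have e : len (s * g)%g = (len g).+1 by rewrite (len_finW_min l_gt0 Ws Cg) (len_S l_gt0 Ss) add1n.
have := H_barsymm_coset g uf; rewrite mulgA mulgV mul1g e => /(congr1 T).
rewrite !linearZ /= -(S_H_up l_gt0 Hk Ss e) -mulrA (ind_tens_S N _ Ss Ws).
have -> : (len g).+1%:Z = (len g)%:Z + 1 by lia.
set m := T _; rewrite vpowD => h.
apply: (@torsion_free (vpow (len g) * (1 + vpow 1 * vpow 1))); last first.
  have -> : (vpow (len g) * (1 + vpow 1 * vpow 1)) *: m =
      vpow (len g) *: m - (vpow (len g) * vpow 1) *: (- vpow 1 *: m).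
    by rewrite scalerA -scalerBl; congr (_ *: _); ring.
  by rewrite -h subrr.
apply/eqP => /(congr1 (fun p => lcoef p (len g))).
by rewrite lcoef_vpowM subrr -vpowD lcoefD lcoef1 lcoef_vpow lcoef0.
Qed.

End Symmetriser.

End Descents.

(** * The module of points and the operator P *)

Section PointModule.
Variables (R : realType) (n : nat) (rs : root_system R n) (l : nat).
Hypothesis l_gt0 : (0 < l)%N.
Local Notation V := 'rV[R]_n.
Local Notation affW := (affW rs l).
Local Notation len := (clength (affS rs l)).
Local Notation bpt := (bpt rs l).
Local Notation ue := (ue rs l).
Local Notation spec := (spec rs l).
Local Notation rho := (rho rs).
Local Notation dominant := (dominant rs).
Local Notation linked := (linked rs l).
Variables (Hk : hecke_algebra (affS rs l)) (N : induced_sign (finW rs l) Hk).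
Variables (kl : affW -> affW -> laurent).
Hypothesis hkl : is_kl_family N kl.
Local Notation uN := (uN (rs := rs) (l := l) kl).
Local Notation npt := (npt (rs := rs) (l := l) kl).
Local Notation pm := (pointmod rs).
Local Notation point_lt := (point_lt rs l).
Implicit Types (lam mu nu kap : V) (m : pm) (g w : affW).

Definition el mu : affW := ue (mu + rho).

Lemma linkedP lam mu : linked lam mu <-> exists w : affW, w (mu + rho) = lam + rho.
Proof.
split=> [[w Ww ->]|[w wE]].
  by exists (AffW (asboolT Ww)); rewrite /= subrK.
by exists w; [exact: affWP | rewrite wE addrK].
Qed.

Lemma linked_refl mu : linked mu mu.
Proof. by apply/linkedP; exists 1%g. Qed.

Lemma linked_trans mu lam nu : linked lam mu -> linked mu nu -> linked lam nu.
Proof.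
move=> /linkedP[w wE] /linkedP[g gE]; apply/linkedP; exists (w * g)%g.
by rewrite affWM_val gE wE.
Qed.

(** The representative of mu + rho in the closed fundamental alcove. *)
Definition base_point mu : V := (el mu)^-1%g (mu + rho).

Lemma base_point_spec mu : spec (base_point mu) bpt.
Proof.
rewrite -[X in spec _ X](affWVK (el mu)); apply: spec_aff; exact: spec_ue.
Qed.

Lemma el_base_point mu : el mu (base_point mu) = mu + rho.
Proof. exact: affWKV. Qed.

Lemma base_point_linked lam mu : linked lam mu -> base_point lam = base_point mu.
Proof.
move=> /linkedP[w wE].
apply: (fund_domain l_gt0 (w := ((el mu)^-1 * w^-1 * el lam)%g)); try exact: base_point_spec.
by rewrite affWM_val el_base_point -wE affWM_val affWVK.
Qed.

Lemma linked_el_eq lam mu : linked lam mu -> el lam = el mu -> lam = mu.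
Proof.
move=> lm e; have := el_base_point lam; rewrite e (base_point_linked lm) el_base_point.
by move/addIr.
Qed.

Lemma point_ltE lam mu : point_lt lam mu <->
  [/\ dominant lam, dominant mu, linked lam mu & bruhat_lt (affS rs l) (el lam) (el mu)].
Proof.
split=> [[dl dm lm]|[dl dm lm]]; first by rewrite !(alcove_elt_point l_gt0).
by move=> h; split=> //; rewrite !(alcove_elt_point l_gt0).
Qed.

Lemma point_lt_len lam mu : point_lt lam mu -> (len (el lam) < len (el mu))%N.
Proof. by move=> /point_ltE[_ _ _ [/bruhat_length[]]]. Qed.

Lemma point_lt_trans mu lam nu : point_lt lam mu -> point_lt mu nu -> point_lt lam nu.
Proof.
move=> h1 h2; have := point_lt_len h1; have := point_lt_len h2.
move: h1 h2 => /point_ltE[dl _ lm [b1 _]] /point_ltE[_ dn mn [b2 _]] k1 k2.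
apply/point_ltE; split=> //; first exact: linked_trans mn.
split; first exact: bruhat_trans b2.
by move=> e; move: k1 k2; rewrite e; lia.
Qed.

Lemma nptE lam mu : dominant lam -> dominant mu ->
  npt lam mu = if `[< linked lam mu >] then kl (el lam) (el mu) else 0.
Proof. by move=> dl dm; rewrite /Defs.npt /nkl !(alcove_elt_point l_gt0). Qed.

Lemma el_min mu : dominant mu -> min_rep (affS rs l) (finW rs l) (el mu).
Proof. exact: ue_min. Qed.

Lemma npt_el lam mu : dominant lam -> dominant mu -> npt lam mu != 0 ->
  linked lam mu /\ kl (el lam) (el mu) != 0.
Proof.
move=> dl dm; rewrite (nptE dl dm); case: asboolP => [lm nz|_]; first by split.
by rewrite eqxx.
Qed.

Lemma npt_finite mu : dominant mu ->
  finite_set [set lam | dominant lam /\ npt lam mu != 0].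
Proof.
move=> dm; have fk := kl_finite hkl (el_min dm).
apply: (@sub_finite_set _ _ [set` [seq g (base_point mu) - rho | g <- suppseq (kl^~ (el mu))]]).
  move=> lam [dl /(npt_el dl dm)[lm nz]] /=; apply/mapP; exists (el lam).
    by rewrite mem_suppseq.
  by rewrite -(base_point_linked lm) el_base_point addrK.
exact: finite_seq.
Qed.

Lemma uNE mu lam : dominant mu ->
  (uN mu) lam = if `[< dominant lam >] then npt lam mu else 0.
Proof.
move=> dm; pose r := fset_set [set lam | dominant lam /\ npt lam mu != 0] : seq V.
have rE kap : (kap \in r) <-> dominant kap /\ npt kap mu != 0.
  rewrite in_fset_set; last exact: npt_finite.
  by split=> [/set_mem|h] //; exact: mem_set.
rewrite /Defs.uN (@fsum_comb _ _ _ _ _ _ r) ?fset_uniq //; last 2 first.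
- by move=> kap /rE[].
- by move=> kap dk nz; apply/rE.
rewrite fmE_sum; under eq_bigr do rewrite fmEZ.
transitivity (\sum_(kap <- r) npt kap mu * (lam == kap)%:R).
  rewrite big_seq [RHS]big_seq; apply: eq_bigr => kap /rE[dk _].
  by rewrite /Npt fmbasisE.
have [lr|nlr] := boolP (lam \in r); last first.
  rewrite big1_seq.
    case: asboolP => // dl; apply/esym/eqP; apply: contraR nlr => nz; exact/rE.
  move=> kap /= kr; case: (eqVneq lam kap) => [e|_]; last by rewrite mulr0.
  by move: nlr; rewrite e kr.
have [dl _] := (rE lam).1 lr; rewrite asboolT // (bigD1_seq lam) ?fset_uniq //= eqxx mulr1.
rewrite big1 ?addr0 // => kap; rewrite eq_sym => /negbTE ->; by rewrite mulr0.
Qed.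

Lemma uN_diag mu : dominant mu -> (uN mu) mu = 1.
Proof.
move=> dm; rewrite uNE // asboolT // nptE // asboolT; last exact: linked_refl.
exact: kl_diag hkl _ (el_min dm).
Qed.

Lemma uN_neq0 mu lam : dominant mu -> (uN mu) lam != 0 -> lam = mu \/ point_lt lam mu.
Proof.
move=> dm; rewrite uNE //; case: asboolP => [dl|]; last by rewrite eqxx.
move=> /(npt_el dl dm)[lm /(kl_neq0 hkl (el_min dm))[_ ble]].
have [e|ne] := pselect (el lam = el mu); first by left; exact: linked_el_eq.
by right; apply/point_ltE; split.
Qed.

Lemma uN_small mu lam : dominant mu -> lam <> mu -> in_vZv ((uN mu) lam).
Proof.
move=> dm lm; rewrite uNE //; case: asboolP => [dl|_]; last exact: in_vZv0.
rewrite nptE //; case: asboolP => [link|_]; last exact: in_vZv0.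
apply: (kl_small hkl (el_min dm)) => e; apply: lm; exact: linked_el_eq.
Qed.

(** ** Coordinates with respect to the self-dual basis *)

(** The coefficient families that define an element of the module. *)
Definition fdom (c : V -> laurent) :=
  finite_set [set mu | c mu != 0] /\ [set mu | c mu != 0] `<=` dominant.

Lemma fdom_fm m : fdom m.
Proof. by split; [exact: fm_finite | move=> mu; exact: fm_dom]. Qed.

Lemma ucombE (A : set V) c : fdom c -> [set mu | c mu != 0] `<=` A ->
  \sum_(mu \in A) c mu *: uN mu = lcomb uN c.
Proof.
move=> [fc _] cA; rewrite lcomb_suppE //; apply: fsum_comb; first exact: suppseq_uniq.
  by move=> mu; rewrite mem_suppseq // => /cA.
by move=> mu _; rewrite mem_suppseq.
Qed.

Lemma ucomb_eval c lam : finite_set [set mu | c mu != 0] ->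
  (lcomb uN c) lam = \sum_(mu <- suppseq c) c mu * (uN mu) lam.
Proof. by move=> fc; rewrite lcomb_suppE // fmE_sum. Qed.

Lemma max_point c : fdom c -> (exists mu, c mu != 0) ->
  exists mu, c mu != 0 /\ forall lam, c lam != 0 -> (len (el lam) <= len (el mu))%N.
Proof.
move=> [fc _] [mu0 c0]; pose P k := `[< exists mu, c mu != 0 /\ len (el mu) = k >].
have exP : exists k, P k by exists (len (el mu0)); apply/asboolP; exists mu0.
pose B := \max_(mu <- suppseq c) len (el mu).
have bnd mu : c mu != 0 -> (len (el mu) <= B)%N.
  by move=> cm; apply: leq_bigmax_seq => //; rewrite mem_suppseq.
have PB k : P k -> (k <= B)%N by move=> /asboolP[mu [cm <-]]; exact: bnd.
case: (ex_maxnP exP PB) => k /asboolP[mu [cm mk]] kmax; exists mu; split=> // lam cl.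
by rewrite mk; apply: kmax; apply/asboolP; exists lam.
Qed.

(** The uN of the other points of the support do not reach mu, which would have to be
    shorter than they are. *)
Lemma ucomb_top c mu : fdom c -> c mu != 0 ->
  (forall lam, c lam != 0 -> (len (el lam) <= len (el mu))%N) ->
  (lcomb uN c) mu = c mu.
Proof.
move=> [fc dc] cm mmax; rewrite ucomb_eval // (bigD1_seq mu) ?suppseq_uniq //=; last first.
  by rewrite mem_suppseq.
rewrite uN_diag ?mulr1; last exact: dc.
rewrite big_seq_cond big1 ?addr0 // => lam /andP[]; rewrite mem_suppseq // => cl lm.
apply/eqP; apply: contraT => nz.
have /(uN_neq0 (dc _ cl))[e|/point_lt_len] : (uN lam) mu != 0.
  by apply: contra nz => /eqP ->; rewrite mulr0.
  by rewrite e eqxx in lm.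
by have := mmax lam cl; rewrite leqNgt => /negbTE ->.
Qed.

Lemma ucomb_eq0 c : fdom c -> lcomb uN c = 0 -> c = fun=> 0.
Proof.
move=> fc c0; apply: funext => mu; apply/eqP; apply: contraT => cm.
have [|nu [cn nmax]] := max_point fc; first by exists mu.
by have e := ucomb_top fc cn nmax; move: cn; rewrite -e c0 eqxx.
Qed.

Lemma fdomD c c' : fdom c -> fdom c' -> fdom (fun mu => c mu + c' mu).
Proof.
move=> [fc dc] [fc' dc']; split; first exact: (lcomb_addf fc fc').
move=> mu /=; case: (eqVneq (c mu) 0) => [->|/dc //]; rewrite add0r; exact: dc'.
Qed.

Lemma fdomM (a : V -> laurent) c : fdom c -> fdom (fun mu => a mu * c mu).
Proof.
move=> [fc dc]; split; first exact: (scalef_finite a fc).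
by move=> mu /= h; apply: dc => /=; apply: contra h => /eqP ->; rewrite mulr0.
Qed.

Lemma fdomN c : fdom c -> fdom (fun mu => - c mu).
Proof.
move=> fc; have := fdomM (fun=> -1) fc; congr fdom; apply: funext => mu.
by rewrite mulN1r.
Qed.

Lemma ucombN c : fdom c -> lcomb uN (fun mu => - c mu) = - lcomb uN c.
Proof.
move=> [fc _]; rewrite -scaleN1r -(lcombZ uN (-1) fc); apply: lcomb_ext => mu.
by rewrite mulN1r.
Qed.

Lemma fdom_delta mu : dominant mu -> fdom (fun x => (x == mu)%:R).
Proof.
move=> dm; split; first exact: delta_finite.
by move=> x /=; case: (eqVneq x mu) => [->|]; rewrite ?eqxx.
Qed.

Lemma uN_coord_uN mu : dominant mu ->
  uN_coord (rs := rs) (l := l) kl (uN mu) = fun x => (x == mu)%:R.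
Proof.
move=> dm; have fd := fdom_delta dm; rewrite /uN_coord; case: xgetP => [c _ [fc dc e]|h].
  have fdc : fdom c := conj fc dc.
  rewrite ucombE // in e.
  have : lcomb uN (fun x => c x + - (x == mu)%:R) = 0.
    rewrite (lcombD uN fc (fdomN fd).1) (ucombN fd) lcomb1 -e; exact: subrr.
  move=> /(ucomb_eq0 (fdomD fdc (fdomN fd))) h; apply: funext => x.
  by apply/eqP; rewrite -subr_eq0 (congr1 (fun f => f x) h).
case: (h (fun x => (x == mu)%:R)); split; [exact: fd.1 | exact: fd.2 |].
by rewrite ucombE //; [rewrite lcomb1 | exact: fd.2].
Qed.

Lemma uN_linear_uN (F : V -> pm) mu : dominant mu ->
  uN_linear (rs := rs) (l := l) kl F (uN mu) = F mu.
Proof.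
move=> dm; rewrite /uN_linear uN_coord_uN // (@fsum_comb _ _ _ _ _ _ [:: mu]) //.
- by rewrite big_seq1 eqxx scale1r.
- by move=> x; rewrite inE => /eqP ->.
- by move=> x _; rewrite inE; case: (eqVneq x mu) => //; rewrite eqxx.
Qed.

Lemma self_dualP m : self_dual (rs := rs) (l := l) kl m <->
  exists c, [/\ fdom c, forall mu, lbar (c mu) = c mu & m = lcomb uN c].
Proof.
split=> [[c [fc dc cb e]]|[c [[fc dc] cb e]]].
  by exists c; split=> //; rewrite e ucombE.
by exists c; split=> //; rewrite e ucombE.
Qed.

Lemma self_dual_ucomb c : fdom c -> (forall mu, lbar (c mu) = c mu) ->
  self_dual (rs := rs) (l := l) kl (lcomb uN c).
Proof. by move=> fc cb; apply/self_dualP; exists c. Qed.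

Lemma self_dualD m m' : self_dual (rs := rs) (l := l) kl m ->
  self_dual (rs := rs) (l := l) kl m' -> self_dual (rs := rs) (l := l) kl (m + m').
Proof.
move=> /self_dualP[c [fc cb ->]] /self_dualP[c' [fc' cb' ->]].
apply/self_dualP; exists (fun mu => c mu + c' mu); split; first exact: fdomD.
  by move=> mu; rewrite lbarD cb cb'.
by rewrite (lcombD uN fc.1 fc'.1).
Qed.

Lemma self_dualB m m' : self_dual (rs := rs) (l := l) kl m ->
  self_dual (rs := rs) (l := l) kl m' -> self_dual (rs := rs) (l := l) kl (m - m').
Proof.
move=> sm /self_dualP[c [fc cb ->]]; apply: self_dualD => //.
rewrite -ucombN //; apply: self_dual_ucomb; first exact: fdomN.
by move=> mu; rewrite lbarN cb.
Qed.

Lemma self_dual_uN mu : dominant mu -> self_dual (rs := rs) (l := l) kl (uN mu).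
Proof.
move=> dm; rewrite -[uN mu](lcomb1 uN); apply: self_dual_ucomb; first exact: fdom_delta.
by move=> x; case: eqP; rewrite ?lbar1 ?lbar0.
Qed.

(** The coordinate of maximal length is a coefficient, hence both in v Z[v] and fixed by
    the bar involution. *)
Lemma self_dual_small m : self_dual (rs := rs) (l := l) kl m ->
  (forall lam, in_vZv (m lam)) -> m = 0.
Proof.
move=> /self_dualP[c [fc cb ->]] h.
rewrite (_ : c = fun=> 0) ?lcomb0 //; apply: funext => mu.
apply/eqP; apply: contraT => cm; have [|nu [cn nmax]] := max_point fc; first by exists mu.
have := h nu; rewrite (ucomb_top fc cn nmax) => hn.
by rewrite (in_vZv_bar_eq0 hn (cb nu)) eqxx in cn.
Qed.

(** ** The operator P *)

Local Notation Pdom := (Pdom (rs := rs) (l := l) kl).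
Local Notation Pstep := (Pstep (rs := rs) (l := l) kl).

Lemma Pdom_unique nu m : dominant nu -> Pdom nu m ->
  (forall lam, point_lt lam nu -> in_vZv (m lam)) -> m = uN nu.
Proof.
move=> dn [sm mn msupp] small; apply/eqP; rewrite -subr_eq0; apply/eqP.
apply: self_dual_small => [|lam]; first by apply: self_dualB => //; exact: self_dual_uN.
rewrite fmEB; have [->|/eqP ln] := eqVneq lam nu.
  by rewrite mn uN_diag // subrr; exact: in_vZv0.
apply: in_vZvD; last by apply: in_vZvN; exact: uN_small.
have [->|/msupp[//|]] := eqVneq (m lam) 0; first exact: in_vZv0.
exact: small.
Qed.

(** The self-dual factor by which P corrects a lowest term v^i with i <= 0. *)
Definition Pfactor (i : int) : laurent := if i < 0 then vpow i + vpow (- i) else 1.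

Lemma Pfactor_bar i : lbar (Pfactor i) = Pfactor i.
Proof.
by rewrite /Pfactor; case: ifP => _; rewrite ?lbar1 // lbarD !lbar_vpow opprK addrC.
Qed.

Lemma Pfactor_low i j : i <= 0 -> j <= i -> lcoef (Pfactor i) j = (j == i)%:R.
Proof.
rewrite /Pfactor => i0 ji; case: ltrP => h.
  rewrite lcoefD !lcoef_vpow; have -> : (j == - i) = false by lia.
  by rewrite addr0.
by rewrite lcoef1; congr (_%:R); lia.
Qed.

Lemma Pfactor_small i j f : i <= 0 -> j <= i -> in_vZv f -> lcoef (Pfactor i * f) j = 0.
Proof.
rewrite /Pfactor => i0 ji hf; case: ltrP => h; last by rewrite mul1r hf //; lia.
by rewrite mulrDl lcoefD !lcoef_vpowM !hf //; lia.
Qed.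

Definition Pcorr nu (i : int) m : V -> laurent := fun lam =>
  (if `[< point_lt lam nu >] then Pfactor i *~ lcoef (m lam) i else 0).

Lemma Pcorr_fdom nu i m : fdom (Pcorr nu i m).
Proof.
have [fm dm] := fdom_fm m.
have sub lam : Pcorr nu i m lam != 0 -> m lam != 0.
  rewrite /Pcorr; case: asboolP => [_|]; last by rewrite eqxx.
  by apply: contra => /eqP ->; rewrite lcoef0 mulr0z.
by split; [exact: sub_finite_set sub fm | move=> lam /sub /dm].
Qed.

Lemma PstepE nu m : Pstep nu m = if low_exp l nu m <= 0
  then m - lcomb uN (Pcorr nu (low_exp l nu m) m) else m.
Proof.
rewrite /Defs.Pstep; set i := low_exp _ _ _.
have E (c : V -> laurent) : (forall lam, point_lt lam nu -> c lam = Pcorr nu i m lam) ->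
    \sum_(lam \in [set lam | point_lt lam nu]) c lam *: uN lam = lcomb uN (Pcorr nu i m).
  move=> cE; rewrite -(ucombE (A := [set lam | point_lt lam nu])); last 2 first.
  - exact: Pcorr_fdom.
  - by move=> lam /=; rewrite /Pcorr; case: asboolP => //; rewrite eqxx.
  by apply: eq_fsbigr => lam /set_mem h; rewrite cE.
case: (ltrgtP i 0) => h.
- congr (m - _); apply: E => lam ll; rewrite /Pcorr asboolT // /Pfactor h //.
- by [].
- congr (m - _); apply: E => lam ll; rewrite /Pcorr asboolT // /Pfactor h ltxx //.
Qed.

Definition lowb nu (i : int) m := forall lam j, point_lt lam nu ->
  lcoef (m lam) j != 0 -> i <= j.

Lemma lowb_exists nu m : exists d : nat, lowb nu (1 - d%:Z) m.
Proof.
have [B hB] : exists B : nat, forall lam, lam \in suppseq m ->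
    forall j, lcoef (m lam) j != 0 -> `|j| <= B%:Z.
  elim: (suppseq m) => [|lam r [B IH]]; first by exists 0%N.
  have [B' hB'] := lcoef_bounded (m lam); exists (B + B')%N => kap.
  rewrite inE => /orP[/eqP ->|/IH h] j; first by move=> /hB'; lia.
  by move=> /h; lia.
exists B.+1 => lam j _ nz; have : lam \in suppseq m.
  rewrite mem_suppseq; last exact: fm_finite.
  by apply: contra nz => /eqP ->; rewrite lcoef0.
by move=> /hB/(_ j nz); lia.
Qed.

(** A lowest exponent exists because the exponents are bounded below. *)
Lemma low_exp_spec nu m : ~ (forall lam, point_lt lam nu -> in_vZv (m lam)) ->
  [/\ low_exp l nu m <= 0, lowb nu (low_exp l nu m) m &
    exists2 lam, point_lt lam nu & lcoef (m lam) (low_exp l nu m) != 0].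
Proof.
move=> nsmall; have [lam [j [ll j0 nz]]] : exists lam (j : int),
    [/\ point_lt lam nu, j <= 0 & lcoef (m lam) j != 0].
  apply: contrapT => no; apply: nsmall => lam ll j j0; apply/eqP; apply: contraT => nz.
  by case: no; exists lam, j.
have [d hd] := lowb_exists nu m.
pose P k := `[< exists2 kap, point_lt kap nu & lcoef (m kap) (k%:Z + (1 - d%:Z)) != 0 >].
have exP : exists k, P k.
  have h := hd lam j ll nz; exists (absz (j - (1 - Posz d))%R); apply/asboolP; exists lam => //.
  by rewrite (_ : _ + _ = j) //; lia.
have [k /asboolP kP kmin] := ex_minnP exP.
have lowk : lowb nu (k%:Z + (1 - d%:Z)) m.
  move=> kap i kl_ nzi; have h := hd kap i kl_ nzi.
  have : (k <= absz (i - (1 - Posz d))%R)%N.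
    apply: kmin; apply/asboolP; exists kap => //.
    by rewrite (_ : _ + _ = i) //; lia.
  lia.
rewrite /low_exp; case: xgetP => [i _ [[kap kapl kapnz] imin]|h].
  split; [exact: le_trans (imin _ _ ll nz) j0 | by move=> kap' i'; exact: imin |].
  by exists kap.
case: (h (k%:Z + (1 - d%:Z))); split; first by case: kP => kap; exists kap.
by move=> i kap; exact: lowk.
Qed.

(** At the point kap only the correction at kap itself contributes to the exponents up to
    the lowest one, since the other uN have their coefficient at kap in v Z[v]. *)
Lemma Pstep_low nu m : low_exp l nu m <= 0 -> lowb nu (low_exp l nu m) m ->
  lowb nu (low_exp l nu m + 1) (Pstep nu m).
Proof.
move=> i0; rewrite PstepE i0; set i := low_exp _ _ _ in i0 * => low kap j kl_.
apply: contraR => ji; have {}ji : j <= i by lia.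
have [fc dc] := Pcorr_fdom nu i m.
rewrite fmEB lcoefB ucomb_eval // lcoef_sum.
have other lam : lam != kap -> lcoef (Pcorr nu i m lam * (uN lam) kap) j = 0.
  move=> lk; rewrite /Pcorr; case: asboolP => [ll|_]; last by rewrite mul0r lcoef0.
  rewrite mulrzAl lcoefMz Pfactor_small ?mul0r //.
  by case/point_ltE: ll => dl _ _ _; apply: uN_small => //; apply/eqP; rewrite eq_sym.
have E : \sum_(lam <- suppseq (Pcorr nu i m)) lcoef (Pcorr nu i m lam * (uN lam) kap) j =
    lcoef (Pcorr nu i m kap) j.
  have dk : dominant kap by case/point_ltE: kl_.
  have [kr|nkr] := boolP (kap \in suppseq (Pcorr nu i m)).
    rewrite (bigD1_seq kap) ?suppseq_uniq //= uN_diag // mulr1 big1; first by rewrite addr0.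
    move=> lam lk; exact: (other lam lk).
  move: (nkr); rewrite mem_suppseq // negbK => /eqP ->; rewrite lcoef0 big1_seq //.
  move=> lam /= lr; apply: other; apply: contraNneq nkr => <- //.
rewrite E /Pcorr asboolT // lcoefMz Pfactor_low //.
case: (eqVneq j i) => [->|ne]; first by rewrite mul1r subrr.
rewrite mul0r subr0; apply: contraT => nz; have := low kap j kl_ nz; lia.
Qed.

Lemma Pstep_dom nu m : Pdom nu m -> Pdom nu (Pstep nu m).
Proof.
move=> [sm mn msupp]; rewrite PstepE; case: ifP => [i0|_]; last by split.
set i := low_exp _ _ _; have fc := Pcorr_fdom nu i m.
have below_nu lam : Pcorr nu i m lam != 0 -> point_lt lam nu.
  by rewrite /Pcorr; case: asboolP => //; rewrite eqxx.
split.
- apply: self_dualB => //; apply: self_dual_ucomb => // mu.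
  rewrite /Pcorr; case: asboolP => _; last exact: lbar0.
  by rewrite lbarMz Pfactor_bar.
- rewrite fmEB mn ucomb_eval ?big1_seq ?subr0 //; last exact: fc.1.
  move=> lam /=; rewrite mem_suppseq; last exact: fc.1.
  move=> cl; have ll := below_nu _ cl; apply/eqP; apply: contraT => nz.
  have dl : dominant lam by case/point_ltE: ll.
  have /(uN_neq0 dl)[e|ln] : (uN lam) nu != 0.
    by apply: contra nz => /eqP ->; rewrite mulr0.
    by have := point_lt_len ll; rewrite e ltnn.
  by have := point_lt_len (point_lt_trans ln ll); rewrite ltnn.
- move=> kap; rewrite fmEB; have [->|/msupp //] := eqVneq (m kap) 0; rewrite sub0r oppr_eq0.
  rewrite ucomb_eval; last exact: fc.1.
  move=> nz; have [lam lr nzl] : exists2 lam, lam \in suppseq (Pcorr nu i m) &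
      Pcorr nu i m lam * (uN lam) kap != 0.
    apply: contrapT => no; case/eqP: nz; apply: big1_seq => lam /= lr.
    by apply/eqP; apply: contraT => h; case: no; exists lam.
  have cl : Pcorr nu i m lam != 0 by apply: contra nzl => /eqP ->; rewrite mul0r.
  have ll := below_nu _ cl; have dl : dominant lam by case/point_ltE: ll.
  have /(uN_neq0 dl)[->|kl_] : (uN lam) kap != 0.
  + by apply: contra nzl => /eqP ->; rewrite mulr0.
  + by right.
  + by right; exact: point_lt_trans ll.
Qed.

(** Each step raises the lowest exponent. *)
Lemma Pstep_terminates nu m : Pdom nu m ->
  exists k, forall lam, point_lt lam nu -> in_vZv (iter k (Pstep nu) m lam).
Proof.
have [d] := lowb_exists nu m; elim: d m => [|d IH] m low Pm.
  exists 0%N => lam ll j j0 /=; apply/eqP; apply: contraT => nz.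
  by have := low lam j ll nz; lia.
have [small|nsmall] := pselect (forall lam, point_lt lam nu -> in_vZv (m lam)).
  by exists 0%N.
have [i0 lowi [lam ll nzl]] := low_exp_spec nsmall.
have [|k hk] := IH (Pstep nu m) _ (Pstep_dom Pm); last first.
  by exists k.+1 => kap; rewrite iterSr; exact: hk.
move=> kap j kl_ nz; have := Pstep_low i0 lowi kl_ nz; have := low lam _ ll nzl; lia.
Qed.

Lemma Pop_uN nu m : dominant nu -> Pdom nu m ->
  Pop (rs := rs) (l := l) kl m = uN nu.
Proof.
move=> dn Pm; rewrite /Pop; case: pselect => [e|[]]; last by exists nu.
case: cid => nu' /= Pm'; have -> : nu' = nu.
  have [_ mn supp] := Pm; have [_ mn' supp'] := Pm'.
  have [//|h] : nu' = nu \/ point_lt nu' nu by apply: supp; rewrite mn' oner_eq0.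
  have [//|h'] : nu = nu' \/ point_lt nu nu' by apply: supp'; rewrite mn oner_eq0.
  by have := point_lt_len (point_lt_trans h h'); rewrite ltnn.
rewrite /Piter; case: xgetP => [k _ hk|h]; last first.
  by have [k hk] := Pstep_terminates Pm; case: (h k).
have it j : Pdom nu (iter j (Pstep nu) m).
  by elim: j => [|j IH]; [exact: Pm | rewrite iterS; exact: Pstep_dom].
exact: (Pdom_unique dn (it k) hk).
Qed.

End PointModule.

(** * Counting the hyperplanes around a facet *)

Section Counting.
Variables (R : realType) (n : nat) (rs : root_system R n) (l : nat).
Hypothesis l_gt0 : (0 < l)%N.
Local Notation V := 'rV[R]_n.
Local Notation dot := (dot rs).
Local Notation affW := (affW rs l).
Local Notation lvl m := ((m : int)%:~R * l%:R : R).
Local Notation kf := (kf rs l).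
Local Notation len := (clength (affS rs l)).
Local Notation ue := (ue rs l).
Local Notation spec := (spec rs l).
Implicit Types (p y a b : V) (w : affW).

Definition pos_seq : seq V := [seq a <- root_seq rs | `[< pos_root rs a >]].

Lemma mem_pos_seq a : (a \in pos_seq) <-> pos_root rs a.
Proof.
rewrite mem_filter; split=> [/andP[/asboolP //]|pa]; apply/andP.
split; [exact/asboolP | apply/mem_root_seq; exact: pos_rootW].
Qed.

Lemma pos_seq_uniq : uniq pos_seq.
Proof. by rewrite filter_uniq // root_seq_uniq. Qed.

Lemma root_seq_pos : perm_eq (root_seq rs) (pos_seq ++ map -%R pos_seq).
Proof.
apply: uniq_perm; first exact: root_seq_uniq.
  rewrite cat_uniq pos_seq_uniq (map_inj_uniq oppr_inj) pos_seq_uniq andbT /=.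
  apply/hasPn => _ /mapP[a /mem_pos_seq pa ->]; apply/negP => /mem_pos_seq.
  exact: pos_rootN.
move=> a; rewrite mem_cat; apply/idP/orP.
  move=> /mem_root_seq ra; have [pa|pa] := root_pos_neg ra.
    by left; exact/mem_pos_seq.
  by right; apply/mapP; exists (- a); rewrite ?opprK //; exact/mem_pos_seq.
case=> [/mem_pos_seq pa|/mapP[b /mem_pos_seq pb ->]]; apply/mem_root_seq.
  exact: pos_rootW.
by apply: is_rootN; exact: pos_rootW.
Qed.

(** The number of hyperplanes separating the alcove above y from the fundamental alcove,
    on which all floors of positive roots are 0. *)
Lemma len_ue_kf y : len (ue y) = \sum_(a <- pos_seq) absz (kf a y).
Proof.
have := dist_len l_gt0 (ue y); rewrite /adist (perm_big _ root_seq_pos) big_cat /=.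
rewrite big_map; set s1 := (\sum_(a <- _) _)%N; set s2 := (\sum_(a <- _) _)%N.
have -> : s1 = \sum_(a <- pos_seq) absz (kf a y).
  rewrite /s1 big_seq [RHS]big_seq; apply: eq_bigr => a /mem_pos_seq pa.
  by rewrite ue_kf // fund_kf ?sub0r ?abszN //; exact: bpt_fund.
have -> : s2 = \sum_(a <- pos_seq) absz (kf a y).
  rewrite /s2 big_seq [RHS]big_seq; apply: eq_bigr => a /mem_pos_seq pa.
  rewrite !kfN //; [|exact: pos_rootW|exact: affW_regular|exact: pos_rootW|exact: bpt_regular].
  rewrite ue_kf // fund_kf //; last exact: bpt_fund.
  by congr absz; ring.
by rewrite addnn -mul2n => /eqP; rewrite eqn_pmul2l // => /eqP ->.
Qed.

(** That p lies on a hyperplane orthogonal to a, expressed by the only candidate. *)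
Definition on_hyp p a := dot p a == lvl (kf a p).

Lemma on_hypP p a : reflect (exists m, dot p a = lvl m) (on_hyp p a).
Proof.
apply: (iffP eqP) => [e|[m e]]; first by exists (kf a p).
rewrite e; congr (_%:~R * _); apply/esym/kfP => //; rewrite e // lvl_lt //; lia.
Qed.

Definition nneg p y : nat := count (fun a => on_hyp p a && (dot y a < dot p a)) pos_seq.
Definition npos p y : nat := count (fun a => on_hyp p a && (dot p a < dot y a)) pos_seq.

(** The alcove above y lies below that above p across the hyperplanes through p
    that have y on their negative side, and across no others. *)
Lemma len_spec p y : chamber rs p -> chamber rs y -> spec p y ->
  len (ue p) = (len (ue y) + nneg p y)%N.
Proof.
move=> Cp Cy py; rewrite !len_ue_kf.
have -> : nneg p y = \sum_(a <- pos_seq) nat_of_bool (on_hyp p a && (dot y a < dot p a)).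
  by rewrite /nneg -sum1_count big_mkcond; apply: eq_bigr => a _; case: ifP.
rewrite -big_split.
rewrite big_seq [RHS]big_seq; apply: eq_bigr => a /mem_pos_seq pa; have ra := pos_rootW pa.
have k0 := chamber_kf l_gt0 Cy pa; have k1 := chamber_kf l_gt0 Cp pa.
have /andP[k2 k3] := spec_kf l_gt0 ra py.
have : kf a p = kf a y + (on_hyp p a && (dot y a < dot p a))%:Z.
  rewrite /on_hyp; case: eqP => [e|ne] /=.
    rewrite e -kf_lt //; case: ltrP => h /=; lia.
  suff : ~~ (kf a y < kf a p) by lia.
  apply/negP; rewrite kf_lt // => /ltW /(spec_le ra py) h; apply: ne.
  by apply/eqP; rewrite eq_le h -kf_ge // lexx.
by case: (_ && _) => /= ->; lia.
Qed.

Lemma card_set_seq (T : choiceType) (A : set T) (r : seq T) : uniq r ->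
  (forall x, A x <-> x \in r) -> card_set A = size r.
Proof.
move=> ur Ar; have fA : finite_set A.
  by apply: (@sub_finite_set _ _ [set` r]); [move=> x /Ar | exact: finite_seq].
apply: perm_size; apply: uniq_perm => // x.
by rewrite in_fset_set //; apply/idP/idP => [/set_mem/Ar|/Ar h] //; exact: mem_set.
Qed.

(** The hyperplanes through p with normal a are at most one, so they are counted by roots. *)
Lemma num_through p (P : V -> bool) (Q : V * int -> Prop) :
    (forall a, pos_root rs a -> dot p a = lvl (kf a p) -> (Q (a, kf a p) <-> P a)) ->
  card_set [set q | [/\ is_hyp rs q, facet_of rs l p `<=` hyp rs l q & Q q]] =
  count (fun a => on_hyp p a && P a) pos_seq.
Proof.
move=> QP; rewrite (@card_set_seq _ _
    [seq (a, kf a p) | a <- pos_seq & on_hyp p a && P a]); last 2 first.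
- rewrite map_inj_in_uniq; last by move=> a b _ _ [].
  by rewrite filter_uniq // pos_seq_uniq.
- case=> a m; split=> /=.
    move=> [pa /(facet_hyp l_gt0 _ pa)]; rewrite /hyp /= => e Qa.
    have em : kf a p = m.
      by have /on_hypP/eqP : exists m, dot p a = lvl m; [exists m | rewrite e => /lvl_inj ->].
    rewrite -em in e Qa *; apply: map_f; rewrite mem_filter /on_hyp e eqxx /=.
    by rewrite (QP a) // in Qa *; rewrite Qa /=; apply/mem_pos_seq.
  move=> /mapP[b]; rewrite mem_filter => /andP[/andP[/eqP ob Pb] /mem_pos_seq pb] [-> ->].
  split=> //; last exact/QP.
  exact/facet_hyp.
by rewrite size_map size_filter.
Qed.

Lemma num_negE p y : num_neg rs l (facet_of rs l p) (facet_of rs l y) = nneg p y.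
Proof.
apply: num_through => a pa e; rewrite e.
exact: (@facet_neg_side _ _ _ _ l_gt0 y (a, kf a p) pa).
Qed.

Lemma num_posE p y : num_pos rs l (facet_of rs l p) (facet_of rs l y) = npos p y.
Proof.
apply: num_through => a pa e; rewrite e.
exact: (@facet_pos_side _ _ _ _ l_gt0 y (a, kf a p) pa).
Qed.

(** The hyperplanes that contain p but not y, each counted by its two normals, so
    that the count is visibly invariant. *)
Lemma nneg_npos p y : (nneg p y + npos p y).*2 =
  count (fun a => on_hyp p a && (dot y a != dot p a)) (root_seq rs).
Proof.
rewrite (seq.permP root_seq_pos) count_cat count_map.
have -> : count (preim -%R (fun a => on_hyp p a && (dot y a != dot p a))) pos_seq =
          count (fun a => on_hyp p a && (dot y a != dot p a)) pos_seq.
  apply: eq_count => a /=; rewrite !dotNr eqr_opp; congr (_ && _).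
  apply/on_hypP/on_hypP => [[m e]|[m e]]; exists (- m).
    by rewrite rmorphN mulNr -e dotNr opprK.
  by rewrite dotNr e rmorphN mulNr.
have -> : (nneg p y + npos p y)%N = count (fun a => on_hyp p a && (dot y a != dot p a)) pos_seq.
  rewrite /nneg /npos; elim: pos_seq => //= a r <-.
  by case: (on_hyp p a) => //=; case: (ltrgtP (dot y a) (dot p a)) => _ /=; lia.
by rewrite addnn.
Qed.

Lemma nneg_npos_aff w p y : (nneg (w p) (w y) + npos (w p) (w y) = nneg p y + npos p y)%N.
Proof.
apply: double_inj; rewrite !nneg_npos.
have pe : perm_eq (map (adj w) (root_seq rs)) (root_seq rs).
  apply: uniq_perm; rewrite ?(map_inj_uniq (@adj_inj _ _ _ _ w)) ?root_seq_uniq // => a.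
  apply/mapP/idP => [[b /mem_root_seq rb ->]|/mem_root_seq ra].
    by apply/mem_root_seq; exact: adj_root.
  exists (linp w a); last by rewrite /adj linpKV.
  by apply/mem_root_seq; exact: linp_root.
rewrite -[in RHS](seq.permP pe) count_map; apply: eq_in_count => a /mem_root_seq ra /=.
have [m mE] := dot_affW w ra; rewrite !mE (inj_eq (addIr _)); congr (_ && _).
apply/on_hypP/on_hypP => [[q e]|[q e]].
  by exists (q - m); rewrite rmorphB mulrBl -e mE addrK.
by exists (q + m); rewrite mE e rmorphD mulrDl.
Qed.

End Counting.

(** * From points to the Hecke module *)

Section Transfer.
Variables (R : realType) (n : nat) (rs : root_system R n) (l : nat).
Hypothesis l_gt0 : (0 < l)%N.
Local Notation min_rep := (min_rep (affS rs l) (finW rs l)).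
Local Notation bpt := (bpt rs l).
Local Notation el := (el rs l).
Local Notation spec := (spec rs l).
Local Notation dominant := (dominant rs).
Local Notation base_point := (base_point rs l).
Local Notation V := 'rV[R]_n.
Local Notation affW := (affW rs l).
Local Notation len := (clength (affS rs l)).
Local Notation ue := (ue rs l).
Local Notation rho := (rho rs).
Variables (Hk : hecke_algebra (affS rs l)) (N : induced_sign (finW rs l) Hk).
Variables (kl : affW -> affW -> laurent).
Hypothesis hkl : is_kl_family N kl.
Local Notation uN := (uN (rs := rs) (l := l) kl).
Local Notation nbar := (ind_bar (i := N)).
Local Notation KL := (KL N kl).
Local Notation pm := (pointmod rs).
Local Notation nb := (nb N).
Local Notation point_coef := (point_coef (rs := rs) (l := l)).
Implicit Types (lam mu nu kap f : V) (m : pm) (g w x : affW).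

(** A point of an orbit W f is sent to the combination of the N_g over the alcoves
    g A_+ around it, weighted so that the coefficients at the g with the same
    g f are those that the descent relations of the self-dual basis dictate. *)
Definition phi f m : N := lcomb (fun lam => lcomb nb (point_coef f (lam + rho))) m.

Definition phi_coef f m g : laurent :=
  vpow ((len (ue (g f)))%:Z - (len g)%:Z) * m (g f - rho).

Section Phi.
Variable f : V.
Hypothesis sf : spec f bpt.

Lemma point_coef_fin (p : V) : finite_set [set g | point_coef f p g != 0].
Proof.
have [[w wf]|no] := pselect (exists w : affW, w f = p).
  by apply: (point_coef_finite l_gt0 sf); exact: (ue_stab l_gt0 sf wf).
rewrite (_ : [set _ | _] = set0) ?finite_set0 // -subset0 => g /=.
by rewrite /point_coef; case: (eqVneq (g f) p) => [gf _|_]; [apply: no; exists g | rewrite eqxx].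
Qed.

Lemma phi_sum_coef m g :
  \sum_(lam <- suppseq m) m lam * point_coef f (lam + rho) g = phi_coef f m g.
Proof.
have E lam : lam != g f - rho -> m lam * point_coef f (lam + rho) g = 0.
  move=> h; rewrite /point_coef; case: (eqVneq (g f) (lam + rho)) => [e|_]; last by rewrite mulr0.
  by rewrite e addrK eqxx in h.
rewrite /phi_coef; have [kr|nkr] := boolP (g f - rho \in suppseq m).
  rewrite (bigD1_seq _ kr) ?suppseq_uniq //= big1; last by move=> lam; exact: E.
  by rewrite addr0 /point_coef subrK eqxx mulrC.
move: (nkr); rewrite mem_suppseq ?negbK; last exact: fm_finite.
move=> /eqP ->; rewrite mulr0 big1_seq // => lam /= lr; apply: E.
by apply: contraNneq nkr => <-.
Qed.

Lemma phi_coef_finite m : finite_set [set g | phi_coef f m g != 0].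
Proof.
under eq_set do rewrite -phi_sum_coef.
apply: sumf_finite => lam; apply: scalef_finite; exact: point_coef_fin.
Qed.

Lemma phiE m : phi f m = lcomb nb (phi_coef f m).
Proof.
have fc lam := scalef_finite (fun=> m lam) (point_coef_fin (lam + rho)).
rewrite -(lcomb_ext nb (phi_sum_coef m)) (lcomb_sum nb (suppseq m) fc).
rewrite /phi lcomb_suppE; last exact: fm_finite.
by apply: eq_bigr => lam _; rewrite (lcombZ nb (m lam) (point_coef_fin (lam + rho))).
Qed.

Lemma phi_coef_supp m g : phi_coef f m g != 0 ->
  [/\ m (g f - rho) != 0, min_rep g & (len g <= len (el (g f - rho)))%N].
Proof.
move=> h; have nz : m (g f - rho) != 0 by apply: contra h => /eqP e; rewrite /phi_coef e mulr0.
have Cg : chamber rs (g f) by have := fm_dom nz; rewrite /Defs.dominant /= subrK.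
have [Cb e] := len_ue l_gt0 Cg sf erefl; split=> //; first exact/(min_repP l_gt0).
by rewrite /el subrK e leq_addr.
Qed.

Lemma phi_coef_el m lam : base_point lam = f -> phi_coef f m (el lam) = m lam.
Proof.
move=> e; rewrite /phi_coef -e el_base_point addrK.
by rewrite /el subrr vpow0 mul1r.
Qed.

Lemma phiD m m' : phi f (m + m') = phi f m + phi f m'.
Proof. exact: (lcombD _ (fm_finite m) (fm_finite m')). Qed.

Lemma phiZ a m : phi f (a *: m) = a *: phi f m.
Proof. exact: (lcombZ _ a (fm_finite m)). Qed.

Lemma phi_sum I (r : seq I) (F : I -> pm) :
  phi f (\sum_(i <- r) F i) = \sum_(i <- r) phi f (F i).
Proof.
apply: (big_morph (phi f)) => [m m'|]; first exact: phiD.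
exact: lcomb0.
Qed.

End Phi.

(** The coefficients n_{g, x} for x = el mu are constant, up to the weights of phi,
    along the cosets of the stabiliser of the base point. *)
Lemma phi_uN mu : dominant mu -> phi (base_point mu) (uN mu) = KL (el mu).
Proof.
move=> dm; have sf : spec (base_point mu) bpt := base_point_spec l_gt0 mu.
have ef := el_base_point rs l mu; set f := base_point mu in sf ef *.
rewrite (phiE sf) /KL; apply: lcomb_ext => g; rewrite /phi_coef (uNE l_gt0 hkl _ dm).
have [Cg|nC] := pselect (chamber rs (g f)); last first.
  rewrite asboolF ?mulr0; last by rewrite /Defs.dominant /= subrK.
  apply/esym/eqP; apply: contraT => nz.
  have [mg _] := kl_neq0 hkl (el_min l_gt0 dm) nz.
  by case/eqP: nz; exact: (kl_coset_wall l_gt0 hkl sf dm ef).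
have dg : dominant (g f - rho) by rewrite /Defs.dominant /= subrK.
rewrite asboolT // (nptE l_gt0 _ dg dm) asboolT; last first.
  apply/linkedP; exists (g * (el mu)^-1)%g.
  by rewrite affWM_val -ef affWVK subrK.
have := kl_coset l_gt0 hkl sf dm ef Cg.
rewrite /el subrK => e; rewrite addrC vpowD -mulrA -e mulrA vpowNK mul1r //.
Qed.

Lemma self_dual0 : self_dual (rs := rs) (l := l) kl 0.
Proof.
rewrite -(lcomb0 (K := laurent) uN); apply: self_dual_ucomb => [|mu]; last exact: lbar0.
split=> [|mu]; last by rewrite /= eqxx.
by rewrite (_ : [set _ | _] = set0) // -subset0 => x /=; rewrite eqxx.
Qed.

(** Self-duality can be tested after applying phi: the coefficients of maximal length
    are then fixed by the involution, and subtracting the corresponding self-dual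
    basis elements lowers the length. *)
Lemma phi_self_dual f m : spec f bpt ->
  (forall lam, m lam != 0 -> base_point lam = f) ->
  nbar (phi f m) = phi f m -> self_dual (rs := rs) (l := l) kl m.
Proof.
move=> sf; have [d] : exists d, forall lam, m lam != 0 -> (len (el lam) < d)%N.
  exists (\max_(lam <- suppseq m) len (el lam)).+1 => lam nz; rewrite ltnS.
  by apply: leq_bigmax_seq => //; rewrite mem_suppseq //; exact: fm_finite.
elim: d m => [|d IH] m bd orb mb.
  suff -> : m = 0 by exact: self_dual0.
  by apply: fm_ext => lam; apply/eqP; apply: contraT => /bd.
pose c lam : laurent := if len (el lam) == d then m lam else 0.
have cm lam : c lam != 0 -> m lam != 0 /\ len (el lam) = d.
  by rewrite /c; case: (eqVneq (len (el lam)) d) => [e nz|_]; [split | rewrite eqxx].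
have fc : fdom rs c.
  split; last by move=> lam /cm[/fm_dom].
  by apply: sub_finite_set (fm_finite m) => lam /cm[].
have fcf := phi_coef_finite sf m.
have cb lam : lbar (c lam) = c lam.
  rewrite /c; case: eqP => [ed|_]; last exact: lbar0.
  have [->|nz] := eqVneq (m lam) 0; first exact: lbar0.
  have cmin g : phi_coef f m g != 0 -> min_rep g by move=> /(phi_coef_supp sf)[].
  have clen g : phi_coef f m g != 0 -> (len g <= len (el lam))%N.
    by move=> /(phi_coef_supp sf)[/bd h _ h']; rewrite ed; lia.
  have cbar : nbar (lcomb nb (phi_coef f m)) = lcomb nb (phi_coef f m).
    by rewrite -(phiE sf).
  have := top_coef_bar l_gt0 hkl fcf cmin cbar (el_min l_gt0 (fm_dom nz)) clen.
  by rewrite (phi_coef_el m (orb _ nz)).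
pose m1 := lcomb uN c.
have m1E kap : m1 kap = \sum_(lam <- suppseq c) c lam * (uN lam) kap.
  by apply: ucomb_eval; exact: fc.1.
have m1b : nbar (phi f m1) = phi f m1.
  have -> : phi f m1 = \sum_(lam <- suppseq c) c lam *: KL (el lam).
    rewrite /m1 lcomb_suppE ?phi_sum; last exact: fc.1.
    rewrite big_seq [RHS]big_seq; apply: eq_bigr => lam.
    rewrite mem_suppseq; last exact: fc.1.
    by move=> cl; have [nz _] := cm _ cl; rewrite phiZ -(orb _ nz) phi_uN //; exact: fm_dom nz.
  rewrite nbar_sum big_seq [RHS]big_seq; apply: eq_bigr => lam.
  rewrite mem_suppseq; last exact: fc.1.
  move=> cl; rewrite nbarZ cb (nbar_KL hkl) //; apply: (el_min l_gt0); exact: fc.2.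
have sm1 : self_dual (rs := rs) (l := l) kl m1 by exact: self_dual_ucomb.
have -> : m = (m - m1) + m1 by rewrite subrK.
apply: (self_dualD) => //; apply: IH; last first.
- rewrite -scaleN1r phiD phiZ ind_barD nbarZ mb m1b lbarN lbar1 //.
- move=> kap; rewrite fmEB; have [->|/orb //] := eqVneq (m kap) 0; rewrite sub0r oppr_eq0.
  rewrite m1E => nz; have [lam lr nzl] : exists2 lam, lam \in suppseq c & c lam * (uN lam) kap != 0.
    apply: contrapT => no; case/eqP: nz; apply: big1_seq => lam /= lr.
    by apply/eqP; apply: contraT => h; case: no; exists lam.
  have cl : c lam != 0 by apply: contra nzl => /eqP ->; rewrite mul0r.
  have [ml _] := cm _ cl; rewrite -(orb _ ml).
  have /(uN_neq0 l_gt0 hkl (fm_dom ml))[->//|] : (uN lam) kap != 0.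
    by apply: contra nzl => /eqP ->; rewrite mulr0.
  by move=> /point_ltE => /(_ l_gt0)[_ _ lk _]; exact: (base_point_linked l_gt0 lk).
- move=> kap; apply: contraR; rewrite -leqNgt => dk; apply/eqP; rewrite fmEB m1E.
  have other lam : lam \in suppseq c -> lam != kap -> c lam * (uN lam) kap = 0.
    rewrite mem_suppseq; last exact: fc.1.
    move=> cl lk; have [ml ed] := cm _ cl; apply/eqP; apply: contraT => nz.
    have /(uN_neq0 l_gt0 hkl (fm_dom ml))[e|/(point_lt_len l_gt0)] : (uN lam) kap != 0.
    + by apply: contra nz => /eqP ->; rewrite mulr0.
    + by rewrite e eqxx in lk.
    + by rewrite ed ltnNge dk.
  have [kr|nkr] := boolP (kap \in suppseq c).
    rewrite (bigD1_seq _ kr) ?suppseq_uniq //= big_seq_cond big1 ?addr0; last first.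
      by move=> lam /andP[]; exact: other.
    move: kr; rewrite mem_suppseq; last exact: fc.1.
    move=> ck; have [mk ed] := cm _ ck; rewrite (uN_diag l_gt0 hkl (fm_dom mk)) mulr1 /c ed eqxx.
    exact: subrr.
  rewrite big1_seq ?subr0; last first.
    by move=> lam /= lr; apply: other => //; apply: contraNneq nkr => <-.
  apply/eqP; apply: contraT => mk; move: nkr; rewrite mem_suppseq; last exact: fc.1.
  rewrite /c; have -> : len (el kap) == d by have := bd _ mk; rewrite eqn_leq dk andbT ltnS.
  by rewrite mk.
Qed.

End Transfer.

(** * One step of the path *)

Section StepGeometry.
Variables (R : realType) (n : nat) (rs : root_system R n) (l : nat).
Hypothesis l_gt0 : (0 < l)%N.
Local Notation V := 'rV[R]_n.
Local Notation dot := (dot rs).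
Local Notation lvl m := ((m : int)%:~R * l%:R : R).
Local Notation affW := (affW rs l).
Local Notation bpt := (bpt rs l).
Local Notation ue := (ue rs l).
Local Notation spec := (spec rs l).
Local Notation facet_of := (facet_of rs l).
Implicit Types (lam mu nu kap f p y : V) (g w x u z : affW).

(** A point in the closure of the facet of f0 lies on every wall through f0, so it is
    fixed by the stabiliser of f0. *)
Lemma stab_spec f f0 : spec f0 bpt -> spec f f0 -> forall u, u f0 = f0 -> u f = f.
Proof.
move=> sf0 ff0; apply: (stab_ind l_gt0 sf0 (K := fun u => u f = f)) => //.
move=> s u Ss sf _ _ uf; rewrite affWM_val uf.
have [b [q [wbq sE]]] := (affS_wallp l_gt0 s).1 Ss; have rbb := wallp_root wbq.
have e : dot f0 b = lvl q.
  have := dot_arefl_self l q f0 rbb; rewrite -sE sf; lra.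
rewrite sE; apply: arefl_fix => //; apply/eqP; rewrite eq_le.
rewrite (spec_le rbb ff0) ?e //=; apply: ff0 => //; by rewrite e.
Qed.

Lemma stab_spec_eq f f0 w z : spec f0 bpt -> spec f f0 -> w f0 = z f0 -> w f = z f.
Proof.
move=> sf0 ff0 e; have h : (z^-1 * w)%g f = f.
  by apply: (stab_spec sf0 ff0); rewrite affWM_val e affWVK.
by rewrite -{2}h affWM_val affWKV.
Qed.

Lemma spec_chamber p y : spec p y -> chamber rs p -> chamber rs y.
Proof.
move=> py Cp i; have si := simple_root rs i; rewrite ltNge; apply/negP => h.
have := @spec_le _ _ rs l p y (simple rs i) 0 si py; rewrite mul0r => /(_ h).
by rewrite leNgt Cp.
Qed.

Lemma facet_chamber p : facet_of p `<=` chamber rs <-> chamber rs p.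
Proof.
split=> [h|Cp y]; first by apply: h; exact: facet_of_refl.
rewrite facet_ofE // => py; apply: (spec_chamber (p := p)) Cp.
exact: same_facet_spec (same_facet_sym py).
Qed.

(** After transport of p to the closed fundamental alcove this is stab_ind; the conjugates
    of the simple reflections that fix f are reflections that fix p. *)
Lemma stab_reflections p u : u p = p ->
  generated [set g | exists q, [/\ is_hyp rs q, facet_of p `<=` hyp rs l q
                                 & g = hyp_refl rs l q]] u.
Proof.
set G := [set g | _]; move=> up; pose w := ue p; pose f := (w^-1)%g p.
have sf : spec f bpt.
  by rewrite -[X in spec _ X](affWVK w); apply: spec_aff => //; exact: spec_ue.
have wf : w f = p by exact: affWKV.
suff h : forall v : affW, v f = f -> generated G (w * v * w^-1)%g.
  have := h (w^-1 * u * w)%g; rewrite !affWM_val wf up => /(_ erefl).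
  by rewrite !mulgA mulgV mul1g mulgK.
apply: (stab_ind l_gt0 sf) => [|s v Ss sff vf _ IH].
  by rewrite mulg1 mulgV; exact: generated_id.
have -> : (w * (s * v) * w^-1 = (w * s * w^-1) * (w * v * w^-1))%g.
  by rewrite !mulgA mulgVK.
apply: generated_comp IH.
have [a [m [ra tE]]] : exists a m, is_root rs a /\ (w * s * w^-1)%g = arefl rs l a m.
  by apply: (creflection_arefl l_gt0); exists w, s.
have e : dot p a = lvl m.
  have := dot_arefl_self l m p ra; rewrite -tE !affWM_val -wf affWVK sff; lra.
have wlog_pos b q : pos_root rs b -> dot p b = lvl q -> G (arefl rs l b q).
  move=> pb eb; exists (b, q); split=> //; first exact/facet_hyp.
  by apply: funext => y; rewrite areflE //; exact: pos_rootW.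
rewrite tE; have [pa|pa] := root_pos_neg ra; first exact: wlog_pos.
rewrite -(areflN _ _ ra) //; apply: wlog_pos => //.
by rewrite dotNr e rmorphN mulNr.
Qed.

End StepGeometry.

Section Step.
Variables (R : realType) (n : nat) (rs : root_system R n) (l : nat).
Hypothesis l_gt0 : (0 < l)%N.
Local Notation V := 'rV[R]_n.
Local Notation dot := (dot rs).
Local Notation affW := (affW rs l).
Local Notation S := (affS rs l).
Local Notation len := (clength (affS rs l)).
Local Notation min_rep := (min_rep (affS rs l) (finW rs l)).
Local Notation bpt := (bpt rs l).
Local Notation ue := (ue rs l).
Local Notation el := (el rs l).
Local Notation spec := (spec rs l).
Local Notation rho := (rho rs).
Local Notation dominant := (dominant rs).
Local Notation linked := (linked rs l).
Local Notation base_point := (base_point rs l).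
Local Notation nneg := (nneg rs l).
Local Notation npos := (npos rs l).
Local Notation facet_of := (facet_of rs l).
Variables (Hk : hecke_algebra (affS rs l)) (N : induced_sign (finW rs l) Hk).
Variables (kl : affW -> affW -> laurent).
Hypothesis hkl : is_kl_family N kl.
Local Notation H := (hk_H Hk).
Local Notation bar := (@hk_bar _ _ Hk).
Local Notation T := (ind_tens N).
Local Notation nbar := (ind_bar (i := N)).
Local Notation nb := (nb N).
Local Notation uN := (uN (rs := rs) (l := l) kl).
Local Notation npt := (npt (rs := rs) (l := l) kl).
Local Notation pm := (pointmod rs).
Local Notation point_lt := (point_lt rs l).
Local Notation point_coef := (point_coef (rs := rs) (l := l)).
Local Notation phi := (phi N).
Implicit Types (lam nu kap gam y : V) (m : pm) (g w x u z : affW).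

Variables (mu Lam p0 : V).
Local Notation y0 := (mu + rho).
Local Notation y1 := (mu + rho + Lam).
Local Notation nu := (mu + Lam).
Hypothesis dmu : dominant mu.
Hypothesis FE : xget set0 [set F | admissible_via rs l mu Lam F] = facet_of p0.
Hypotheses (p0y0 : spec p0 y0) (p0y1 : spec p0 y1).
Hypothesis p0_between : forall a, pos_root rs a -> dot y0 a <= dot p0 a <= dot y1 a.

(** The alcoves above p0 and above y1 coincide (ME below), so f and f1 are the
    representatives of p0 and y1 in the closed fundamental alcove, and f0 is that of y0. *)
Let M : affW := ue p0.
Let f : V := (M^-1)%g p0.
Let f0 : V := base_point mu.
Let f1 : V := (M^-1)%g y1.

Let sf : spec f bpt.
Proof. rewrite -[X in spec _ X](affWVK M); apply: spec_aff => //; exact: spec_ue. Qed.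

Let Mf : M f = p0. Proof. exact: affWKV. Qed.

Let sf0 : spec f0 bpt. Proof. exact: base_point_spec. Qed.

Let ME : M = ue y1.
Proof.
apply: (ue_unique l_gt0) => a pa; have ra := pos_rootW pa; rewrite ue_kf //.
apply/eqP; rewrite eq_le; have /andP[-> _] := spec_kf l_gt0 ra p0y1; rewrite andbT.
by rewrite kf_ge //; have /andP[_] := p0_between pa; apply: le_trans; rewrite -kf_ge.
Qed.

Let nuE : nu + rho = y1. Proof. by rewrite addrAC. Qed.

Let elnu : el nu = M. Proof. by rewrite /el nuE ME. Qed.

Let f1E : base_point nu = f1. Proof. by rewrite /base_point elnu nuE. Qed.

Let sf1 : spec f1 bpt. Proof. rewrite -f1E; exact: base_point_spec. Qed.

Let Mf1 : M f1 = y1. Proof. exact: affWKV. Qed.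

Let ff1 : spec f f1. Proof. exact: spec_aff. Qed.

Let elmuf : el mu f = p0.
Proof.
pose f' := ((el mu)^-1)%g p0; have sf' : spec f' bpt.
  rewrite -[X in spec _ X](affWVK (el mu)); apply: spec_aff => //.
  have h : spec y0 (el mu bpt) by exact: spec_ue.
  exact: (spec_trans p0y0 h).
have e : f' = f.
  apply: (fund_domain l_gt0 (w := (M^-1 * el mu)%g) sf' sf).
  by rewrite affWM_val affWKV.
by rewrite -e affWKV.
Qed.

Let ff0 : spec f f0.
Proof.
have -> : f = ((el mu)^-1)%g p0 by rewrite -elmuf affWVK.
exact: spec_aff.
Qed.

Let Cy0 : chamber rs y0. Proof. exact: dmu. Qed.

Let Cp0 : chamber rs p0.
Proof.
by move=> i; have /andP[h _] := p0_between (simple_pos rs i); apply: lt_le_trans h; exact: Cy0.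
Qed.

Let dnu : dominant nu.
Proof. rewrite /Defs.dominant /= nuE; exact: (spec_chamber p0y1 Cp0). Qed.

Let el_f0 lam : linked lam mu -> el lam f0 = lam + rho.
Proof. by move=> ll; rewrite /f0 -(base_point_linked l_gt0 ll) el_base_point. Qed.

(** ** The operator F on basis elements *)

(** The points gam + rho in the orbit O_lam, for lam linked to mu, provided that the facet
    F', which contains el lam f, lies in the chamber. *)
Definition crossing lam gam := chamber rs (el lam f) /\
  exists z, z f = el lam f /\ z f1 = gam + rho.

Lemma fsum_Npt (A : set V) (c : V -> laurent) gam : finite_set A -> A `<=` dominant ->
  (\sum_(x \in A) c x *: Npt rs x) gam = if `[< A gam >] then c gam else 0.
Proof.
move=> fA AD; pose r := fset_set A : seq V.
have rE (x : V) : (x \in r) <-> A x.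
  by rewrite in_fset_set //; split=> [/set_mem|h] //; exact: mem_set.
rewrite (@fsum_comb _ _ _ _ _ _ r) ?fset_uniq //; last 2 first.
- by move=> x /rE.
- by move=> x Ax _; apply/rE.
rewrite fmE_sum; under eq_bigr do rewrite fmEZ.
transitivity (\sum_(x <- r) c x * (gam == x)%:R).
  by rewrite big_seq [RHS]big_seq; apply: eq_bigr => x /rE/AD dx; rewrite /Npt fmbasisE.
case: asboolP => [Ag|nA].
  have gr : gam \in r by exact/rE.
  rewrite (bigD1_seq gam) ?fset_uniq //= eqxx mulr1 big1 ?addr0 // => x.
  by rewrite eq_sym => /negbTE ->; rewrite mulr0.
rewrite big1_seq // => x /= /rE Ax; case: (eqVneq gam x) => [e|_]; last by rewrite mulr0.
by case: nA; rewrite e.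
Qed.

Lemma crossing_dominant lam gam : crossing lam gam -> dominant gam.
Proof.
move=> [Cp [z [zf zf1]]]; rewrite /Defs.dominant /= -zf1.
have sz : spec (z f) (z f1) by exact: spec_aff.
have Cz : chamber rs (z f) by rewrite zf.
exact: (spec_chamber sz Cz).
Qed.

Lemma crossing_finite lam : finite_set [set gam | crossing lam gam].
Proof.
apply: (@sub_finite_set _ _ [set` [seq (el lam * v)%g f1 - rho | v <- stab_seq rs l f]]);
  last exact: finite_seq.
move=> gam [_ [z [zf zf1]]] /=; apply/mapP; exists ((el lam)^-1 * z)%g.
  by rewrite mem_stab_seq // affWM_val zf affWVK.
by rewrite ?affWM_val affWKV zf1 addrK.
Qed.

(** The reflections through F' generate the stabiliser of the point el lam f of F', so O_lam
    is the set of the z f1 with z f = el lam f. *)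
Lemma Fterm_eval lam gam : linked lam mu ->
  (Fterm rs l Lam mu lam) gam = if `[< crossing lam gam >] then
    vpow ((nneg (el lam f) (gam + rho))%:Z - (npos (el lam f) (lam + rho))%:Z) else 0.
Proof.
move=> ll; rewrite /Fterm FE; case: xgetP => [w _ [Ww wE]|no]; last first.
  by have [w Ww wE] := ll; case: (no w).
pose u : affW := AffW (asboolT Ww); rewrite -[w]/(affW_val u).
have uy0 : u y0 = lam + rho by rewrite wE subrK.
have up0 : u p0 = el lam f.
  rewrite -elmuf -affWM_val; apply: (stab_spec_eq l_gt0 sf0 ff0).
  by rewrite affWM_val el_base_point uy0 el_f0.
rewrite (facet_of_aff l_gt0) up0; set p' := el lam f.
have OE y : (exists2 g, generated [set g | exists q, [/\ is_hyp rs q,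
      facet_of p' `<=` hyp rs l q & g = hyp_refl rs l q]] g & y = g (u y1)) <->
    exists z, z f = p' /\ z f1 = y.
  split=> [[g Gg ->]|[z [zf zf1]]].
    have [v [vE vp]] : exists v : affW, affW_val v = g /\ v p' = p'.
      elim: Gg => [|h k [q [hq Fq ->]] _ [v [<- vp]]]; first by exists 1%g.
      have rq := pos_rootW hq; exists (arefl rs l q.1 q.2 * v)%g; split.
        by apply: funext => x; rewrite /= areflE.
      by rewrite affWM_val vp; apply: arefl_fix => //; exact/(facet_hyp l_gt0 _ hq).
    exists (v * u * M)%g; rewrite !affWM_val Mf1 Mf up0 vp vE; split=> //.
  exists (z * (u * M)^-1)%g.
    have pE : (u * M)%g f = p' by rewrite affWM_val Mf.
    by apply: (stab_reflections l_gt0); rewrite affWM_val -{1}pE affWVK.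
  by rewrite affWM_val -Mf1 -(affWM_val u M) affWVK zf1.
have fcP := @facet_chamber _ _ rs l l_gt0 p'.
have [Cp|nC] := pselect (chamber rs p'); last first.
  rewrite !asboolF //; first by case.
  by move/fcP.
rewrite asboolT; last exact/fcP.
have AE : [set gam | [set y | exists2 g, generated [set g | exists q, [/\ is_hyp rs q,
      facet_of p' `<=` hyp rs l q & g = hyp_refl rs l q]] g & y = g (u y1)] (gam + rho)] =
    [set gam | crossing lam gam].
  apply/seteqP; split=> x /=; first by move=> /OE h; split.
  by move=> [_ h]; exact/OE.
rewrite AE fsum_Npt; [|exact: crossing_finite|by move=> x; exact: crossing_dominant].
by rewrite num_negE // num_posE.
Qed.

Lemma crossing_z lam gam z : crossing lam gam -> z f1 = gam + rho -> z f = el lam f.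
Proof. by move=> [_ [z' [<- e]]] e'; apply: (stab_spec_eq l_gt0 sf1 ff1); rewrite e' e. Qed.

Lemma Fterm_wall lam : linked lam mu -> ~ chamber rs (el lam f) ->
  Fterm rs l Lam mu lam = 0.
Proof. by move=> ll nC; apply: fm_ext => gam; rewrite Fterm_eval // asboolF // => -[]. Qed.

Lemma vpow_neq0 i : vpow i != 0.
Proof. by apply/eqP => e; have := vpowKN i; rewrite e mul0r => /esym/eqP; rewrite oner_eq0. Qed.

(** The count nneg in the exponent of F is the difference of length between the alcoves above
    el lam f and above gam + rho. *)
Lemma phi_Fterm lam : linked lam mu -> chamber rs (el lam f) ->
  phi f1 (Fterm rs l Lam mu lam) =
  vpow (- (npos (el lam f) (lam + rho))%:Z) *: lcomb nb (point_coef f (el lam f)).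
Proof.
move=> ll Cp; rewrite (phiE l_gt0 N sf1) -(lcombZ _ _ (point_coef_fin l_gt0 sf (el lam f))).
apply: lcomb_ext => g; rewrite /phi_coef Fterm_eval // subrK /point_coef.
case: (eqVneq (g f) (el lam f)) => [gf|ne]; last first.
  rewrite asboolF ?mulr0 // => h; case/eqP: ne; apply: (crossing_z h); by rewrite subrK.
have cr : crossing lam (g f1 - rho) by split=> //; exists g; rewrite subrK.
rewrite asboolT // -!vpowD; congr vpow.
have Cg : chamber rs (g f1) by have := crossing_dominant cr; rewrite /Defs.dominant /= subrK.
have pg : spec (el lam f) (g f1) by rewrite -gf; exact: spec_aff.
have := len_spec l_gt0 Cp Cg pg; lia.
Qed.

(** ** Self-duality of the image of a basis element *)

Let L : seq V := fset_set [set lam | dominant lam /\ npt lam mu != 0].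

Let LE lam : (lam \in L) <-> dominant lam /\ npt lam mu != 0.
Proof.
rewrite in_fset_set; last exact: (npt_finite l_gt0 hkl dmu).
by split=> [/set_mem|h] //; exact: mem_set.
Qed.

Let L_uniq : uniq L. Proof. exact: fset_uniq. Qed.

Let L_linked lam : lam \in L -> linked lam mu.
Proof. by move=> /LE[dl nz]; have [] := npt_el l_gt0 dl dmu nz. Qed.

(** The element F (uN mu). *)
Let Rsum : pm := \sum_(lam <- L) npt lam mu *: Fterm rs l Lam mu lam.

Lemma Fop_uN : Fop (rs := rs) (l := l) kl Lam (uN mu) = Rsum.
Proof.
rewrite /Fop (uN_linear_uN l_gt0 hkl) //; apply: fsum_comb; first exact: L_uniq.
  by move=> lam lL; split; [have [] := (LE lam).1 lL | exact: L_linked].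
by move=> lam [dl _] nz; apply/LE.
Qed.

(** The number of hyperplanes through p0 that do not contain y0; it is the same for all
    lam linked to mu (dE below). *)
Let d : nat := (nneg p0 y0 + npos p0 y0)%N.

Let dE lam : linked lam mu ->
  (nneg (el lam f) (lam + rho) + npos (el lam f) (lam + rho))%N = d.
Proof.
move=> ll; rewrite -(el_f0 ll) nneg_npos_aff // /d -{1 2}elmuf -(el_f0 (linked_refl _ _ _)).
by rewrite nneg_npos_aff.
Qed.

(** The alcoves around lam + rho are the el lam u with u in the stabiliser of f0; they have
    length l(el lam) - l(u), both KL_x and the symmetriser contribute a factor v^l(u), and
    the sum is the Poincare polynomial. *)
Lemma grouped_term lam : lam \in L ->
  \sum_(u <- stab_seq rs l f0)
     kl (el lam * u)%g (el mu) *: T (H (el lam * u)%g * bar (symm Hk f)) =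
  (vpow d * poinc rs l f0) *: (npt lam mu *: phi f1 (Fterm rs l Lam mu lam)).
Proof.
move=> lL; have ll := L_linked lL; have [dl nz] := (LE lam).1 lL.
have uf u : u \in stab_seq rs l f0 -> u f0 = f0 /\ u f = f.
  rewrite mem_stab_seq // => /eqP e; split=> //; exact: (stab_spec l_gt0 sf0 ff0).
have [Cp|nC] := pselect (chamber rs (el lam f)); last first.
  rewrite (Fterm_wall ll nC) big_seq big1 => [|u us].
    by rewrite -(scale0r (0 : pm)) phiZ !scale0r !scaler0.
  have [_ uff] := uf u us.
  have [->|k0] := eqVneq (kl (el lam * u)%g (el mu)) 0; first by rewrite scale0r.
  have [mg _] := kl_neq0 hkl (el_min l_gt0 dmu) k0.
  by rewrite (nb_barsymm_wall l_gt0 N sf mg) ?scaler0 // affWM_val uff.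
rewrite (phi_Fterm ll Cp) !scalerA /poinc mulr_sumr mulr_suml mulr_suml scaler_suml.
rewrite big_seq [RHS]big_seq; apply: eq_bigr => u us; have [uf0 uff] := uf u us.
set g := (el lam * u)%g; have gf : g f = el lam f by rewrite affWM_val uff.
have gf0 : g f0 = lam + rho by rewrite affWM_val uf0 el_f0.
have Cl : chamber rs (lam + rho) by [].
have Cg : chamber rs (g f) by rewrite gf.
rewrite (nb_barsymm l_gt0 N sf Cg) gf scalerA; congr (_ *: _).
have Cg0 : chamber rs (g f0) by rewrite gf0.
have := kl_coset l_gt0 hkl sf0 Cy0 (el_base_point rs l mu) Cg0.
rewrite gf0 -/(el lam) -/(el mu) => kg.
have nE : npt lam mu = kl (el lam) (el mu) by rewrite nptE // asboolT.
have kE : kl g (el mu) = vpow ((len (el lam))%:Z - (len g)%:Z) * npt lam mu.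
  by rewrite nE addrC vpowD -mulrA -kg mulrA vpowNK mul1r.
have [_ lenE] := len_ue l_gt0 Cl sf0 gf0.
have lu : len (g^-1 * ue (lam + rho))%g = len u.
  by rewrite /g invgM -mulgA mulVg mulg1 len_V.
rewrite lu -/(el lam) in lenE.
have lsp : len (ue (el lam f)) = (len (el lam) + nneg (el lam f) (lam + rho))%N.
  apply: len_spec => //; rewrite -(el_f0 ll); exact: spec_aff.
have := dE ll => dd.
have pw : vpow ((len (el lam))%:Z - (len g)%:Z) * vpow ((len (ue (el lam f)))%:Z - (len g)%:Z) =
    vpow d * vpow (len u + len u)%N * vpow (- (npos (el lam f) (lam + rho))%:Z).
  by rewrite -!vpowD; congr vpow; lia.
rewrite kE mulrAC pw; ring.
Qed.

(** The support of KL_x consists of alcoves around points lam + rho of the orbit of f0. *)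
Lemma grouped : T (lcomb H (kl^~ (el mu)) * bar (symm Hk f)) =
  (vpow d * poinc rs l f0) *: phi f1 Rsum.
Proof.
have fx := kl_finite hkl (el_min l_gt0 dmu).
have -> : T (lcomb H (kl^~ (el mu)) * bar (symm Hk f)) =
    lcomb (fun g => T (H g * bar (symm Hk f))) (kl^~ (el mu)).
  rewrite !lcomb_suppE // mulr_suml linear_sum; apply: eq_bigr => g _.
  by rewrite -scalerAl linearZ.
rewrite (lcomb_seq _ (r := [seq (el lam * u)%g | lam <- L, u <- stab_seq rs l f0])).
- rewrite big_allpairs_dep /Rsum phi_sum scaler_sumr big_seq [RHS]big_seq.
  by apply: eq_bigr => lam lL; rewrite grouped_term // phiZ.
- apply: allpairs_uniq; [exact: L_uniq | exact: stab_seq_uniq |].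
  move=> [lam u] [lam' u'] /allpairsP[[x v] /= [xL vs [-> ->]]].
  move=> /allpairsP[[x' v'] /= [xL' vs' [-> ->]]] /= e.
  have h (z : V) (w : affW) : z \in L -> w \in stab_seq rs l f0 -> (el z * w)%g f0 = z + rho.
    by move=> zL; rewrite mem_stab_seq // affWM_val => /eqP ->; rewrite el_f0 //; exact: L_linked.
  have xx : x = x' by apply: (addIr rho); rewrite -(h x v) // e h.
  rewrite xx in e *; congr (_, _); apply: (mulgI (el x')); exact: e.
- move=> g k0; have [mg _] := kl_neq0 hkl (el_min l_gt0 dmu) k0.
  have [Cg|nC] := pselect (chamber rs (g f0)); last first.
    by case/eqP: k0; exact: (kl_coset_wall l_gt0 hkl sf0 Cy0 (el_base_point rs l mu)).
  have kg := kl_coset l_gt0 hkl sf0 Cy0 (el_base_point rs l mu) Cg.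
  have dl : dominant (g f0 - rho) by rewrite /Defs.dominant /= subrK.
  have ll : linked (g f0 - rho) mu.
    by apply/linkedP; exists (g * (el mu)^-1)%g; rewrite affWM_val subrK.
  apply/allpairsP; exists (g f0 - rho, ((el (g f0 - rho))^-1 * g)%g); split => /=.
  + apply/LE; split; first exact: dl.
    rewrite (nptE l_gt0 kl dl dmu) (asboolT ll) /el subrK.
    apply: contra k0 => /eqP k1; move: kg; rewrite k1 mulr0 => /laurent_mulf_eq0[/eqP|->//].
    by rewrite (negbTE (vpow_neq0 _)).
  + have gE : el (g f0 - rho) f0 = g f0 by rewrite el_f0 // subrK.
    rewrite mem_stab_seq // affWM_val; apply/eqP.
    by apply: (can_inj (affWVK (el (g f0 - rho)))); rewrite affWKV gE.
  + by rewrite mulgA mulgV mul1g.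
Qed.

Lemma Rsum_neq0 gam : Rsum gam != 0 -> exists lam, [/\ lam \in L,
  (el lam = el mu \/ (len (el lam) < len (el mu))%N),
  bruhat_le S (el lam) (el mu) & crossing lam gam].
Proof.
move=> nz; have [lam lL nzl] : exists2 lam, lam \in L &
    npt lam mu * (Fterm rs l Lam mu lam) gam != 0.
  apply: contrapT => no; case/eqP: nz; rewrite /Rsum fmE_sum; apply: big1_seq => lam /= lL.
  by apply/eqP; apply: contraT => h; case: no; exists lam.
have ll := L_linked lL; have [dl nl] := (LE lam).1 lL.
have [_ kn] := npt_el l_gt0 dl dmu nl.
have [_ ble] := kl_neq0 hkl (el_min l_gt0 dmu) kn.
exists lam; split=> //; first by have [] := bruhat_length ble; [left | right].
apply: contrapT => nc; case/eqP: nzl; by rewrite Fterm_eval // asboolF // mulr0.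
Qed.

(** M = el nu has maximal length in the coset of the stabiliser of f, and this coset
    contains el mu: by the lifting property the elements of W below el mu stay below
    M after translation by that stabiliser. *)
Lemma Rsum_supp gam : Rsum gam != 0 -> gam = nu \/ point_lt gam nu.
Proof.
move=> /Rsum_neq0[lam [lL _ ble cr]]; have ll := L_linked lL.
have dg := crossing_dominant cr; have [Cp [z [zf zf1]]] := cr.
have lg : linked gam nu.
  by apply/linkedP; exists (z * M^-1)%g; rewrite affWM_val nuE.
have elg1 : el gam f1 = gam + rho.
  by rewrite -f1E -(base_point_linked l_gt0 lg) el_base_point.
have elg := crossing_z cr elg1.
have Mmax s : S s -> s f = f -> len M = (len (M * s)%g).+1.
  by move=> Ss sff; exact: (ue_max l_gt0 Cp0 sf Mf Ss sff).
have cm := bruhat_coset_max l_gt0 sf Mmax.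
have muM : bruhat_le S (el mu) M.
  have := cm (M^-1 * el mu)%g _ M (bruhat_refl _ _); rewrite mulgA mulgV mul1g; apply.
  by rewrite affWM_val elmuf.
have : bruhat_le S (el gam) M.
  have := cm ((el lam)^-1 * el gam)%g _ (el lam) (bruhat_trans ble muM).
  by rewrite mulgA mulgV mul1g; apply; rewrite affWM_val elg affWVK.
rewrite -elnu => bg; have [e|ne] := pselect (el gam = el nu).
  by left; exact: (linked_el_eq l_gt0 lg e).
by right; apply/(point_ltE rs l_gt0); split; [exact: dg | exact: dnu | exact: lg | split; [exact: bg | exact: ne]].
Qed.

Let npos0 : npos p0 y0 = 0%N.
Proof.
apply/eqP; rewrite /npos -leqn0 leqNgt -has_count; apply/hasPn => a /mem_pos_seq pa.
by have /andP[h _] := p0_between pa; rewrite negb_and -leNgt h orbT.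
Qed.

Let nneg1 : nneg p0 y1 = 0%N.
Proof.
apply/eqP; rewrite /nneg -leqn0 leqNgt -has_count; apply/hasPn => a /mem_pos_seq pa.
by have /andP[_ h] := p0_between pa; rewrite negb_and -leNgt h orbT.
Qed.

(** Only the term of mu itself reaches nu: going from lam to nu crosses at most as many
    hyperplanes as going from mu to nu. *)
Lemma Rsum_top : Rsum nu = 1.
Proof.
have muL : mu \in L.
  apply/LE; split=> //; rewrite nptE // asboolT; last exact: linked_refl.
  by rewrite (kl_diag hkl (el_min l_gt0 dmu)) oner_eq0.
rewrite /Rsum fmE_sum; under eq_bigr do rewrite fmEZ.
rewrite (bigD1_seq mu) ?L_uniq //= big_seq_cond big1 => [|lam /andP[lL lm]].
  rewrite addr0 Fterm_eval; last exact: linked_refl.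
  rewrite asboolT; last by split; [rewrite elmuf | exists M; rewrite Mf elmuf Mf1 nuE].
  rewrite elmuf nuE npos0 nneg1 subrr vpow0 mulr1 nptE // asboolT; last exact: linked_refl.
  exact: (kl_diag hkl (el_min l_gt0 dmu)).
apply/eqP; apply: contraT => nz.
have ll := L_linked lL; have [dl nl] := (LE lam).1 lL.
have cr : crossing lam nu.
  apply: contrapT => nc; case/eqP: nz; by rewrite Fterm_eval // asboolF // mulr0.
have e : el lam f = p0 by rewrite -(crossing_z cr (z := M)) ?Mf1 ?nuE.
have h1 := len_spec l_gt0 Cp0 Cy0 p0y0.
have pl : spec p0 (lam + rho) by rewrite -e -(el_f0 ll); exact: spec_aff.
have Cl : chamber rs (lam + rho) by [].
have h2 := len_spec l_gt0 Cp0 Cl pl; have h3 := dE ll; rewrite e in h3.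
have [_ kn] := npt_el l_gt0 dl dmu nl.
have [_ ble] := kl_neq0 hkl (el_min l_gt0 dmu) kn.
have [e2|h4] := bruhat_length ble; first by rewrite (linked_el_eq l_gt0 ll e2) eqxx in lm.
move: h1 h2 h3 h4; rewrite /d npos0 /el; lia.
Qed.

Lemma Rsum_base gam : Rsum gam != 0 -> base_point gam = f1.
Proof.
move=> /Rsum_supp[->|/(point_ltE rs l_gt0)[_ _ lg _]]; rewrite -f1E //.
exact: base_point_linked.
Qed.

(** With P the Poincare polynomial of the stabiliser of f, the self-duality of KL_x gives
    bar P X = P bar X for the element X = c Y of grouped, with Y = phi f1 Rsum.  So Y and bar Y
    are proportional, with factor 1 because Y has leading coefficient 1, and the module is
    torsion free. *)
Lemma Rsum_self_dual : self_dual (rs := rs) (l := l) kl Rsum.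
Proof.
apply: (phi_self_dual l_gt0 hkl sf1 Rsum_base).
set Y := phi f1 Rsum; pose X := T (lcomb H (kl^~ (el mu)) * bar (symm Hk f)).
pose P := poinc rs l f; pose c := vpow d * poinc rs l f0.
have mmu := el_min l_gt0 dmu.
have XE : X = c *: Y := grouped.
have X' : nbar (T (lcomb H (kl^~ (el mu)) * symm Hk f)) = X.
  exact: (act_bar hkl (symm Hk f) mmu (KL_tens hkl mmu)).
have PX : lbar P *: X = P *: nbar X.
  have e : P *: T (lcomb H (kl^~ (el mu)) * symm Hk f) = lbar P *: X.
    transitivity (T (P *: (lcomb H (kl^~ (el mu)) * symm Hk f))); first by rewrite linearZ.
    by rewrite scalerAr (poinc_symm l_gt0 Hk sf) -scalerAr linearZ.
  by have := congr1 nbar e; rewrite !nbarZ lbarK X'.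
have AB : (lbar P * c) *: Y = (P * lbar c) *: nbar Y.
  by rewrite -(scalerA (lbar P)) -(scalerA P) -nbarZ -XE.
have mM : min_rep M by rewrite -elnu; exact: el_min.
have Yc := phiE l_gt0 N sf1 Rsum; rewrite -/Y in Yc.
have fY := phi_coef_finite l_gt0 sf1 Rsum.
have supp g : phi_coef f1 Rsum g != 0 -> min_rep g /\ (len g < (len M).+1)%N.
  move=> /(phi_coef_supp l_gt0 sf1)[nz mg lg]; split=> //; apply: leq_ltn_trans lg _.
  rewrite ltnS -elnu; have [->|/(point_lt_len l_gt0)/ltnW] := Rsum_supp nz; exact.
have YM : ncoef M Y = 1.
  rewrite Yc ncoef_lcomb //; last by move=> g /supp[].
  by rewrite -elnu phi_coef_el ?Rsum_top.
have bY : below (len M).+1 Y by exists (phi_coef f1 Rsum); split.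
have E : lbar P * c = P * lbar c.
  have := congr1 (ncoef M) AB; rewrite !ncoefZ // (ncoef_nbar l_gt0 hkl) // YM lbar1.
  by rewrite !mulr1.
apply/eqP; rewrite -subr_eq0; apply/eqP.
apply: (torsion_free l_gt0 (a := lbar P * c)); last by rewrite scalerBr AB E subrr.
have nP : lbar P != 0.
  apply: contra (poinc_neq0 l_gt0 sf) => /eqP e.
  by rewrite -/P -(lbarK P) e lbar0.
have nc : c != 0.
  apply/eqP => /laurent_mulf_eq0[/eqP|/eqP]; first by rewrite (negbTE (vpow_neq0 _)).
  by rewrite (negbTE (poinc_neq0 l_gt0 sf0)).
by apply/eqP => /laurent_mulf_eq0[/eqP|/eqP]; [rewrite (negbTE nP) | rewrite (negbTE nc)].
Qed.

Lemma Fop_dom : Pdom (rs := rs) (l := l) kl nu (Fop (rs := rs) (l := l) kl Lam (uN mu)).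
Proof.
rewrite Fop_uN; split; [exact: Rsum_self_dual | exact: Rsum_top | exact: Rsum_supp].
Qed.

End Step.

(** * Paths *)

Section Path.
Variables (R : realType) (n : nat) (rs : root_system R n).
Local Notation V := 'rV[R]_n.
Local Notation dot := (dot rs).
Local Notation rho := (rho rs).
Implicit Types (mu Lam a : V).

Lemma closure_chamber_ge0 Lam a : closure (chamber rs) Lam -> pos_root rs a ->
  0 <= dot Lam a.
Proof.
move=> cL pa; apply: (closure_dot_ge cL) => z Cz; exact: ltW (dot_pos_gt0 Cz pa).
Qed.

(** rho and theta are dominant. *)
Lemma dual_coxeter_ge1 : 1 <= dual_coxeter rs.
Proof.
rewrite /dual_coxeter lerDl -mulrA mulr_ge0 // divr_ge0 //; last first.
  by rewrite ltW // root_gt0 //; exact: theta_root.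
have -> : rho = 2^-1 *: \sum_(a <- pos_seq rs) a.
  rewrite /Defs.rho; congr (_ *: _); apply: (fsum_seq (pos_seq_uniq rs)).
    by move=> a /mem_pos_seq.
  by move=> a pa _; exact/mem_pos_seq.
rewrite dotZl mulr_ge0 ?invr_ge0 // dotC dot_sumr big_seq sumr_ge0 // => a /mem_pos_seq.
apply: dot_pos_ge0; exact: theta_dominant.
Qed.

Variable l : nat.
Hypothesis l_gt0 : (0 < l)%N.

(** For p0 take a point where the segment meets the intermediate facet. *)
Lemma admissible_point mu Lam : closure (chamber rs) Lam -> admissible rs l mu Lam ->
  exists p0, [/\ xget set0 [set F | admissible_via rs l mu Lam F] = facet_of rs l p0,
    spec rs l p0 (mu + rho), spec rs l p0 (mu + rho + Lam)
    & forall a, pos_root rs a ->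
        dot (mu + rho) a <= dot p0 a <= dot (mu + rho + Lam) a].
Proof.
move=> cL [F0 adm]; case: xgetP => [F _ [fF F0c F1c [p0 [[t /= t01 tE] Fp]] _]|no].
  have FE : F = facet_of rs l p0 by rewrite (facetE l_gt0 fF Fp) facet_ofE.
  exists p0; split=> //.
  - by apply: (facet_closure_spec l_gt0); rewrite -FE.
  - by apply: (facet_closure_spec l_gt0); rewrite -FE.
  move=> a pa; have L0 := closure_chamber_ge0 cL pa.
  have /andP[t0 t1] : 0 <= t <= 1 by move: t01; rewrite in_itv.
  rewrite -tE (dotDl _ _ (t *: Lam)) (dotDl _ _ Lam) dotZl lerDl lerD2l mulr_ge0 //=.
  exact: ler_piMl.
by case: (no F0).
Qed.

End Path.

Theorem corollary3p1 (R : realType) (n : nat) (rs : root_system R n) (l : nat)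
    (hl : dual_coxeter rs < l%:R)
    (Hk : hecke_algebra (affS rs l))
    (N : induced_sign (finW rs l) Hk)
    (kl : affW rs l -> affW rs l -> laurent)
    (hkl : is_kl_family N kl)
    (mu Lam : 'rV[R]_n)
    (hmu : dominant rs mu)
    (hLam : closure (chamber rs) Lam)
    (k : nat) (mu_ : nat -> 'rV[R]_n)
    (mu_start : mu_ 0%N = mu)
    (mu_end : mu_ k = mu + Lam)
    (mu_steps : forall i, (i < k)%N ->
       closure (chamber rs) (mu_ i.+1 - mu_ i) /\
       admissible rs l (mu_ i) (mu_ i.+1 - mu_ i)) :
  Top kl Lam (uN kl mu) = path_op kl mu_ k (uN kl mu).
Proof.
have l_gt0 : (0 < l)%N.
  by rewrite -(ltr_nat R); apply: lt_trans hl; apply: lt_le_trans (dual_coxeter_ge1 rs).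
rewrite /Top (uN_linear_uN l_gt0 hkl) // -mu_end.
suff [_ ->] : dominant rs (mu_ k) /\ path_op kl mu_ k (uN kl mu) = uN kl (mu_ k) by [].
elim: {-2}k (leqnn k) => [|i IH] ik; first by rewrite mu_start.
have [di Ei] := IH (ltnW ik); have [cL adm] := mu_steps i ik.
have [p0 [FE p0y0 p0y1 p0b]] := admissible_point l_gt0 cL adm.
have := Fop_dom l_gt0 hkl di FE p0y0 p0y1 p0b.
rewrite addrC subrK => Pd; have [_ Pd1 _] := Pd.
have /fm_dom dnu : Fop kl (mu_ i.+1 - mu_ i) (uN kl (mu_ i)) (mu_ i.+1) != 0.
  by rewrite Pd1 oner_eq0.
split=> //=.
by rewrite Ei (Pop_uN l_gt0 hkl dnu Pd).
Qed.
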